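(* Let the two-patch geometry $\mathbf F^{(L)},\mathbf F^{(R)}$, the gluing data $\alpha^{(S)},\beta^{(S)}$, the projector $P_h$, the approximated gluing data $\widetilde\alpha^{(S)},\widetilde\beta^{(S)}$ and the interface space $\widetilde{\mathcal A}_\Gamma$ be as in the context. Assume that $\alpha^{(S)},\beta^{(S)}\in C^{\hat r_2-1}([0,1])$ for $S\in\{L,R\}$ and that $h_2$ is small enough, namely such that $$\frac{|\alpha^{(S)}(v)-\widetilde\alpha^{(S)}(v)|}{|\alpha^{(S)}(v)|}\le \varepsilon<1\qquad\text{for all } v\in[0,1],\ S\in\{L,R\},$$ for some fixed $\varepsilon<1$. Then there is a constant $C>0$, depending on the geometry but not on the mesh size (the degrees, the regularities, $\varepsilon$ and the constants in the properties of $P_h$ being fixed), such that for all $\varphi_h\in\widetilde{\mathcal A}_\Gamma$ $$\left\|\,[\![\partial_{\mathbf n}\varphi_h]\!]\,\right\|_{L^2(\Gamma)}\le C\,h_2^{\widetilde p+1}\left(\|\varphi_h\|_{H^2(\Omega^{(R)})}^2+\|\varphi_h\|_{H^2(\Omega^{(L)})}^2\right)^{1/2}.$$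
   Context: **Spline spaces.** For integers $p,n\ge1$, $r<p$ and $h=1/n$, $\mathcal S(p,r,h)$ is the space of $f\in C^r([0,1])$ that are polynomial of degree $\le p$ on each $(ih,(i+1)h)$, $i=0,\dots,n-1$. If $\hat h=kh$ with a positive integer $k$ (and $1/\hat h$ an integer), $\mathcal S(p,(r,\hat r),(h,\hat h))$ is the space of functions on $[0,1]$ that are polynomial of degree $\le p$ on each $(ih,(i+1)h)$ and, across each inner knot $ih$, are $C^{\hat r}$ if $ih=j\hat h$ for some integer $j$, and $C^r$ otherwise. B-spline bases are taken with respect to the corresponding open knot vectors (end knots $0,1$ repeated $p+1$ times; an inner knot of regularity $\rho$ has multiplicity $p-\rho$). **Geometry.** $\Omega\subset\mathbb R^2$ is a bounded open set with $\overline\Omega=\overline{\Omega^{(L)}}\cup\overline{\Omega^{(R)}}$, where $\Omega^{(L)},\Omega^{(R)}$ are disjoint open sets, and $\Gamma=\partial\Omega^{(L)}\cap\partial\Omega^{(R)}\cap\Omega$. For $S\in\{L,R\}$, $\mathbf F^{(S)}:[0,1]^2\to\overline{\Omega^{(S)}}$ is bijective with both components in $\mathcal S(\hat p_1^{(S)},\hat r_1^{(S)},\hat h_1^{(S)})\otimes\mathcal S(\hat p_2,\hat r_2,\hat h_2)$, all regularities being $\ge1$ (the second factor is the same for both patches), and $|\det\nabla\mathbf F^{(S)}|\ge c>0$ on $[0,1]^2$. The interface is parametrized by $u=0$ on both patches, with $\mathbf F^{(L)}(0,v)=\mathbf F^{(R)}(0,v)$ for all $v\in[0,1]$. Put $\mathbf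 t(v)=\partial_v\mathbf F^{(S)}(0,v)$, $\tau=\|\mathbf t\|$, $\mathbf t_0=\mathbf t/\tau$; $\mathbf n=\mathbf n^{(L)}=-\mathbf n^{(R)}$ is the unit normal on $\Gamma$, with $\mathbf n^{(S)}$ the outward unit normal to $\Omega^{(S)}$. **Gluing data.** $\alpha^{(S)}(v)=\det(\partial_u\mathbf F^{(S)}(0,v),\mathbf t(v))$ and $\beta^{(S)}(v)=\dfrac{\partial_u\mathbf F^{(S)}(0,v)\cdot\mathbf t_0(v)}{\tau(v)}$. The orientation is such that $\alpha^{(L)}<0<\alpha^{(R)}$ on $[0,1]$. It is assumed throughout that $\alpha^{(S)},\beta^{(S)}\in C^1([0,1])$ and that the gluing data are not polynomial functions. **Approximated gluing data.** Fix $1\le\widetilde r\le\widetilde p-1$. Here $h_2$ is the mesh size of the discretization in the $v$-direction, with $\hat h_2=kh_2$. $P_h: C^{\hat r_2-1}([0,1])\to \mathcal S(\widetilde p,(\widetilde r,\hat r_2-1),(h_2,\hat h_2))$ is a projection operator such that: (i) $P_hs=s$ for all $s$ in the target spline space; (ii) $\|P_hs\|_{L^\infty([0,1])}\le C\|s\|_{L^\infty([0,1])}$ for all $s\in C^{\hat r_2-1}([0,1])$; (iii) $(P_hs)(\bar v)=s(\bar v)$ for $\bar v\in\{0,1\}$; (iv) for each $\hat\omega_j=[j\hat h_2,(j+1)\hat h_2]$, $0\le j\le 1/\hat h_2-1$, $\|s-P_hs\|_{L^\infty(\hat\omega_j)}\le Ch_2^{\widetilde p+1}\|s^{(\widetilde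 p+1)}\|_{L^\infty(\hat\omega_j)}$ for all $s$ (in the domain of $P_h$) that are $C^\infty$ on each $\hat\omega_j$. The constants $C$ in (ii), (iv) do not depend on $h_2$ or $s$. Put $\widetilde\alpha^{(S)}=P_h\alpha^{(S)}$, $\widetilde\beta^{(S)}=P_h\beta^{(S)}$. **Interface space.** The discretization space on patch $S$ is $\mathcal S_1^{(S)}\otimes\mathcal S_2$ with $\mathcal S_1^{(S)}=\mathcal S(p_1^{(S)},(r_1^{(S)},\hat r_1^{(S)}),(h_1^{(S)},\hat h_1^{(S)}))$ and $\mathcal S_2=\mathcal S(p_2,(r_2,\hat r_2),(h_2,\hat h_2))$, where $p_1^{(S)}\ge\hat p_1^{(S)}$, $p_2\ge\max(\hat p_2,3)$, $1\le r_1^{(S)}\le p_1^{(S)}-1$, $1\le r_2\le p_2-1$. Let $b_{1,1}^{(S)},b_{1,2}^{(S)}$ be the first two B-splines of $\mathcal S_1^{(S)}$. Let $\{b_j^+\}_{j=1}^{N_+}$ and $\{b_j^-\}_{j=1}^{N_-}$ be the B-spline bases of $\mathcal S^+=\mathcal S(p_2,(p_2-1,\hat r_2),(h_2,\hat h_2))$ and $\mathcal S^-=\mathcal S(p_2-1,(p_2-2,\hat r_2-1),(h_2,\hat h_2))$. Define on $[0,1]^2$ $$\widetilde f^{(S)}_{(j,+)}(u,v)=b_j^+(v)\big(b_{1,1}^{(S)}(u)+b_{1,2}^{(S)}(u)\big)+\widetilde\beta^{(S)}(v)(b_j^+)'(v)\tfrac{h_1^{(S)}}{p_1^{(S)}}b_{1,2}^{(S)}(u),$$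 $$\widetilde f^{(S)}_{(j,-)}(u,v)=\widetilde\alpha^{(S)}(v)b_j^-(v)\tfrac{h_1^{(S)}}{p_1^{(S)}}b_{1,2}^{(S)}(u),$$ and let $\widetilde B_{(j,\pm)}$ be the function on $\Omega$ equal to $\widetilde f^{(S)}_{(j,\pm)}\circ(\mathbf F^{(S)})^{-1}$ on $\Omega^{(S)}$, $S\in\{L,R\}$ (extended continuously to $\Gamma$). Then $\widetilde{\mathcal A}_\Gamma=\mathrm{span}\{\widetilde B_{(j,+)}\}_{j=1}^{N_+}\oplus\mathrm{span}\{\widetilde B_{(j,-)}\}_{j=1}^{N_-}$. It is a standing requirement that $\widetilde f^{(S)}_{(j,\pm)}\in C^1([0,1]^2)$ (this holds e.g. if $\hat r_2\ge2$ or if $\hat h_2=1$). **Jump.** For $\mathbf x\in\Gamma$, $\partial_{\mathbf n}\varphi_h^{(S)}(\mathbf x)=\lim_{\Omega^{(S)}\ni\mathbf y\to\mathbf x}\nabla\varphi_h(\mathbf y)\cdot\mathbf n$ and $[\![\partial_{\mathbf n}\varphi_h]\!]=\partial_{\mathbf n}\varphi_h^{(R)}-\partial_{\mathbf n}\varphi_h^{(L)}$. *)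

(* Defs.v *)
(* Functions on [0,1], on [0,1]^2 and on planar domains are total functions of
   which only the values on the domain in question matter. *)
From HB Require Import structures.
From mathcomp Require Export all_boot all_order all_algebra.
From mathcomp Require Export all_classical all_reals all_analysis.
Export Order.TTheory GRing.Theory Num.Theory.
Export numFieldNormedType.Exports.

Set Implicit Arguments.
Unset Strict Implicit.
Unset Printing Implicit Defensive.

#[global] Open Scope classical_set_scope.
#[global] Open Scope ring_scope.

Inductive patch := PL | PR.

Section Calculus.
Context {R : realType}.

(* Derivative relative to [0,1]: one-sided at the end points.  The library's
   two-sided derivative would be meaningless at 0 and 1. *)
Definition D01 (f : R -> R) (v : R) : R :=
  lim ((fun w => (f w - f v) / (w - v)) @ within `[0, 1] v^').

(* f in C^k([a,b]): the derivatives of order <= k exist on the open interval and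
   extend continuously to [a,b]; g i is the (extended) i-th derivative. *)
Definition Ck (k : nat) (a b : R) (f : R -> R) : Prop :=
  exists g : nat -> R -> R,
    [/\ forall x, x \in `[a, b] -> g 0%N x = f x,
        forall i, (i <= k)%N -> {within `[a, b], continuous (g i)}
      & forall i x, (i < k)%N -> x \in `]a, b[ ->
          is_derive x 1 (g i) (g i.+1 x)].

Definition Cinfty (a b : R) (f : R -> R) : Prop := forall k, Ck k a b f.

Definition Linfty_norm (a b : R) (f : R -> R) : \bar R :=
  Lnorm (@lebesgue_measure R) +oo%E (EFin \o (f \_ `[a, b])).

Definition is_poly01 (f : R -> R) : Prop :=
  exists q : {poly R}, forall v, v \in `[0, 1] -> f v = q.[v].

Definition square : set (R * R) := `[0, 1] `*` `[0, 1].
Definition osquare : set (R * R) := `]0, 1[ `*` `]0, 1[.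

Definition C1_square (f : R * R -> R) : Prop :=
  exists fu fv : R * R -> R,
    [/\ {within square, continuous f},
        {within square, continuous fu},
        {within square, continuous fv}
      & forall x, osquare x ->
          is_derive x ((1, 0) : R * R) f (fu x) /\
          is_derive x ((0, 1) : R * R) f (fv x)].

Definition dot (x y : R * R) : R := x.1 * y.1 + x.2 * y.2.
Definition det2 (x y : R * R) : R := x.1 * y.2 - x.2 * y.1.
Definition enorm (x : R * R) : R := Num.sqrt (dot x x).

Definition boundary (A : set (R * R)) : set (R * R) := closure A `\` interior A.

End Calculus.

Section Splines.
Context {R : realType}.

Definition knot (n i : nat) : R := i%:R / n%:R.

Definition piecewise_poly (p n : nat) (f : R -> R) : Prop :=
  forall i, (i < n)%N -> exists q : {poly R},
    (size q <= p.+1)%N /\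
    forall x, x \in `[knot n i, knot n i.+1] -> f x = q.[x].

(* S(p,r,h) with h = 1/n.  For r >= 0 the closed mesh intervals may be used. *)
Definition spline (p r n : nat) (f : R -> R) : Prop :=
  piecewise_poly p n f /\ Ck r 0 1 f.

(* On a fine mesh of n elements, the coarse knots are those of index divisible
   by k. *)
Definition knot_reg (r rh k i : nat) : nat := if (k %| i)%N then rh else r.

(* S(p,(r,rh),(1/n,k/n)); continuity at 0 and 1 comes from the use of closed
   mesh intervals. *)
Definition spline2 (p r rh n k : nat) (f : R -> R) : Prop :=
  piecewise_poly p n f /\
  forall i, (0 < i < n)%N ->
    Ck (knot_reg r rh k i) (knot n i.-1) (knot n i.+1) f.

Definition tensor (A B : (R -> R) -> Prop) (f : R * R -> R) : Prop :=
  exists (N : nat) (a b : 'I_N -> R -> R),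
    (forall i, A (a i) /\ B (b i)) /\
    forall u v, u \in `[0, 1] -> v \in `[0, 1] ->
      f (u, v) = \sum_(i < N) a i u * b i v.

Definition knots (p r rh n k : nat) : seq R :=
  nseq p.+1 0
  ++ flatten [seq nseq (p - knot_reg r rh k i) (knot n i) | i <- iota 1 n.-1]
  ++ nseq p.+1 1.

(* Cox - de Boor recursion, with 0/0 = 0 built into the library's division.  The
   last nonempty knot span is closed on the right. *)
Fixpoint bspline (t : seq R) (p i : nat) (x : R) {struct p} : R :=
  if p is p'.+1 then
      (x - t`_i) / (t`_(i + p) - t`_i) * bspline t p' i x
    + (t`_(i + p).+1 - x) / (t`_(i + p).+1 - t`_i.+1) * bspline t p' i.+1 x
  else if (t`_i <= x < t`_i.+1)
       || [&& t`_i < t`_i.+1, t`_i.+1 == last 0 t & x == last 0 t]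
  then 1 else 0.

Definition nb_bspline (p r rh n k : nat) : nat :=
  (size (knots p r rh n k) - p.+1)%N.

End Splines.

Section Sobolev.
Context {R : realType}.

Definition mu2 :
    {measure set (measurableTypeR R * measurableTypeR R) -> \bar R} :=
  (@lebesgue_measure R \x @lebesgue_measure R)%E.

Definition pd1 (f : R * R -> R) : R * R -> R := fun x => 'D_((1, 0) : R * R) f x.
Definition pd2 (f : R * R -> R) : R * R -> R := fun x => 'D_((0, 1) : R * R) f x.

Definition pd_word (s : seq bool) (f : R * R -> R) : R * R -> R :=
  foldr (fun b g => if b then pd1 g else pd2 g) f s.

Definition smooth2 (f : R * R -> R) : Prop :=
  forall s : seq bool,
    [/\ continuous (pd_word s f),
        forall x, derivable (pd_word s f) x ((1, 0) : R * R)
      & forall x, derivable (pd_word s f) x ((0, 1) : R * R)].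

Definition test_function (O : set (R * R)) (psi : R * R -> R) : Prop :=
  smooth2 psi /\
  exists K : set (R * R),
    [/\ compact K, K `<=` O & forall x, ~ K x -> psi x = 0].

Definition locally_integrable (O : set (R * R)) (f : R * R -> R) : Prop :=
  forall K, compact K -> K `<=` O -> mu2.-integrable K (EFin \o f).

Definition weak_derivative (O : set (R * R)) (i j : nat) (f g : R * R -> R) :
    Prop :=
  [/\ locally_integrable O f, locally_integrable O g
    & forall psi, test_function O psi ->
      \int[mu2]_(x in O) (f x * iter i pd1 (iter j pd2 psi) x) =
      (-1) ^+ (i + j) * \int[mu2]_(x in O) (g x * psi x)].

(* H^k(O) norm; weak derivatives being unique almost everywhere, the infimum is
   over a set with at most one element, and is +oo outside H^k(O). *)
Definition sobolev_norm (k : nat) (O : set (R * R)) (f : R * R -> R) : \bar R :=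
  ereal_inf [set N | exists w : nat -> nat -> R * R -> R,
    (forall i j, (i + j <= k)%N -> weak_derivative O i j f (w i j)) /\
    N = ((\sum_(i < k.+1) \sum_(j < k.+1 | (i + j <= k)%N)
          \int[mu2]_(x in O) ((w i j x) ^+ 2)%:E) `^ 2^-1)%E].

End Sobolev.

Section Geometry.
Context {R : realType}.

(* The mesh sizes of the parametrization are 1/gn1 S and 1/gn2. *)
Record geometry := Geometry {
  Omega : set (R * R);
  OmegaS : patch -> set (R * R);
  Fmap : patch -> R * R -> R * R;
  normal : R * R -> R * R;
  gp1 : patch -> nat; gr1 : patch -> nat; gn1 : patch -> nat;
  gp2 : nat; gr2 : nat; gn2 : nat
}.

Variable G : geometry.

Definition Gamma : set (R * R) :=
  boundary (OmegaS G PL) `&` boundary (OmegaS G PR) `&` Omega G.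

Definition dFu (S : patch) (u v : R) : R * R :=
  (D01 (fun u' => (Fmap G S (u', v)).1) u,
   D01 (fun u' => (Fmap G S (u', v)).2) u).
Definition dFv (S : patch) (u v : R) : R * R :=
  (D01 (fun v' => (Fmap G S (u, v')).1) v,
   D01 (fun v' => (Fmap G S (u, v')).2) v).

(* On the interface the two maps agree, so that the tangent does not depend on
   the patch. *)
Definition tangent (v : R) : R * R := dFv PL 0 v.
Definition tau (v : R) : R := enorm (tangent v).
Definition tangent0 (v : R) : R * R := (tau v)^-1 *: tangent v.

Definition alpha (S : patch) (v : R) : R := det2 (dFu S 0 v) (tangent v).
Definition beta (S : patch) (v : R) : R :=
  dot (dFu S 0 v) (tangent0 v) / tau v.

Definition outward_unit_normal (O : set (R * R)) (x t nu : R * R) : Prop :=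
  [/\ enorm nu = 1, dot nu t = 0
    & exists2 d : R, 0 < d & forall s, 0 < s < d ->
        O (x - s *: nu) /\ ~ closure O (x + s *: nu)].

Record two_patch : Prop := TwoPatch {
  tp_open : open (Omega G);
  tp_bounded : bounded_set (Omega G);
  tp_openS : forall S, open (OmegaS G S);
  tp_disj : OmegaS G PL `&` OmegaS G PR = set0;
  tp_closure :
    closure (Omega G) = closure (OmegaS G PL) `|` closure (OmegaS G PR);
  tp_bij : forall S, set_bij square (closure (OmegaS G S)) (Fmap G S);
  (* not a consequence of the previous field: removing a closed nowhere dense
     set from OmegaS does not change its closure *)
  tp_img : forall S, OmegaS G S = Fmap G S @` osquare;
  tp_mesh1 : forall S, (0 < gn1 G S)%N;
  tp_mesh2 : (0 < gn2 G)%N;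
  tp_reg1 : forall S, (1 <= gr1 G S < gp1 G S)%N;
  tp_reg2 : (1 <= gr2 G < gp2 G)%N;
  tp_spline : forall S,
    tensor (spline (gp1 G S) (gr1 G S) (gn1 G S))
           (spline (gp2 G) (gr2 G) (gn2 G)) (fun x => (Fmap G S x).1) /\
    tensor (spline (gp1 G S) (gr1 G S) (gn1 G S))
           (spline (gp2 G) (gr2 G) (gn2 G)) (fun x => (Fmap G S x).2);
  tp_det : exists2 c : R, 0 < c & forall S u v,
    u \in `[0, 1] -> v \in `[0, 1] -> c <= `|det2 (dFu S u v) (dFv S u v)|;
  tp_interface : forall v, v \in `[0, 1] -> Fmap G PL (0, v) = Fmap G PR (0, v);
  (* the end points of the curve lie on the boundary of Omega, hence not on
     Gamma *)
  tp_Gamma : Gamma = [set Fmap G PL (0, v) | v in `]0, 1[];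
  tp_normalL : forall v, v \in `]0, 1[ ->
    outward_unit_normal (OmegaS G PL) (Fmap G PL (0, v)) (tangent v)
      (normal G (Fmap G PL (0, v)));
  tp_normalR : forall v, v \in `]0, 1[ ->
    outward_unit_normal (OmegaS G PR) (Fmap G PR (0, v)) (tangent v)
      (- normal G (Fmap G PR (0, v)));
  tp_orient : forall v, v \in `[0, 1] -> alpha PL v < 0 < alpha PR v;
  tp_gluing_C1 : forall S, Ck 1 0 1 (alpha S) /\ Ck 1 0 1 (beta S);
  tp_gluing_nonpoly : ~ (forall S, is_poly01 (alpha S) /\ is_poly01 (beta S))
}.

(* The normal derivative at a point x of Gamma, taken from the side O. *)
Definition side_derivative (O : set (R * R)) (phi : R * R -> R) (x : R * R) : R :=
  lim ((fun y => dot (pd1 phi y, pd2 phi y) (normal G x)) @ within O (nbhs x)).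

Definition jump (phi : R * R -> R) (x : R * R) : R :=
  side_derivative (OmegaS G PR) phi x - side_derivative (OmegaS G PL) phi x.

(* L^2(Gamma) norm with respect to arc length, tau being the speed of the
   parametrization v |-> F(0,v) of Gamma. *)
Definition L2_Gamma (f : R * R -> R) : \bar R :=
  ((\int[@lebesgue_measure R]_(v in `]0%R, 1%R[)
      ((f (Fmap G PL (0, v))) ^+ 2 * tau v)%:E) `^ 2^-1)%E.

End Geometry.
Arguments geometry : clear implicits.

Record degrees := Degrees {
  p1 : patch -> nat; r1 : patch -> nat;
  p2 : nat; r2 : nat;
  pt : nat; rt : nat
}.

Section Discretization.
Context {R : realType}.
Variables (G : geometry R) (D : degrees).

Record admissible : Prop := Admissible {
  ad_p1 : forall S, (gp1 G S <= p1 D S)%N;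
  ad_r1 : forall S, (1 <= r1 D S <= p1 D S - 1)%N;
  ad_p2 : (maxn (gp2 G) 3 <= p2 D)%N;
  ad_r2 : (1 <= r2 D <= p2 D - 1)%N;
  ad_rt : (1 <= rt D <= pt D - 1)%N
}.

(* Each element of the mesh of the parametrization is divided into k1 S,
   respectively k2, elements. *)
Variables (k1 : patch -> nat) (k2 : nat).

Definition n1 (S : patch) : nat := (gn1 G S * k1 S)%N.
Definition n2 : nat := (gn2 G * k2)%N.
Definition h1 (S : patch) : R := (n1 S)%:R^-1.
Definition h2 : R := n2%:R^-1.

(* Linearity of P is not required. *)
Record projector (Cst Capp : R) (P : (R -> R) -> R -> R) : Prop := Projector {
  pr_target : forall s, Ck (gr2 G - 1) 0 1 s ->
    spline2 (pt D) (rt D) (gr2 G - 1) n2 k2 (P s);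
  pr_proj : forall s, Ck (gr2 G - 1) 0 1 s ->
    spline2 (pt D) (rt D) (gr2 G - 1) n2 k2 s ->
    forall v, v \in `[0, 1] -> P s v = s v;
  pr_stable : forall s, Ck (gr2 G - 1) 0 1 s ->
    (Linfty_norm 0 1 (P s) <= Cst%:E * Linfty_norm 0 1 s)%E;
  pr_interp : forall s, Ck (gr2 G - 1) 0 1 s -> P s 0 = s 0 /\ P s 1 = s 1;
  pr_approx : forall s, Ck (gr2 G - 1) 0 1 s ->
    (forall j, (j < gn2 G)%N -> Cinfty (knot (gn2 G) j) (knot (gn2 G) j.+1) s) ->
    forall j, (j < gn2 G)%N ->
      (Linfty_norm (knot (gn2 G) j) (knot (gn2 G) j.+1) (s \- P s)%R <=
       (Capp * h2 ^+ (pt D).+1)%:E *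
       Linfty_norm (knot (gn2 G) j) (knot (gn2 G) j.+1)
         (derive1n (pt D).+1 s))%E
}.

Definition knots1 (S : patch) : seq R :=
  knots (p1 D S) (r1 D S) (gr1 G S) (n1 S) (k1 S).
Definition b1 (S : patch) (u : R) : R := bspline (knots1 S) (p1 D S) 0 u.
Definition b2 (S : patch) (u : R) : R := bspline (knots1 S) (p1 D S) 1 u.

Definition Nplus : nat :=
  @nb_bspline R (p2 D) (p2 D - 1) (gr2 G) n2 k2.
Definition bplus (j : 'I_Nplus) (v : R) : R :=
  bspline (knots (p2 D) (p2 D - 1) (gr2 G) n2 k2) (p2 D) j v.

Definition Nminus : nat :=
  @nb_bspline R (p2 D - 1) (p2 D - 2) (gr2 G - 1) n2 k2.
Definition bminus (j : 'I_Nminus) (v : R) : R :=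
  bspline (knots (p2 D - 1) (p2 D - 2) (gr2 G - 1) n2 k2) (p2 D - 1) j v.

Variable P : (R -> R) -> R -> R.

Definition alphat (S : patch) : R -> R := P (alpha G S).
Definition betat (S : patch) : R -> R := P (beta G S).

Definition fplus (S : patch) (j : 'I_Nplus) (x : R * R) : R :=
  bplus j x.2 * (b1 S x.1 + b2 S x.1) +
  betat S x.2 * D01 (bplus j) x.2 * (h1 S / (p1 D S)%:R) * b2 S x.1.

Definition fminus (S : patch) (j : 'I_Nminus) (x : R * R) : R :=
  alphat S x.2 * bminus j x.2 * (h1 S / (p1 D S)%:R) * b2 S x.1.

(* The function f S \o F_S^-1 on each subdomain.  A point F(0,v) of Gamma falls
   in the second branch; the value there is the common limit from both sides,
   since the functions f PL and f PR used below agree for u = 0. *)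
Definition glue (f : patch -> R * R -> R) (y : R * R) : R :=
  if y \in OmegaS G PR
  then f PR ('pinv_(fun=> (0, 0)) square (Fmap G PR) y)
  else f PL ('pinv_(fun=> (0, 0)) square (Fmap G PL) y).

Definition Bplus (j : 'I_Nplus) : R * R -> R := glue (fun S => fplus S j).
Definition Bminus (j : 'I_Nminus) : R * R -> R := glue (fun S => fminus S j).

Definition interface_space : set (R * R -> R) :=
  [set phi | exists (c : 'I_Nplus -> R) (d : 'I_Nminus -> R),
    forall y, phi y = \sum_j c j * Bplus j y + \sum_j d j * Bminus j y].

Definition basis_C1 : Prop :=
  (forall S j, C1_square (fplus S j)) /\ (forall S j, C1_square (fminus S j)).

End Discretization.

(* Main.v *)
(* Write a function of the interface space on patch S as f o F^-1 with
     f(u,v) = A(v) (b1 + b2)(u) + (bt A' + at B)(v) (h1/p1) b2(u),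
   at, bt being the approximated gluing data.  Since b1 + b2 is flat and b2 has
   slope p1/h1 at u = 0, the gradient g of the function on the interface satisfies
   g.t = A' and g.F_u = bt A' + at B.  As n is orthogonal to t, g.n equals, up to
   a sign common to both patches, tau (bt A' + at B - beta A') / alpha, and the
   jump is tau times
     [(bt - beta) / alpha]_L^R A' + [(at - alpha) / alpha]_L^R B.
   On each coarse element alpha is a polynomial and beta a rational function
   without poles, so that the approximation property of the projector makes the
   brackets O(h2^(pt+1)) almost everywhere.  Moreover A' and B are bounded by |g|
   because |at| >= (1 - eps) |alpha|.

   It remains to bound the L^2 norm of g over the interface, seen from one side,
   by any family of weak derivatives up to order two.  At F(0,v) take a strip of
   width eps reaching from the point to a fixed depth inside the patch, and a test
   function psi on it which rises from 0 to 1 near the interface and decays far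
   from it.  Integrating the derivative of psi along the strip against the
   gradient gives eps |g(F(0,v))|^2 <= C int_strip W^2 + o(eps).  The strips
   attached to points at mutual distance 4 eps are disjoint; summing over them
   and letting eps tend to 0 gives the trace inequality.  Linearizing F near
   (0,v) by a contraction argument shows that the strips lie in the patch. *)
Require Import Defs.
From mathcomp Require Import ring lra measurable_realfun ess_sup_inf.

Set Implicit Arguments.
Unset Strict Implicit.
Unset Printing Implicit Defensive.

(** Two obstacles shape the trace inequality. The Sobolev norm is an infimum over families of weak
    derivatives, and such a family is never identified with the classical gradient: the latter is
    integrated only against a test function concentrated near the interface, the weak derivatives
    only against the remainder. Moreover [F] is only known to be of class C^1, so a test function
    built in the parameter square need not be smooth on the patch. Strips and test functions are
    therefore straight in the physical plane: the test functions are products of one-variable smooth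
    functions of two linear coordinates, and [F] enters their construction only through its values
    and first derivatives at points of the interface. Since the area of a strip is of order eps,
    Young's inequality trades the integral of [W] for that of [W^2] with the very factor that makes
    the sum over the strips a Riemann sum. The strips lean with slope 1 or -1 in the chart, away
    from the nearer end of the interface; at a corner, a strip in the direction [(1, 0)] would stick
    out of the patch. *)

Section Square.
Context {R : realType}.
Implicit Types (f g : R * R -> R) (z w : R * R).

Lemma squareP z : square z <-> (0 <= z.1 <= 1) /\ (0 <= z.2 <= 1).
Proof. by case: z => a b; rewrite /square /=; split=> -[] /=; rewrite !in_itv /=. Qed.

Lemma osquareP z : osquare z <-> (0 < z.1 < 1) /\ (0 < z.2 < 1).
Proof. by case: z => a b; rewrite /osquare /=; split=> -[] /=; rewrite !in_itv /=. Qed.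

Lemma osquare_square z : osquare z -> square z.
Proof.
by move=> /osquareP[/andP[a b] /andP[c d]]; apply/squareP; rewrite !ltW.
Qed.

Lemma norm_pair_le z (e : R) : (`|z| <= e) = (`|z.1| <= e) && (`|z.2| <= e).
Proof. by case: z => a b; rewrite prod_normE ge_max. Qed.

Lemma norm_pair_lt z (e : R) : (`|z| < e) = (`|z.1| < e) && (`|z.2| < e).
Proof. by case: z => a b; rewrite prod_normE gt_max. Qed.

Lemma norm_fst_le z : `|z.1| <= `|z|.
Proof. by have := lexx `|z|; rewrite norm_pair_le => /andP[]. Qed.

Lemma norm_snd_le z : `|z.2| <= `|z|.
Proof. by have := lexx `|z|; rewrite norm_pair_le => /andP[]. Qed.

Lemma compact_square : compact (@square R).
Proof. by apply: compact_setX; exact: segment_compact. Qed.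

Lemma within_dist (A : set (R * R)) f : {within A, continuous f} ->
  forall z, A z -> forall e : R, 0 < e -> exists2 d : R, 0 < d &
    forall w, A w -> `|w - z| < d -> `|f w - f z| < e.
Proof.
move=> /subspace_continuousP cf z Az e e0.
have /cvgrPdist_lt /(_ e e0) := cf z Az.
rewrite /within /= => /nbhs_normP[d /= d0 H].
exists d => // w Aw wz; rewrite distrC; apply: H => //=.
by rewrite distrC.
Qed.

Lemma dist_within (A : set (R * R)) f :
  (forall z, A z -> forall e : R, 0 < e -> exists2 d : R, 0 < d &
    forall w, A w -> `|w - z| < d -> `|f w - f z| < e) ->
  {within A, continuous f}.
Proof.
move=> H; apply/subspace_continuousP => z Az; apply/cvgrPdist_lt => e e0.
have [d d0 Hd] := H z Az e e0.
rewrite /within; apply/(@nbhs_normP _ (R * R)%type); exists d => //= w /= wz Aw.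
by rewrite distrC; apply: Hd => //; rewrite distrC.
Qed.

(** A radius that works near each point becomes one for the whole set by [compact_near_coveringP],
    the radius being the parameter that tends to 0 from the right. *)
Lemma within_unif (A : set (R * R)) f : compact A -> {within A, continuous f} ->
  forall e : R, 0 < e -> exists2 d : R, 0 < d &
    forall z w, A z -> A w -> `|w - z| < d -> `|f w - f z| < e.
Proof.
move=> cA cf e e0.
pose P (d : R) z := A z -> forall w, A w -> `|w - z| < d -> `|f w - f z| < e.
have : near_covering A by apply/compact_near_coveringP.
move=> /(_ R (0^'+) P _).
have Hn z : A z -> \forall x' \near z & i \near 0^'+, P i x'.
  move=> Az; have [d d0 Hd] := @within_dist A f cf z Az (e / 2) (divr_gt0 e0 (ltr0Sn _ 1)).
  exists (ball z (d / 2), [set i | i < d / 2]) => /=.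
    split; first by apply: nbhsx_ballx; rewrite divr_gt0.
    by apply: nbhs_right_lt; rewrite divr_gt0.
  move=> [x i] /= [bx id2] Ax w Aw wx.
  have xz : `|x - z| < d / 2 by rewrite -ball_normE /= in bx; rewrite distrC.
  have -> : f w - f x = (f w - f z) - (f x - f z) by ring.
  apply: (le_lt_trans (ler_normB _ _)).
  rewrite [ltRHS](splitr e); apply: ltrD; apply: Hd => //.
    have -> : w - z = (w - x) + (x - z) by rewrite addrA subrK.
    apply: (le_lt_trans (ler_normD _ _)).
    by rewrite (splitr d) ltrD // (lt_trans wx).
  by apply: (lt_trans xz); lra.
move=> /(_ Hn) /= H.
have : \forall i \near 0^'+, 0 < i /\ (forall x, A x -> P i x).
  by near=> i; split; near: i; [exact: nbhs_right_gt | exact: H].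
move=> /filter_ex[i [i0 Hi]].
by exists i => // z w Az Aw; apply: Hi.
Unshelve. all: end_near. Qed.

Lemma within_bounded (A : set (R * R)) f : compact A -> {within A, continuous f} ->
  exists2 M : R, 0 < M & forall z, A z -> `|f z| <= M.
Proof.
move=> cA cf.
have /compact_bounded/ex_strict_bound_gt0 [M M0 H] := continuous_compact cf cA.
by exists M => // z Az; apply/ltW/H; exists z.
Qed.

Lemma interior_approx z (d : R) : square z -> 0 < d ->
  exists2 w, osquare w & `|w - z| < d.
Proof.
move=> /squareP[/andP[z1 z2] /andP[z3 z4]] d0.
(* A convex combination with the centre of the square is an interior point and moves each coordinate
   by at most [t / 2]. *)
pose t := Num.min (1/2) (d / 2).
have t0 : 0 < t by rewrite lt_min; apply/andP; split; lra.
have t1 : t <= 1/2 by rewrite ge_min lexx.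
have td : t <= d / 2 by rewrite ge_min lexx orbT.
exists (z.1 + t * (1/2 - z.1), z.2 + t * (1/2 - z.2)).
  by apply/osquareP => /=; split; apply/andP; split; nra.
rewrite norm_pair_lt /= !ltr_norml.
by apply/andP; split; apply/andP; split; nra.
Qed.

Lemma is_derive_fst f z (l : R) :
  is_derive z ((1, 0) : R * R) f l <-> is_derive z.1 1 (fun t => f (t, z.2)) l.
Proof.
case: z => a b /=.
have E : (fun h : R => h^-1 *: (f (h *: ((1, 0) : R * R) + (a, b)) - f (a, b))) =
   (fun h : R => h^-1 *: (f (h *: (1 : R) + a, b) - f (a, b))).
  apply/funext => h; congr (_ *: (f _ - _)).
  by congr pair; rewrite /= ?scaler0 ?add0r.
split=> -[H1 H2]; split; rewrite ?/derivable ?/derive /= in H1 H2 *.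
- by rewrite -E.
- by rewrite -E.
- by rewrite E.
- by rewrite E.
Qed.

Lemma is_derive_snd f z (l : R) :
  is_derive z ((0, 1) : R * R) f l <-> is_derive z.2 1 (fun t => f (z.1, t)) l.
Proof.
case: z => a b /=.
have E : (fun h : R => h^-1 *: (f (h *: ((0, 1) : R * R) + (a, b)) - f (a, b))) =
   (fun h : R => h^-1 *: (f (a, h *: (1 : R) + b) - f (a, b))).
  apply/funext => h; congr (_ *: (f _ - _)).
  by congr pair; rewrite /= ?scaler0 ?add0r.
split=> -[H1 H2]; split; rewrite ?/derivable ?/derive /= in H1 H2 *.
- by rewrite -E.
- by rewrite -E.
- by rewrite E.
- by rewrite E.
Qed.

End Square.

(** * Linearization of C^1 functions up to the boundary of the square *)

Section MeanValue.
Context {R : realType}.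

Lemma mean_value_linear (h dh : R -> R) (x y a k : R) :
  (forall t, Num.min x y <= t <= Num.max x y -> is_derive t 1 h (dh t)) ->
  (forall t, Num.min x y <= t <= Num.max x y -> `|dh t - a| <= k) ->
  `|h y - h x - a * (y - x)| <= k * `|y - x|.
Proof.
wlog xy : x y / x <= y => [H|] Hd Hk.
  have [xy|yx] := leP x y; first exact: H.
  have := H y x (ltW yx); rewrite minC maxC => /(_ Hd Hk).
  rewrite -[`|x - y|]normrN opprB; congr (_ <= _); rewrite -normrN; congr `|_|.
  by ring.
rewrite (min_idPl xy) (max_idPr xy) in Hd Hk.
have cont : {within `[x, y], continuous h}.
  apply: derivable_within_continuous => t; rewrite in_itv /= => /Hd[].
  by [].
have [t] : exists2 c, c \in `[x, y]%R & h y - h x = dh c * (y - x).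
  apply: MVT_segment => // t; rewrite in_itv /= => /andP[t1 t2].
  by apply: Hd; rewrite !ltW.
rewrite in_itv /= => /Hk txy ->.
by rewrite -mulrBl normrM ler_wpM2r.
Qed.

(** [C1_square] with its witnesses named: [fu] and [fv] are continuous on the closed square but are
    known to be derivatives only in the open one. *)
Definition C1_with (f fu fv : R * R -> R) : Prop :=
  [/\ {within square, continuous f},
      {within square, continuous fu},
      {within square, continuous fv}
    & forall x, osquare x ->
        is_derive x ((1, 0) : R * R) f (fu x) /\
        is_derive x ((0, 1) : R * R) f (fv x)].

(** A ball of the max norm is a box, so the path from [z] over [(z.1, w.2)] to [w] stays in it, and
    each leg is a mean value inequality in one variable. Points on the sides of the square, where no
    derivative is assumed, are reached by approximation from inside. *)
Lemma C1_linear_estimate (f fu fv : R * R -> R) (z0 : R * R) (eta a b k : R) :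
  C1_with f fu fv -> 0 <= k ->
  (forall z, osquare z -> `|z - z0| < eta ->
     `|fu z - a| <= k /\ `|fv z - b| <= k) ->
  forall z w, square z -> square w -> `|z - z0| < eta -> `|w - z0| < eta ->
    `|f w - f z - (a * (w.1 - z.1) + b * (w.2 - z.2))|
      <= k * (`|w.1 - z.1| + `|w.2 - z.2|).
Proof.
move=> [cf _ _ df] k0 Hk.
have between (x y lo hi t : R) : lo < x < hi -> lo < y < hi ->
    Num.min x y <= t <= Num.max x y -> lo < t < hi.
  move=> /andP[h1 h2] /andP[h3 h4] /andP[]; rewrite ge_min le_max.
  by move=> /orP[?|?] /orP[?|?]; apply/andP; split; lra.
have open_case z w : osquare z -> osquare w -> `|z - z0| < eta -> `|w - z0| < eta ->
    `|f w - f z - (a * (w.1 - z.1) + b * (w.2 - z.2))|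
      <= k * (`|w.1 - z.1| + `|w.2 - z.2|).
  move=> oz ow; rewrite !norm_pair_lt /= !ltr_distl => /andP[nz1 nz2] /andP[nw1 nw2].
  case/osquareP: (oz) => oz1 oz2; case/osquareP: (ow) => ow1 ow2.
  have h1 t : Num.min z.1 w.1 <= t <= Num.max z.1 w.1 ->
      osquare (t, w.2) /\ `|(t, w.2) - z0| < eta.
    move=> ht; split; first by apply/osquareP; split=> //=; apply: between ht.
    by rewrite norm_pair_lt /= !ltr_distl nw2 andbT; apply: between ht.
  have h2 t : Num.min z.2 w.2 <= t <= Num.max z.2 w.2 ->
      osquare (z.1, t) /\ `|(z.1, t) - z0| < eta.
    move=> ht; split; first by apply/osquareP; split=> //=; apply: between ht.
    by rewrite norm_pair_lt /= !ltr_distl nz1 /=; apply: between ht.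
  have e1 : `|f (w.1, w.2) - f (z.1, w.2) - a * (w.1 - z.1)| <= k * `|w.1 - z.1|.
    apply: (@mean_value_linear (fun t => f (t, w.2)) (fun t => fu (t, w.2))) => t /h1 [ot nt].
      by have [/is_derive_fst + _] := df _ ot.
    by have [] := Hk _ ot nt.
  have e2 : `|f (z.1, w.2) - f (z.1, z.2) - b * (w.2 - z.2)| <= k * `|w.2 - z.2|.
    apply: (@mean_value_linear (fun t => f (z.1, t)) (fun t => fv (z.1, t))) => t /h2 [ot nt].
      by have [_ /is_derive_snd +] := df _ ot.
    by have [] := Hk _ ot nt.
  rewrite [leRHS]mulrDr.
  have -> : f w - f z - (a * (w.1 - z.1) + b * (w.2 - z.2)) =
    (f (w.1, w.2) - f (z.1, w.2) - a * (w.1 - z.1)) +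
    (f (z.1, w.2) - f (z.1, z.2) - b * (w.2 - z.2)).
    by rewrite -!surjective_pairing; ring.
  exact: (le_trans (ler_normD _ _) (lerD e1 e2)).
move=> z w sz sw nz nw; apply/ler_addgt0Pr => e e0.
have e4 : 0 < e / 4 by rewrite divr_gt0.
(* Half of [e] pays for the change of the values of [f], the other half for the linear terms and the
   right-hand side; the latter change by at most [(2 |a| + 2 |b| + 4 k) d], hence the requirement
   [8 M d <= e]. *)
pose M := `|a| + `|b| + k + 1.
have M0 : 0 < M by rewrite /M; have := normr_ge0 a; have := normr_ge0 b; lra.
have [d1 d10 Hd1] := within_dist cf sz e4.
have [d2 d20 Hd2] := within_dist cf sw e4.
pose d := Num.min (Num.min d1 d2) (Num.min (Num.min (eta - `|z - z0|) (eta - `|w - z0|)) (e / (8 * M))).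
have dle : [/\ d <= d1, d <= d2, d <= eta - `|z - z0|, d <= eta - `|w - z0| & d <= e / (8 * M)].
  by split; rewrite !ge_min lexx ?orbT.
have d0 : 0 < d.
  by rewrite !lt_min d10 d20 !subr_gt0 nz nw /= divr_gt0 // mulr_gt0.
case: dle => l1 l2 l3 l4 l5.
have [z' oz' nz'] := interior_approx sz d0.
have [w' ow' nw'] := interior_approx sw d0.
have in_eta (x x' : R * R) : `|x' - x| < d -> d <= eta - `|x - z0| -> `|x' - z0| < eta.
  move=> h1 h2; rewrite -(subrK x x') -addrA.
  by apply: (le_lt_trans (ler_normD _ _)); lra.
have := open_case _ _ oz' ow' (in_eta _ _ nz' l3) (in_eta _ _ nw' l4).
have := Hd1 _ (osquare_square oz') (lt_le_trans nz' l1).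
have := Hd2 _ (osquare_square ow') (lt_le_trans nw' l2).
move: nz' nw'; rewrite !norm_pair_lt /= => /andP[p1 p2] /andP[p3 p4] q1 q2 q3.
have dM : 8 * M * d <= e by rewrite mulrC -ler_pdivlMr // mulr_gt0.
have s1 : `|w'.1 - z'.1| <= `|w.1 - z.1| + 2 * d.
  have -> : w'.1 - z'.1 = (w.1 - z.1) + ((w'.1 - w.1) - (z'.1 - z.1)) by ring.
  apply: (le_trans (ler_normD _ _)); rewrite lerD2l.
  by apply: (le_trans (ler_normB _ _)); clear -p1 p2 p3 p4; lra.
have s2 : `|w'.2 - z'.2| <= `|w.2 - z.2| + 2 * d.
  have -> : w'.2 - z'.2 = (w.2 - z.2) + ((w'.2 - w.2) - (z'.2 - z.2)) by ring.
  apply: (le_trans (ler_normD _ _)); rewrite lerD2l.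
  by apply: (le_trans (ler_normB _ _)); clear -p1 p2 p3 p4; lra.
have t1 : `|a * ((w'.1 - w.1) - (z'.1 - z.1))| <= `|a| * (2 * d).
  rewrite normrM ler_wpM2l //.
  by apply: (le_trans (ler_normB _ _)); clear -p1 p2 p3 p4; lra.
have t2 : `|b * ((w'.2 - w.2) - (z'.2 - z.2))| <= `|b| * (2 * d).
  rewrite normrM ler_wpM2l //.
  by apply: (le_trans (ler_normB _ _)); clear -p1 p2 p3 p4; lra.
have u1 : k * (`|w'.1 - z'.1| + `|w'.2 - z'.2|) <=
    k * (`|w.1 - z.1| + `|w.2 - z.2|) + 4 * k * d.
  have -> : k * (`|w.1 - z.1| + `|w.2 - z.2|) + 4 * k * d =
    k * (`|w.1 - z.1| + `|w.2 - z.2| + 4 * d) by ring.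
  by rewrite ler_wpM2l //; clear -s1 s2; lra.
have -> : f w - f z - (a * (w.1 - z.1) + b * (w.2 - z.2)) =
   (f w' - f z' - (a * (w'.1 - z'.1) + b * (w'.2 - z'.2))) - (f w' - f w) + (f z' - f z)
   + a * ((w'.1 - w.1) - (z'.1 - z.1)) + b * ((w'.2 - w.2) - (z'.2 - z.2)) by ring.
apply: (le_trans (le_trans (ler_normD _ _) (lerD (le_trans (ler_normD _ _)
  (lerD (le_trans (ler_normD _ _) (lerD (le_trans (ler_normB _ _)
  (lerD q3 (ltW q1))) (ltW q2))) t1)) t2))).
have Ed : 2 * (`|a| * (2 * d)) + 2 * (`|b| * (2 * d)) + 4 * k * d * 2 <= e.
  have hd : 0 <= d by exact: ltW.
  have : 8 * M * d = 8 * `|a| * d + 8 * `|b| * d + 8 * k * d + 8 * d by rewrite /M; ring.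
  clear -dM hd k0; have := mulr_ge0 (normr_ge0 a) hd; have := mulr_ge0 (normr_ge0 b) hd.
  by have := mulr_ge0 k0 hd; lra.
clear -u1 Ed k0 d0; have := mulr_ge0 (normr_ge0 a) (ltW d0); have := mulr_ge0 (normr_ge0 b) (ltW d0).
by have := mulr_ge0 k0 (ltW d0); lra.
Qed.

End MeanValue.

(** * Local inversion of the parametrization by a contraction argument *)

Section Inversion.
Context {R : realType}.
Implicit Types (x y q U T z w : R * R).

(* [lin U T] is the linear map with columns [U] and [T], [sol U T] its inverse
   by Cramer's rule. *)
Definition lin U T q : R * R := q.1 *: U + q.2 *: T.
Definition sol U T x : R * R := (det2 x T / det2 U T, det2 U x / det2 U T).

Lemma linE U T q : lin U T q = (q.1 * U.1 + q.2 * T.1, q.1 * U.2 + q.2 * T.2).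
Proof. by []. Qed.

Lemma sol_lin U T q : det2 U T != 0 -> sol U T (lin U T q) = q.
Proof.
case: q U T => a b [u1 u2] [t1 t2]; rewrite /sol linE /det2 /= => D.
by congr pair; field.
Qed.

Lemma lin_sol U T x : det2 U T != 0 -> lin U T (sol U T x) = x.
Proof.
case: x U T => a b [u1 u2] [t1 t2]; rewrite /sol linE /det2 /= => D.
by congr pair; field.
Qed.

Lemma solB U T x y : sol U T (x - y) = sol U T x - sol U T y.
Proof. by rewrite /sol /det2; congr pair => /=; ring. Qed.

Lemma solD U T x y : sol U T (x + y) = sol U T x + sol U T y.
Proof. by rewrite /sol /det2; congr pair => /=; ring. Qed.

Lemma linZ U T (a : R) q : lin U T (a *: q) = a *: lin U T q.
Proof. by rewrite !linE; congr pair; rewrite /= /GRing.scale /=; ring. Qed.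

Lemma norm_det2_le x y : `|det2 x y| <= 2 * `|x| * `|y|.
Proof.
apply: (le_trans (ler_normB _ _)); rewrite !normrM -mulrA mulrDl mul1r.
by apply: lerD; apply: ler_pM; rewrite ?norm_fst_le ?norm_snd_le.
Qed.

Lemma norm_sol_le U T x (M c : R) : 0 < c -> c <= `|det2 U T| ->
  `|U| <= M -> `|T| <= M -> `|sol U T x| <= 2 * M / c * `|x|.
Proof.
move=> c0 cD UM TM; have D0 : 0 < `|det2 U T| by exact: lt_le_trans cD.
have M0 : 0 <= M by exact: le_trans UM.
have E (d : R) : `|d| <= 2 * M * `|x| -> `|d / det2 U T| <= 2 * M / c * `|x|.
  move=> dM; rewrite normrM normfV ler_pdivrMr //; apply: (le_trans dM).
  have -> : 2 * M / c * `|x| * `|det2 U T| = 2 * M * `|x| * (`|det2 U T| / c) by ring.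
  by rewrite ler_peMr ?mulr_ge0 // ler_pdivlMr // mul1r.
rewrite norm_pair_le; apply/andP; split; apply: E => /=.
  apply: (le_trans (norm_det2_le _ _)).
  by rewrite -!mulrA ler_wpM2l // mulrC ler_wpM2r.
apply: (le_trans (norm_det2_le _ _)).
by rewrite -!mulrA ler_wpM2l // ler_wpM2r.
Qed.

Lemma norm_lin_le U T q (M : R) : `|U| <= M -> `|T| <= M ->
  `|lin U T q| <= 2 * M * `|q|.
Proof.
move=> UM TM; apply: (le_trans (ler_normD _ _)); rewrite !normrZ.
rewrite -mulrA mulrDl mul1r [M * _]mulrC.
by apply: lerD; apply: ler_pM; rewrite ?norm_fst_le ?norm_snd_le.
Qed.

(** [G - id] is [k]-Lipschitz on [K]; for small [k] this takes the place of invertibility of a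
    derivative in a quantitative inverse function theorem. *)
Definition near_id (k : R) (G : R * R -> R * R) (K : set (R * R)) : Prop :=
  forall z w, K z -> K w -> `|G w - G z - (w - z)| <= k * `|w - z|.

(** The factor [4 * M / c] is the bound [2 * M / c] for [sol U T] times a factor 2 lost between the
    sum of the coordinates and the max norm. *)
Lemma near_id_C1 (f fu fv g gu gv : R * R -> R) U T z0 (eta k M c : R) :
  C1_with f fu fv -> C1_with g gu gv -> 0 <= k ->
  0 < c -> c <= `|det2 U T| -> `|U| <= M -> `|T| <= M ->
  (forall z, osquare z -> `|z - z0| < eta ->
     [/\ `|fu z - U.1| <= k, `|fv z - T.1| <= k,
         `|gu z - U.2| <= k & `|gv z - T.2| <= k]) ->
  near_id (4 * M / c * k) (fun z => sol U T (f z, g z))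
    [set z | square z /\ `|z - z0| < eta].
Proof.
move=> Cf Cg k0 c0 cD UM TM H z w [sz nz] [sw nw].
have D0 : det2 U T != 0 by rewrite -normr_gt0 (lt_le_trans c0).
have e1 := C1_linear_estimate Cf k0 (fun z o n => let: And4 a b _ _ := H z o n in conj a b) sz sw nz nw.
have e2 := C1_linear_estimate Cg k0 (fun z o n => let: And4 _ _ a b := H z o n in conj a b) sz sw nz nw.
rewrite -{1}[w - z](sol_lin _ D0) -!solB.
apply: (le_trans (norm_sol_le _ c0 cD UM TM)).
have M0 : 0 <= M by exact: le_trans UM.
have -> : 4 * M / c * k * `|w - z| = 2 * M / c * (k * (2 * `|w - z|)) by ring.
apply: ler_wpM2l; first by rewrite divr_ge0 ?mulr_ge0 // ltW.
have S : k * (`|w.1 - z.1| + `|w.2 - z.2|) <= k * (2 * `|w - z|).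
  rewrite ler_wpM2l // mulrDl mul1r.
  by apply: lerD; [exact: norm_fst_le (w - z)|exact: norm_snd_le (w - z)].
rewrite norm_pair_le /=; apply/andP; split.
  apply: le_trans S; apply: le_trans e1; rewrite le_eqVlt; apply/orP; left.
  by apply/eqP; congr `|_|; rewrite /GRing.scale /=; ring.
apply: le_trans S; apply: le_trans e2; rewrite le_eqVlt; apply/orP; left.
by apply/eqP; congr `|_|; rewrite /GRing.scale /=; ring.
Qed.

Lemma compact_cball z (r : R) : compact [set w : R * R | `|w - z| <= r].
Proof.
have -> : [set w : R * R | `|w - z| <= r] =
    `[z.1 - r, z.1 + r] `*` `[z.2 - r, z.2 + r].
  apply/seteqP; split => w /=; rewrite norm_pair_le /= !ler_distl !in_itv /=.
    by move=> /andP[].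
  by move=> [-> ->].
by apply: compact_setX; exact: segment_compact.
Qed.

(* A minimizer of [|G w - y|] over the ball must be a zero: one Newton step
   multiplies this quantity by at most [k]. *)
Lemma near_id_solve (k : R) (G : R * R -> R * R) z q :
  0 <= k <= 1/2 ->
  near_id k G (z |` [set w | `|w - (z + q)| <= 2 * k * `|q|]) ->
  exists2 w, `|w - (z + q)| <= 2 * k * `|q| & G w = G z + q.
Proof.
move=> /andP[k0 k2] NI.
have aux1 (a b c d e : R * R) : c - (a - (b + e)) - (d + e) = - (a - b - (c - d)).
  by case: a b c d e => [? ?] [? ?] [? ?] [? ?] [? ?]; congr pair => /=; ring.
have aux2 (a b c e : R * R) : a - (b + e) = a - c - (- (c - (b + e))).
  by case: a b c e => [? ?] [? ?] [? ?] [? ?]; congr pair => /=; ring.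
set K := [set w | _] in NI *.
pose g w := `|G w - (G z + q)|.
have Kz w : K w -> (z |` K) w by right.
have cg : {within K, continuous g}.
  apply: dist_within => w Kw e e0; exists (e / 2); first by rewrite divr_gt0.
  move=> w' Kw' nw.
  apply: (le_lt_trans (ler_dist_dist _ _)).
  have -> : G w' - (G z + q) - (G w - (G z + q)) =
     (G w' - G w - (w' - w)) + (w' - w).
    by rewrite subrK opprB addrA subrK.
  apply: (le_lt_trans (ler_normD _ _)).
  have := NI _ _ (Kz _ Kw) (Kz _ Kw'); have := normr_ge0 (w' - w); nra.
have K0 : K !=set0.
  by exists (z + q); rewrite /K /= subrr normr0 !mulr_ge0.
have cK : compact K by exact: compact_cball.
have [w] := compact_EVT_min K0 cK cg.
rewrite inE => Kw minw.
pose w' := w - (G w - (G z + q)).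
(* The Newton step stays in the ball: [|w - z| <= (2 k + 1) |q| <= 2 |q|] because [k <= 1/2], and
   the Lipschitz bound contributes the remaining factor [k]. *)
have Kw' : K w'.
  rewrite /K /=.
  have -> : w' - (z + q) = - (G w - G z - (w - z)).
    exact: aux1.
  rewrite normrN; apply: (le_trans (NI _ _ _ (Kz _ Kw))); first by left.
  have : `|w - z| <= `|w - (z + q)| + `|q|.
    have -> : w - z = w - (z + q) + q by rewrite opprD addrA subrK.
    exact: ler_normD.
  rewrite /K /= in Kw => h; have n0 := normr_ge0 q.
  have -> : 2 * k * `|q| = k * (2 * `|q|) by ring.
  by apply: ler_wpM2l => //; clear -h Kw k2 n0; nra.
exists w => //.
have m := minw w' ltac:(by rewrite inE).
have : g w' <= k * g w.
  have -> : g w' = `|G w' - G w - (w' - w)|.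
    by rewrite /g (aux2 _ _ (G w)) /w' [w - _ - w]addrAC subrr sub0r.
  apply: (le_trans (NI _ _ (Kz _ Kw) (Kz _ Kw'))).
  by rewrite /w' addrAC subrr sub0r normrN.
have g0 : 0 <= g w by exact: normr_ge0.
move=> h; have : g w = 0 by nra.
by move/eqP; rewrite normr_eq0 subr_eq0 => /eqP.
Qed.

(** On the compact set of points at distance at least [eta] from [z0] the distance between the
    images attains its minimum, which is positive by injectivity; [r] is this minimum. *)
Lemma inverse_continuous (f g : R * R -> R) :
  {within square, continuous f} -> {within square, continuous g} ->
  set_inj square (fun z => (f z, g z)) ->
  forall z0 (eta : R), square z0 -> 0 < eta -> exists2 r : R, 0 < r &
    forall z, square z -> `|(f z, g z) - (f z0, g z0)| < r -> `|z - z0| < eta.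
Proof.
move=> cf cg inj z0 eta sz0 eta0.
pose K := square `&` [set z : R * R | eta <= `|z - z0|].
have cK : compact K.
  apply: compact_closedI; first exact: compact_square.
  apply: (@closed_comp _ _ (fun z => `|z - z0|) [set t | eta <= t]).
    move=> z _; apply: cvg_norm; apply: cvgB; [exact: cvg_id|exact: cvg_cst].
  exact: closed_ge.
have [[z1 K1]|] := pselect (K !=set0); last first.
  move=> nK; exists 1 => // z sz _; rewrite ltNge; apply/negP => h.
  by apply: nK; exists z.
pose m z := `|(f z, g z) - (f z0, g z0)|.
have cm : {within K, continuous m}.
  apply: dist_within => w Kw e e0.
  have [d1 d10 H1] := within_dist cf Kw.1 e0.
  have [d2 d20 H2] := within_dist cg Kw.1 e0.
  exists (Num.min d1 d2); first by rewrite lt_min d10 d20.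
  move=> w' Kw'; rewrite lt_min => /andP[n1 n2].
  apply: (le_lt_trans (ler_dist_dist _ _)).
  have -> : (f w', g w') - (f z0, g z0) - ((f w, g w) - (f z0, g z0)) =
    (f w' - f w, g w' - g w) by congr pair => /=; ring.
  rewrite norm_pair_lt /=.
  by rewrite (H1 _ Kw'.1 n1) (H2 _ Kw'.1 n2).
have [w + minw] := compact_EVT_min (ex_intro _ _ K1) cK cm.
rewrite inE => -[sw ew].
exists (m w).
  rewrite normr_gt0 subr_eq0; apply/negP => /eqP/inj.
  rewrite !inE => /(_ sw sz0) E.
  by move: ew; rewrite /= E subrr normr0 leNgt eta0.
move=> z sz; rewrite ltNge => /negP h; rewrite ltNge; apply/negP => h2; apply: h.
by apply: minw; rewrite inE.
Qed.

Lemma osquare_open z : osquare z -> exists2 d : R, 0 < d &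
  forall w, `|w - z| < d -> osquare w.
Proof.
move=> /osquareP[/andP[a b] /andP[c d]].
exists (Num.min (Num.min z.1 (1 - z.1)) (Num.min z.2 (1 - z.2))).
  by rewrite !lt_min !subr_gt0 a b c d.
move=> w; rewrite norm_pair_lt /= !lt_min !ltr_distl.
move=> /andP[/andP[/andP[h1 h1'] /andP[h2 h2']] /andP[/andP[h3 h3'] /andP[h4 h4']]].
apply/osquareP; split; apply/andP; split.
- by clear -h1; lra.
- by clear -h1'; lra.
- by clear -h4; lra.
- by clear -h4'; lra.
Qed.

Lemma is_derive_normP (V : normedModType R) (f : V -> R) (x d : V) (l : R) :
  (forall e : R, 0 < e -> exists2 r : R, 0 < r & forall t : R, t != 0 -> `|t| < r ->
     `|f (t *: d + x) - f x - t * l| <= e * `|t|) ->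
  is_derive x d f l.
Proof.
move=> H.
have L : (fun h : R => h^-1 *: (f (h *: d + x) - f x)) @ 0^' --> l.
  apply/cvgrPdist_le => e e0; have [r r0 Hr] := H e e0.
  near=> t.
  have t0 : t != 0 by near: t; exact: nbhs_dnbhs_neq.
  have tr : `|t| < r.
    by near: t; apply: dnbhs0_lt.
  have := Hr t t0 tr; rewrite -ler_pdivrMr ?normr_gt0 // -normfV -normrM.
  apply: le_trans; rewrite -normrN.
  suff -> : - (l - t^-1 *: (f (t *: d + x) - f x)) =
    (f (t *: d + x) - f x - t * l) / t by [].
  by rewrite /GRing.scale /=; field.
split; first by apply/cvg_ex; exists l.
exact: cvg_lim L.
Unshelve. all: end_near. Qed.

Lemma continuous_edge (k : R * R -> R) : {within square, continuous k} ->
  {within `[0, 1], continuous (fun v => k (0, v))}.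
Proof.
move=> ck; apply/subspace_continuousP => v v01; apply/cvgrPdist_lt => e e0.
have sv : square (0, v) by apply/squareP; rewrite /= lexx ler01; move: v01; rewrite /= in_itv.
have [d d0 H] := within_dist ck sv e0.
rewrite near_withinE; near=> t => t01.
have st : square (0, t) by apply/squareP; rewrite /= lexx ler01; move: t01; rewrite /= in_itv.
rewrite distrC; apply: H => //.
rewrite norm_pair_lt /= subrr normr0 d0 /= distrC.
near: t; apply/nbhs_ballP; exists d => //= t; rewrite -ball_normE.
Unshelve. all: end_near. Qed.

Lemma C1_near (f fu fv : R * R -> R) z (k : R) : C1_with f fu fv -> square z -> 0 < k ->
  exists2 d : R, 0 < d & forall w, square w -> `|w - z| < d ->
    `|fu w - fu z| <= k /\ `|fv w - fv z| <= k.
Proof.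
move=> [_ cu cv _] sz k0.
have [d1 d10 H1] := within_dist cu sz k0.
have [d2 d20 H2] := within_dist cv sz k0.
exists (Num.min d1 d2); first by rewrite lt_min d10.
by move=> w sw; rewrite lt_min => /andP[a b]; rewrite !ltW ?H1 ?H2.
Qed.

(* [near_id_solve] produces the preimage of [(f, g) z + t d] within [o(t)] of
   [z + t (sol U T d)], so that no inverse function theorem is needed. *)
Lemma is_derive_comp_inverse (f fu fv g gu gv p pu pv phi : R * R -> R) z d :
  C1_with f fu fv -> C1_with g gu gv -> C1_with p pu pv ->
  osquare z -> det2 (fu z, gu z) (fv z, gv z) != 0 ->
  (forall w, osquare w -> phi (f w, g w) = p w) ->
  is_derive (f z, g z) d phi
    (dot (pu z, pv z) (sol (fu z, gu z) (fv z, gv z) d)).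
Proof.
move=> Cf Cg Cp oz D0 Hphi; have sz := osquare_square oz.
set U := (fu z, gu z); set T := (fv z, gv z).
pose q := sol U T d; pose c := `|det2 U T|; pose M := Num.max `|U| `|T|.
have c0 : 0 < c by rewrite normr_gt0.
have UM : `|U| <= M by rewrite le_max lexx.
have TM : `|T| <= M by rewrite le_max lexx orbT.
have M0 : 0 <= M by exact: le_trans UM.
apply: is_derive_normP => e e0.
(* [k * S * |t|] dominates the total error: the first term is the linearization error of [p], the
   second the displacement of the preimage from [z + t q], measured by the gradient of [p]. *)
pose S := 4 * `|q| + 2 * (`|pu z| + `|pv z|) * `|q| + 1.
have S0 : 0 < S by rewrite ltr_wpDl // addr_ge0 // !mulr_ge0 // addr_ge0.
pose k := Num.min (1/2) (e / S).
have k0 : 0 < k by rewrite lt_min; apply/andP; split; [lra|exact: divr_gt0].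
have k12 : k <= 1/2 by rewrite ge_min lexx.
have kS : k * S <= e by rewrite -ler_pdivlMr // ge_min lexx orbT.
(* Multiplied by the factor [4 * M / c] of [near_id_C1], this is at most [k]; the [+ 1] keeps the
   denominator positive, as only [0 <= M] is known. *)
pose k' := k * c / (4 * M + 1).
have M1 : 0 < 4 * M + 1 by lra.
have k'0 : 0 < k' by rewrite divr_gt0 // mulr_gt0.
have [d1 d10 H1] := C1_near Cf sz k'0.
have [d2 d20 H2] := C1_near Cg sz k'0.
have [d3 d30 H3] := C1_near Cp sz k0.
have [d4 d40 H4] := osquare_open oz.
pose eta := Num.min (Num.min d1 d2) (Num.min d3 d4).
have eta0 : 0 < eta by rewrite !lt_min d10 d20 d30 d40.
have etaE w : `|w - z| < eta -> [/\ `|w - z| < d1, `|w - z| < d2, `|w - z| < d3 & `|w - z| < d4].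
  by rewrite !lt_min => /andP[/andP[? ?] /andP[? ?]].
have NI : near_id (4 * M / c * k') (fun z => sol U T (f z, g z))
    [set w | square w /\ `|w - z| < eta].
  apply: (near_id_C1 Cf Cg (ltW k'0) c0 (lexx _) UM TM) => w ow /etaE[n1 n2 _ _].
  have [? ?] := H1 w (osquare_square ow) n1; have [? ?] := H2 w (osquare_square ow) n2.
  by split.
have kk : 4 * M / c * k' <= k.
  have -> : 4 * M / c * k' = k * (4 * M / (4 * M + 1)).
    by rewrite /k'; field; rewrite gt_eqF // gt_eqF.
  by rewrite ler_piMr ?(ltW k0) // ler_pdivrMr //; lra.
pose r := eta / (2 * `|q| + 1).
have q1 : 0 < 2 * `|q| + 1 by rewrite ltr_wpDl // mulr_ge0.
exists r; first by rewrite divr_gt0.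
move=> t t0; rewrite ltr_pdivlMr // => tr.
have tq : `|t *: q| = `|t| * `|q| by rewrite normrZ.
have tp : 0 < `|t| by rewrite normr_gt0.
have inK w : `|w - (z + t *: q)| <= 2 * k * `|t *: q| -> `|w - z| < eta.
  move=> h; have -> : w - z = w - (z + t *: q) + t *: q by rewrite opprD addrA subrK.
  apply: (le_lt_trans (ler_normD _ _)); rewrite tq in h *.
  by have := mulr_ge0 (normr_ge0 t) (normr_ge0 q); nra.
have [||w h1 h2] := @near_id_solve k (fun z => sol U T (f z, g z)) z (t *: q) _ _.
- by rewrite k12 ltW.
- have sub w : (z |` [set w | `|w - (z + t *: q)| <= 2 * k * `|t *: q|]) w ->
     square w /\ `|w - z| < eta.
    move=> [->|/inK h]; first by split=> //; rewrite subrr normr0.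
    by split=> //; apply: osquare_square; apply: H4; case: (etaE _ h).
  move=> w1 w2 /sub s1 /sub s2; apply: (le_trans (NI _ _ s1 s2)).
  by rewrite ler_wpM2r.
have ww := inK _ h1; have [_ _ n3 n4] := etaE _ ww.
have ow : osquare w by exact: H4.
have Fw : t *: d + (f z, g z) = (f w, g w).
  have := congr1 (lin U T) h2; rewrite -(sol_lin (t *: q) D0) -solD !lin_sol //.
  by rewrite linZ lin_sol // addrC => <-.
rewrite Fw !Hphi //.
have est := @C1_linear_estimate _ _ _ _ z eta (pu z) (pv z) k Cp (ltW k0) _ z w sz (osquare_square ow) _ ww.
have {est} est : `|p w - p z - (pu z * (w.1 - z.1) + pv z * (w.2 - z.2))| <=
    k * (`|w.1 - z.1| + `|w.2 - z.2|).
  apply: est; last by rewrite subrr normr0.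
  by move=> w' ow' /etaE[_ _ n _]; apply: H3 => //; exact: osquare_square.
move: h1; rewrite norm_pair_le /= tq => /andP[h11 h12].
have wz1 : `|w.1 - z.1| <= 2 * (`|t| * `|q|).
  have : `|t * q.1| <= `|t| * `|q| by rewrite normrM ler_wpM2l // norm_fst_le.
  have -> : w.1 - z.1 = (w.1 - (z.1 + t * q.1)) + t * q.1 by ring.
  have := ler_normD (w.1 - (z.1 + t * q.1)) (t * q.1).
  by have := mulr_ge0 (normr_ge0 t) (normr_ge0 q); rewrite /GRing.scale /= in h11; clear -h11 k12; nra.
have wz2 : `|w.2 - z.2| <= 2 * (`|t| * `|q|).
  have : `|t * q.2| <= `|t| * `|q| by rewrite normrM ler_wpM2l // norm_snd_le.
  have -> : w.2 - z.2 = (w.2 - (z.2 + t * q.2)) + t * q.2 by ring.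
  have := ler_normD (w.2 - (z.2 + t * q.2)) (t * q.2).
  by have := mulr_ge0 (normr_ge0 t) (normr_ge0 q); rewrite /GRing.scale /= in h12; clear -h12 k12; nra.
have -> : p w - p z - t * dot (pu z, pv z) q =
   (p w - p z - (pu z * (w.1 - z.1) + pv z * (w.2 - z.2))) +
   (pu z * (w.1 - (z.1 + t *: q.1)) + pv z * (w.2 - (z.2 + t *: q.2))).
  by rewrite /dot /GRing.scale /=; ring.
apply: (le_trans (ler_normD _ _)).
have b1 : `|pu z * (w.1 - (z.1 + t *: q.1))| <= `|pu z| * (2 * k * (`|t| * `|q|)).
  by rewrite normrM ler_wpM2l.
have b2 : `|pv z * (w.2 - (z.2 + t *: q.2))| <= `|pv z| * (2 * k * (`|t| * `|q|)).
  by rewrite normrM ler_wpM2l.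
have b3 := ler_normD (pu z * (w.1 - (z.1 + t *: q.1))) (pv z * (w.2 - (z.2 + t *: q.2))).
have b4 : k * (`|w.1 - z.1| + `|w.2 - z.2|) <= k * (4 * (`|t| * `|q|)).
  by rewrite ler_wpM2l ?(ltW k0) //; clear -wz1 wz2; lra.
have b5 : k * S * `|t| <= e * `|t| by rewrite ler_wpM2r.
have b6 : 0 <= k * `|t| by rewrite mulr_ge0 // ltW.
apply: le_trans b5; rewrite /S.
have -> : k * (4 * `|q| + 2 * (`|pu z| + `|pv z|) * `|q| + 1) * `|t| =
  k * (4 * (`|t| * `|q|)) + `|pu z| * (2 * k * (`|t| * `|q|)) + `|pv z| * (2 * k * (`|t| * `|q|))
  + k * `|t| by ring.
by clear -b1 b2 b3 b4 b6 est; lra.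
Qed.

End Inversion.

(** * Smooth functions of one variable: a flat function, a bump and a step *)

Section Smooth1.
Context {R : realType}.
Implicit Types (f g : R -> R).

Lemma is_derive_lineP (V : normedModType R) (f : V -> R) (x d : V) (l : R) :
  is_derive x d f l <-> is_derive (0 : R) 1 (fun t : R => f (t *: d + x)) l.
Proof.
have E : (fun h : R => h^-1 *: (f (h *: d + x) - f x)) =
   (fun h : R => h^-1 *: (f ((h *: (1 : R) + 0) *: d + x) - f ((0 : R) *: d + x))).
  apply/funext => h; congr (_ *: (f _ - f _)); last by rewrite scale0r add0r.
  by rewrite addr0 /GRing.scale /= mulr1.
by split=> -[H1 H2]; split; rewrite ?/derivable ?/derive /= in H1 H2 *; rewrite ?E // -E.
Qed.

Lemma is_derive_ext (V : normedModType R) (f g : V -> R) (x d : V) (l l' : R) :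
  (forall y, f y = g y) -> l = l' -> is_derive x d f l -> is_derive x d g l'.
Proof. by move=> /funext -> ->. Qed.

Lemma is_derive_affine (f : R -> R) (a b x l : R) :
  is_derive (a * x + b) 1 f l -> is_derive x 1 (fun t => f (a * t + b)) (l * a).
Proof.
move=> H; apply: (@is_derive1_comp _ f (fun t => a * t + b)) => //.
by apply: is_derive_eq; rewrite /GRing.scale /=; ring.
Qed.

(* A coinductive formulation of C^infinity: [f] lies in some class of functions
   closed under differentiation. *)
Definition smooth1 f : Prop := exists P : (R -> R) -> Prop,
  P f /\ forall g, P g -> exists2 g', (forall x : R, is_derive x 1 g (g' x)) & P g'.

Lemma smooth1_is_derive f : smooth1 f -> forall x : R, is_derive x 1 f ((derive1 f) x).
Proof.
move=> [P [Pf H]] x; have [g' dg _] := H f Pf.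
by rewrite derive1E (@derive_val _ _ _ _ _ _ _ (dg x)).
Qed.

Lemma smooth1_derive1 f : smooth1 f -> smooth1 (derive1 f).
Proof.
move=> [P [Pf H]]; exists P; split=> //; have [g' dg Pg] := H f Pf.
suff -> : (derive1 f) = g' by [].
by apply/funext => x; rewrite derive1E (@derive_val _ _ _ _ _ _ _ (dg x)).
Qed.

Lemma smooth1_continuous f : smooth1 f -> continuous f.
Proof.
move=> sf x; have := smooth1_is_derive sf x => -[d _].
by apply: differentiable_continuous; apply/derivable1_diffP.
Qed.

Lemma smooth1_affine f (a b : R) : smooth1 f -> smooth1 (fun t => f (a * t + b)).
Proof.
move=> [P [Pf H]].
exists (fun h => exists c g, P g /\ h = (fun t => c * g (a * t + b))); split.
  by exists 1, f; split=> //; apply/funext => t; rewrite mul1r.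
move=> _ [c [g [Pg ->]]]; have [g' dg Pg'] := H g Pg.
exists (fun t => (c * a) * g' (a * t + b)); last by exists (c * a), g'.
move=> x; have := is_derive_affine (dg (a * x + b)) => dga.
by apply: is_derive_eq; rewrite /GRing.scale /=; ring.
Qed.

Lemma smooth1_cst (c : R) : smooth1 (fun=> c).
Proof.
exists (fun h => exists c, h = fun=> c); split; first by exists c.
move=> _ [a ->]; exists (fun=> 0); last by exists 0.
by move=> x; exact: is_derive_cst.
Qed.

Lemma smooth1D f g : smooth1 f -> smooth1 g -> smooth1 (fun t => f t + g t).
Proof.
move=> [P [Pf HP]] [Q [Qg HQ]].
exists (fun h => exists f g, [/\ P f, Q g & h = (fun t => f t + g t)]); split.
  by exists f, g.
move=> _ [f1 [g1 [Pf1 Qg1 ->]]].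
have [f' df Pf'] := HP _ Pf1; have [g' dg Qg'] := HQ _ Qg1.
exists (fun t => f' t + g' t); last by exists f', g'.
move=> x; have := df x; have := dg x => ? ?.
exact: is_deriveD.
Qed.

(** The Leibniz rule leads out of the plain products [f * g]; their finite sums form a class closed
    under differentiation. *)
Inductive product_class (P Q : (R -> R) -> Prop) : (R -> R) -> Prop :=
| ProdClass f g : P f -> Q g -> product_class P Q (fun t => f t * g t)
| ProdClassD h k : product_class P Q h -> product_class P Q k ->
    product_class P Q (fun t => h t + k t).

Lemma smooth1M f g : smooth1 f -> smooth1 g -> smooth1 (fun t => f t * g t).
Proof.
move=> [P [Pf HP]] [Q [Qg HQ]].
exists (product_class P Q); split; first exact: ProdClass.
move=> k0; elim=> {k0} [f1 g1 Pf1 Qg1|h k _ [h' dh Ph'] _ [k' dk Pk']]; last first.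
  exists (fun t => h' t + k' t); last exact: ProdClassD.
  by move=> x; have := dh x; have := dk x => ? ?; exact: is_deriveD.
have [f' df Pf'] := HP _ Pf1; have [g' dg Qg'] := HQ _ Qg1.
exists (fun t => f1 t * g' t + f' t * g1 t).
  move=> x; have := df x; have := dg x => ? ?.
  have := @is_deriveM _ _ f1 g1 x 1 (f' x) (g' x) _ _ => H.
  by apply: is_derive_eq; rewrite /GRing.scale /=; ring.
by apply: ProdClassD; apply: ProdClass.
Qed.

(** The class of all [h * f^-n] with [h] smooth is closed under differentiation: the derivative is
    [(h' f - n h f') * f^-(n+1)]. *)
Lemma smooth1V f : smooth1 f -> (forall x, f x != 0) -> smooth1 (fun t => (f t)^-1).
Proof.
move=> sf f0.
exists (fun k => exists h n, smooth1 h /\ k = (fun t => h t * (f t)^-1 ^+ n)); split.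
  exists (fun=> 1), 1%N; split; first exact: smooth1_cst.
  by apply/funext => t; rewrite mul1r.
move=> _ [h [n [sh ->]]].
pose h1 t := (derive1 h) t * f t + (- n%:R) * (h t * (derive1 f) t).
exists (fun t => h1 t * (f t)^-1 ^+ n.+1); last first.
  exists h1, n.+1; split=> //; apply: smooth1D; first exact/smooth1M/sf/smooth1_derive1.
  apply: smooth1M; first exact: smooth1_cst.
  exact/smooth1M/smooth1_derive1.
move=> x; have dh := smooth1_is_derive sh x; have df := smooth1_is_derive sf x.
have dV := is_deriveV (f0 x) df.
have dX := @is_deriveX _ _ _ n x 1 _ dV.
have := @is_deriveM _ _ h _ x 1 _ _ dh dX; rewrite !exprfctE.
apply: is_derive_ext => //; rewrite /h1 /GRing.scale /=.
case: n {dX h1} => [|n] /=; first by rewrite !expr0 expr1; field.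
by rewrite !exprS; move: ((f x)^-1 ^+ n) (f0 x) => X fx; field.
Qed.

(** [flat 1] is the classical function [exp (-1/x)] extended by zero. The polynomial in [1/x] is
    carried along because it is what differentiation produces, so that the whole family is
    closed. *)
Definition flat (p : {poly R}) (x : R) : R :=
  if 0 < x then p.[x^-1] * expR (- x^-1) else 0.

(** Induction on the coefficients, with a power of [t] added to the statement to absorb the shift by
    ['X]; [t ^+ n * expR (- t) <= n!] holds since [t ^+ n / n!] is a term of the exponential
    series. *)
Lemma poly_expR_bounded (p : {poly R}) : exists2 C : R, 0 <= C &
  forall t, 0 <= t -> `|p.[t]| * expR (- t) <= C.
Proof.
suff: forall n, exists2 C : R, 0 <= C &
    forall t, 0 <= t -> `|p.[t] * t ^+ n| * expR (- t) <= C.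
  move=> /(_ 0%N)[C C0 H]; exists C => // t t0.
  by have := H t t0; rewrite expr0 mulr1.
have mono (m : nat) (t : R) : 0 <= t -> t ^+ m * expR (- t) <= m`!%:R.
  move=> t0; case: m => [|m].
    by rewrite expr0 mul1r fact0 -(@expR0 R) ler_expR oppr_le0.
  have := expR_ge1Dxn m t0; rewrite expRN ler_pdivrMr ?expR_gt0 // => h.
  have : t ^+ m.+1 / (m.+1)`!%:R <= expR t by apply: le_trans h; rewrite lerDr.
  by rewrite ler_pdivrMr ?ltr0n ?fact_gt0 // mulrC.
elim/poly_ind: p => [|p c IH] n.
  by exists 0 => // t t0; rewrite horner0 !mul0r normr0 mul0r.
have [C C0 H] := IH n.+1.
exists (C + `|c| * n`!%:R) => [|t t0]; first by rewrite addr_ge0 // mulr_ge0.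
rewrite hornerMXaddC mulrDl -mulrA -exprS.
apply: (le_trans (ler_wpM2r (expR_ge0 _) (ler_normD _ _))).
rewrite mulrDl lerD ?H // normrM -mulrA ler_wpM2l //.
by rewrite ger0_norm ?exprn_ge0 // mono.
Qed.

(** For positive [x], put [y = 1/x]; the chain rule gives [y^2 (p - p')(y) exp (-y)]. At the origin,
    boundedness of [y^2 p(y) exp (-y)] means that [flat p] is [O(t^2)], so the derivative there is
    zero. *)
Lemma is_derive_flat (p : {poly R}) (x : R) :
  is_derive x 1 (flat p) (flat ('X ^+ 2 * (p - p^`())) x).
Proof.
rewrite /flat; case: (ltrgt0P x) => [x0|x0|->].
- have dx : x != 0 by rewrite gt_eqF.
  apply: (@near_eq_is_derive R R R (fun x => p.[x^-1] * expR (- x^-1))).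
    near=> y; have y0 : 0 < y by near: y; exact: lt_nbhsr.
    by rewrite y0.
  have dV : is_derive x 1 (fun y : R => y^-1) (- x ^- 2).
    have := @is_deriveV _ (fun y : R => y) x 1 1 dx (is_derive_id _ _) => H.
    by apply: is_derive_eq; rewrite /GRing.scale /= mulr1.
  have dp : is_derive x 1 (fun y => p.[y^-1]) (p^`().[x^-1] * - x ^- 2).
    exact: (@is_derive1_comp _ (horner p) (fun y => y^-1)).
  have de : is_derive x 1 (fun y : R => expR (- y^-1)) (expR (- x^-1) * - - x ^- 2).
    exact: (@is_derive1_comp _ expR (fun y : R => - y^-1)).
  have := @is_deriveM _ _ _ _ x 1 _ _ dp de => H.
  apply: is_derive_eq; rewrite /GRing.scale /= hornerM hornerXn hornerD hornerN.
  by rewrite exprVn; ring.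
- have d0 : is_derive x 1 (fun=> 0 : R) (0 : R) by exact: is_derive_cst.
  apply: near_eq_is_derive d0.
  near=> y; have y0 : y < 0 by near: y; exact: lt_nbhsl.
  by rewrite ltNge (ltW y0).
- apply: is_derive_normP => e e0.
  have [C C0 H] := poly_expR_bounded ('X ^+ 2 * p).
  have C1 : 0 < C + 1 by rewrite ltr_wpDl.
  exists (e / (C + 1)); first by rewrite divr_gt0.
  move=> t t0; rewrite ltr_pdivlMr // => tr.
  rewrite addr0 [t *: 1]mulr1 ltxx mulr0 !subr0.
  case: ifPn => [tp|_]; last by rewrite normr0 mulr_ge0 // ltW.
  have := H t^-1; rewrite invr_ge0 (ltW tp) => /(_ isT).
  rewrite hornerM hornerXn !normrM (ger0_norm (expR_ge0 _)).
  have ti : 0 <= t^-1 by rewrite invr_ge0 ltW.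
  rewrite (ger0_norm ti) (gtr0_norm tp).
  rewrite (gtr0_norm tp) in tr.
  set A := `|_| * _; move=> h.
  have {}h : A <= C * t ^+ 2.
    have -> : A = t^-1 * t^-1 * `|p.[t^-1]| * expR (- t^-1) * t ^+ 2.
      by rewrite /A; field.
    by rewrite ler_wpM2r // exprn_ge0 // ltW.
  apply: (le_trans h); rewrite expr2 mulrA ler_wpM2r ?(ltW tp) //.
  by nra.
Unshelve. all: end_near. Qed.

Lemma smooth1_flat (p : {poly R}) : smooth1 (flat p).
Proof.
exists (fun f => exists p, f = flat p); split; first by exists p.
move=> _ [q ->]; exists (flat ('X ^+ 2 * (q - q^`()))); last by eexists.
by move=> x; exact: is_derive_flat.
Qed.

Lemma flat1_ge0 (x : R) : 0 <= flat 1 x.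
Proof. by rewrite /flat; case: ifP => // _; rewrite hornerC mul1r expR_ge0. Qed.

Lemma flat1_gt0 (x : R) : 0 < x -> 0 < flat 1 x.
Proof. by move=> x0; rewrite /flat x0 hornerC mul1r expR_gt0. Qed.

Lemma flat1_le1 (x : R) : flat 1 x <= 1.
Proof.
rewrite /flat; case: ifP => // x0; rewrite hornerC mul1r -(@expR0 R) ler_expR.
by rewrite oppr_le0 invr_ge0 ltW.
Qed.

Lemma flat_le0 (p : {poly R}) (x : R) : x <= 0 -> flat p x = 0.
Proof. by rewrite /flat leNgt => /negbTE ->. Qed.

Definition smooth_bump (x : R) : R := flat 1 (1 * x + 1) * flat 1 (-1 * x + 1).

Lemma smooth1_bump : smooth1 smooth_bump.
Proof. by apply: smooth1M; apply: smooth1_affine; exact: smooth1_flat. Qed.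

Lemma smooth_bump_ge0 x : 0 <= smooth_bump x.
Proof. by rewrite mulr_ge0 // flat1_ge0. Qed.

Lemma smooth_bump_le1 x : smooth_bump x <= 1.
Proof. by rewrite mulr_ile1 ?flat1_ge0 ?flat1_le1. Qed.

Lemma smooth_bump_gt0 x : `|x| < 1 -> 0 < smooth_bump x.
Proof.
by rewrite ltr_norml => /andP[a b]; rewrite mulr_gt0 // flat1_gt0 //; lra.
Qed.

Lemma smooth_bump_eq0 x : 1 <= `|x| -> smooth_bump x = 0.
Proof.
rewrite ler_normr /smooth_bump => /orP[h|h].
  by rewrite (@flat_le0 _ (-1 * x + 1)) ?mulr0 //; lra.
by rewrite (@flat_le0 _ (1 * x + 1)) ?mul0r //; lra.
Qed.

(** The usual transition from 0 for [x <= 0] to 1 for [1 <= x]; the two terms of the denominator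
    never vanish together. The spelling [-1 * x + 1] is the shape that [smooth1_affine] matches. *)
Definition step (x : R) : R := flat 1 x * (flat 1 x + flat 1 (-1 * x + 1))^-1.

Lemma step_den_gt0 x : 0 < flat 1 x + flat 1 (-1 * x + 1).
Proof.
have [x0|x0] := ltP 0 x; first by rewrite ltr_wpDr ?flat1_ge0 ?flat1_gt0.
by rewrite ltr_wpDl ?flat1_ge0 ?flat1_gt0 //; lra.
Qed.

Lemma smooth1_step : smooth1 step.
Proof.
apply: smooth1M; first exact: smooth1_flat.
apply: smooth1V; last by move=> x; rewrite gt_eqF // step_den_gt0.
by apply: smooth1D; last apply: smooth1_affine; exact: smooth1_flat.
Qed.

Lemma step_eq0 x : x <= 0 -> step x = 0.
Proof. by move=> x0; rewrite /step flat_le0 // mul0r. Qed.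

Lemma step_eq1 x : 1 <= x -> step x = 1.
Proof.
move=> x1; rewrite /step (@flat_le0 _ (-1 * x + 1)); last by lra.
by rewrite addr0 mulfV // gt_eqF // flat1_gt0 //; lra.
Qed.

Lemma step_ge0 x : 0 <= step x.
Proof. by rewrite mulr_ge0 ?flat1_ge0 // invr_ge0 ltW // step_den_gt0. Qed.

Lemma step_le1 x : step x <= 1.
Proof. by rewrite ler_pdivrMr ?step_den_gt0 // mul1r lerDl flat1_ge0. Qed.

(** The terms of the quotient rule without a definite sign cancel; what is left shows that [step]
    increases strictly on the open unit interval. [flat ('X ^+ 2)] is the derivative of [flat 1]. *)
Lemma step_derive (x : R) : (derive1 step) x =
  (flat ('X ^+ 2) x * flat 1 (-1 * x + 1) + flat 1 x * flat ('X ^+ 2) (-1 * x + 1)) /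
  (flat 1 x + flat 1 (-1 * x + 1)) ^+ 2.
Proof.
have D0 : flat 1 x + flat 1 (-1 * x + 1) != 0 by rewrite gt_eqF // step_den_gt0.
have d1 : is_derive x 1 (flat 1) (flat ('X ^+ 2) x).
  by have := is_derive_flat 1 x; rewrite derivC subr0 mulr1.
have d2 : is_derive x 1 (fun t => flat 1 (-1 * t + 1)) (flat ('X ^+ 2) (-1 * x + 1) * -1).
  apply: is_derive_affine.
  by have := is_derive_flat 1 (-1 * x + 1); rewrite derivC subr0 mulr1.
have d3 : is_derive x 1 (fun t => flat 1 t + flat 1 (-1 * t + 1))
    (flat ('X ^+ 2) x + flat ('X ^+ 2) (-1 * x + 1) * -1).
  exact: (@is_deriveD _ _ _ _ _ x 1 _ _ d1 d2).
have d4 := @is_deriveV _ (fun t => flat 1 t + flat 1 (-1 * t + 1)) x _ 1 D0 d3.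
have d5 := @is_deriveM _ _ _ _ x 1 _ _ d1 d4.
rewrite derive1E (@derive_val _ _ _ _ _ _ _ d5) /GRing.scale /=.
by field.
Qed.

Lemma step_derive_ge0 (x : R) : 0 <= (derive1 step) x.
Proof.
have f2 t : 0 <= flat ('X ^+ 2) t.
  by rewrite /flat; case: ifP => // _; rewrite hornerXn mulr_ge0 ?expR_ge0 // sqr_ge0.
by rewrite step_derive divr_ge0 ?sqr_ge0 // addr_ge0 // mulr_ge0 // flat1_ge0.
Qed.

Lemma step_derive_gt0 (x : R) : 0 < x < 1 -> 0 < (derive1 step) x.
Proof.
move=> /andP[x0 x1].
have f2 t : 0 < t -> 0 < flat ('X ^+ 2) t.
  move=> t0; rewrite /flat t0 hornerXn mulr_gt0 ?expR_gt0 //.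
  by rewrite exprn_gt0 // invr_gt0.
have x1' : 0 < -1 * x + 1 by lra.
by rewrite step_derive divr_gt0 ?exprn_gt0 ?step_den_gt0 // addr_gt0 // mulr_gt0 ?flat1_gt0 ?f2.
Qed.

Lemma step_derive_eq0 (x : R) : x <= 0 \/ 1 <= x -> (derive1 step) x = 0.
Proof.
rewrite step_derive => -[x0|x1].
  by rewrite !(@flat_le0 _ x) // !mul0r addr0 mul0r.
by rewrite !(@flat_le0 _ (-1 * x + 1)) ?mulr0 ?addr0 ?mul0r //; lra.
Qed.

Lemma step_derive_bounded : exists2 C : R, 0 < C & forall x : R, (derive1 step) x <= C.
Proof.
have c : {within `[0, 1], continuous (derive1 step)}.
  by apply: continuous_subspaceT; apply: smooth1_continuous; apply: smooth1_derive1; exact: smooth1_step.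
have [y _ Hy] := EVT_max ler01 c.
exists ((derive1 step) y + 1); first by rewrite ltr_wpDl // step_derive_ge0.
move=> x; have [x0|x0] := leP x 0.
  by rewrite step_derive_eq0; [rewrite addr_ge0 // step_derive_ge0|left].
have [x1|x1] := leP 1 x.
  by rewrite step_derive_eq0; [rewrite addr_ge0 // step_derive_ge0|right].
by apply: (le_trans (Hy x _)); rewrite ?lerDl // in_itv /= !ltW.
Qed.

End Smooth1.

(** * Sums of products of ridge functions as a supply of test functions *)

Section TensorSmooth.
Context {R : realType}.

Lemma dotDr (p x y : R * R) : dot p (x + y) = dot p x + dot p y.
Proof. by rewrite /dot /=; ring. Qed.

Lemma dotZr (p x : R * R) (a : R) : dot p (a *: x) = a * dot p x.
Proof.
have -> : a *: x = (a * x.1, a * x.2) by [].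
by rewrite /dot /=; ring.
Qed.

(** Bumps adapted to a skew strip have this form, and the class is closed under every directional
    derivative, which reduces smoothness in the plane to smoothness in one variable. *)
Inductive tensor_smooth : (R * R -> R) -> Prop :=
| TensorSmooth (c : R) a b p q : smooth1 a -> smooth1 b ->
    tensor_smooth (fun x => c * (a (dot p x) * b (dot q x)))
| TensorSmoothD f g : tensor_smooth f -> tensor_smooth g ->
    tensor_smooth (fun x => f x + g x).

Lemma continuous_dot (p : R * R) : continuous (dot p).
Proof.
move=> x; rewrite /dot; apply: cvgD; apply: cvgM; try exact: cvg_cst.
  exact: cvg_fst.
exact: cvg_snd.
Qed.

Lemma is_derive_ridge (a : R -> R) (p x d : R * R) : smooth1 a ->
  is_derive x d (fun y => a (dot p y)) ((derive1 a) (dot p x) * dot p d).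
Proof.
move=> sa; apply/is_derive_lineP.
have -> : (fun t : R => a (dot p (t *: d + x))) = (fun t => a (dot p d * t + dot p x)).
  by apply/funext => t; rewrite dotDr dotZr mulrC.
apply: is_derive_affine; rewrite mulr0 add0r.
exact: smooth1_is_derive.
Qed.

Lemma is_derive_tensor (c : R) a b (p q x d : R * R) : smooth1 a -> smooth1 b ->
  is_derive x d (fun x => c * (a (dot p x) * b (dot q x)))
   (c * dot p d * ((derive1 a) (dot p x) * b (dot q x)) +
    c * dot q d * (a (dot p x) * (derive1 b) (dot q x))).
Proof.
move=> sa sb.
have da := is_derive_ridge p x d sa; have db := is_derive_ridge q x d sb.
have := @is_deriveM _ _ _ _ x d _ _ da db => dab.
have := @is_deriveZ _ _ _ _ c x d _ dab.
by apply: is_derive_ext => //; rewrite /GRing.scale /=; ring.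
Qed.

Lemma tensor_smooth_derive f (d : R * R) : tensor_smooth f ->
  (forall x, derivable f x d) /\ tensor_smooth (fun x => 'D_d f x).
Proof.
elim=> [c a b p q sa sb|{}f g _ [df sf] _ [dg sg]].
  split=> [x|]; first by have [] := is_derive_tensor c p q x d sa sb.
  have -> : (fun x => 'D_d (fun x => c * (a (dot p x) * b (dot q x))) x) =
      (fun x => c * dot p d * ((derive1 a) (dot p x) * b (dot q x)) +
         c * dot q d * (a (dot p x) * (derive1 b) (dot q x))).
    by apply/funext => x; have [_ ->] := is_derive_tensor c p q x d sa sb.
  by apply: TensorSmoothD; apply: TensorSmooth => //; exact: smooth1_derive1.
split=> [x|]; first exact: derivableD.
have -> : (fun x => 'D_d (fun x => f x + g x) x) = (fun x => 'D_d f x + 'D_d g x).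
  by apply/funext => x; rewrite -deriveD.
exact: TensorSmoothD.
Qed.

Lemma tensor_smooth_continuous f : tensor_smooth f -> continuous f.
Proof.
elim=> [c a b p q sa sb|{}f g _ cf _ cg] x; last by apply: cvgD; [exact: cf|exact: cg].
apply: cvgM; first exact: cvg_cst.
by apply: cvgM; apply: continuous_comp; try exact: continuous_dot;
  exact: smooth1_continuous.
Qed.

Lemma tensor_smooth2 f : tensor_smooth f -> smooth2 f.
Proof.
move=> tf s.
suff H : tensor_smooth (pd_word s f).
  by split; [exact: tensor_smooth_continuous|move=> x; apply tensor_smooth_derive..].
elim: s => [//|b s IH] /=.
by case: b; apply tensor_smooth_derive.
Qed.

End TensorSmooth.

(** * Measurability in the plane and classical integration by parts *)

Section PlaneMeasure.
Context {R : realType}.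
Local Notation plane := (measurableTypeR R * measurableTypeR R)%type.
Local Notation mu := (@lebesgue_measure R).

Definition cbox (c : R * R) (r : R) : set (R * R) := [set w | `|w - c| <= r].

Lemma cboxE (c : R * R) (r : R) :
  cbox c r = `[c.1 - r, c.1 + r] `*` `[c.2 - r, c.2 + r].
Proof.
apply/seteqP; split => w; rewrite /cbox /= norm_pair_le /= !ler_distl !in_itv /=.
  by move=> /andP[].
by move=> [-> ->].
Qed.

Lemma measurable_cbox (c : R * R) (r : R) : measurable (cbox c r : set plane).
Proof. by rewrite cboxE; apply: measurableX; exact: measurable_itv. Qed.

Lemma mu2_cbox (c : R * R) (r : R) : 0 <= r -> mu2 (cbox c r) = ((2 * r) ^+ 2)%:E.
Proof.
move=> r0; rewrite cboxE.
have E (a : R) : mu `[a - r, a + r]%classic = (2 * r)%:E.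
  rewrite lebesgue_measure_itv /= lte_fin; case: ltP => h.
    by rewrite -EFinD; congr EFin; ring.
  by congr EFin; lra.
transitivity (mu `[(c.1 - r)%R, (c.1 + r)%R]%classic * mu `[(c.2 - r)%R, (c.2 + r)%R]%classic)%E.
  by apply: product_measure1E; exact: measurable_itv.
by rewrite (E c.1) (E c.2) -EFinM expr2.
Qed.

(** Squares with rational data, replaced by the empty set when they leave [O]. The cover makes open
    sets measurable for the product sigma-algebra, and it reduces measurability on [O] to compact
    subsets, which is where local integrability gives information. *)
Lemma open_compact_cover (O : set (R * R)) : open O ->
  exists K : nat -> set (R * R),
    [/\ forall n, compact (K n), forall n, measurable (K n : set plane),
        forall n, K n `<=` O & O = \bigcup_n K n].
Proof.
move=> oO.
pose B (q : rat * rat * rat) : set (R * R) :=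
  let C := cbox (ratr q.1.1, ratr q.1.2) (ratr q.2) in if pselect (C `<=` O) then C else set0.
have cB q : compact (B q).
  by rewrite /B; case: pselect => [?|?]; [exact: compact_cball|exact: compact0].
have mB q : measurable (B q : set plane).
  by rewrite /B; case: pselect => [?|?]; [exact: measurable_cbox|exact: measurable0].
have sB q : B q `<=` O by rewrite /B; case: pselect => [//|?] x [].
pose K n := if unpickle n is Some q then B q else set0.
exists K; split.
- by move=> n; rewrite /K; case: unpickle => [q|] //; exact: compact0.
- by move=> n; rewrite /K; case: unpickle => [q|] //; exact: measurable0.
- by move=> n; rewrite /K; case: unpickle => [q|] //; exact: sB.
apply/seteqP; split => x; last first.
  by move=> [n _]; rewrite /K; case: unpickle => [q|] //; exact: sB.
move=> Ox; have := open_nbhs_nbhs (conj oO Ox).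
move=> /nbhs_ballP[d /= d0 dO].
(* A centre within [d / 4] of [x] in each coordinate and a radius between [d / 4] and [d / 2]: the
   square contains [x] and stays within distance [3 d / 4] of it. *)
have [a] := @rat_in_itvoo R (x.1 - d / 4) (x.1 + d / 4) ltac:(lra).
have [b] := @rat_in_itvoo R (x.2 - d / 4) (x.2 + d / 4) ltac:(lra).
have [r] := @rat_in_itvoo R (d / 4) (d / 2) ltac:(lra).
rewrite !in_itv /= => /andP[r1 r2] /andP[b1 b2] /andP[a1 a2].
have [n En] : exists n, unpickle n = Some (a, b, r).
  by exists (pickle (a, b, r)); exact: pickleK.
exists n; rewrite // /K En.
rewrite /B /=; case: pselect => [?|]; last first.
  case=> w; rewrite /cbox /= norm_pair_le /= !ler_distl => /andP[/andP[w1 w2] /andP[w3 w4]].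
  apply: dO; rewrite -ball_normE /= norm_pair_lt /= !ltr_distl.
  by apply/andP; split; apply/andP; split; lra.
rewrite /cbox /= norm_pair_le /= !ler_distl.
by apply/andP; split; apply/andP; split; lra.
Qed.

Lemma open_measurable2 (O : set (R * R)) : open O -> measurable (O : set plane).
Proof.
move=> /open_compact_cover[K [_ mK _ ->]]; exact: bigcupT_measurable.
Qed.

Lemma compact_measurable2 (K : set (R * R)) : compact K -> measurable (K : set plane).
Proof.
move=> cK; rewrite -(setCK K); apply: measurableC; apply: open_measurable2.
by apply: closed_openC; apply: compact_closed => //; exact: norm_hausdorff.
Qed.

Lemma measurable_on_open (O : set (R * R)) (f : R * R -> R) : open O ->
  (forall K, compact K -> K `<=` O -> measurable_fun (K : set plane) f) ->
  measurable_fun (O : set plane) f.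
Proof.
move=> /open_compact_cover[K [cK mK sK ->]] H.
by apply/measurable_fun_bigcup => // n; apply: H => // x Kx; exists n.
Qed.

Lemma continuous_measurable2 (f : R * R -> R) : continuous f ->
  measurable_fun (setT : set plane) f.
Proof.
move=> /continuousP cf; apply: (measurability _ (measurable_realfun.RGenOpens.measurableE R)).
move=> _ [_ [a [b ->] <-]]; rewrite setTI; apply: open_measurable2.
exact/cf/interval_open.
Qed.

Lemma compact_sub_cbox (K : set (R * R)) : compact K ->
  exists2 L : R, 0 < L & K `<=` cbox 0 L.
Proof.
move=> /compact_bounded/ex_strict_bound_gt0[L L0 H].
by exists L => // x Kx; rewrite /cbox /= subr0; apply/ltW/H.
Qed.

Lemma mu2_compact_fin (K : set (R * R)) : compact K -> (mu2 K < +oo)%E.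
Proof.
move=> cK; have [L L0 KL] := compact_sub_cbox cK.
apply: (@le_lt_trans _ _ (mu2 (cbox 0 L))).
  by apply: le_measure => //; rewrite inE; [exact: compact_measurable2|exact: measurable_cbox].
by rewrite mu2_cbox ?ltW // ltry.
Qed.

Lemma integrable_continuous_compact (f : R * R -> R) (K : set (R * R)) :
  continuous f -> compact K -> mu2.-integrable (K : set plane) (EFin \o f).
Proof.
move=> cf cK; apply: measurable_bounded_integrable.
- exact: compact_measurable2.
- exact: mu2_compact_fin.
- by apply: measurable_funTS; exact: continuous_measurable2.
- have := @within_bounded R K f cK (continuous_subspaceT cf) => -[M M0 HM].
  exists M; split; first exact: num_real.
  by move=> M' MM' x Kx; apply: (le_trans (HM x Kx)); exact: ltW.
Qed.

Lemma integrable_continuous_support (f : R * R -> R) (K : set (R * R)) :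
  continuous f -> compact K -> (forall x, ~ K x -> f x = 0) ->
  mu2.-integrable (setT : set plane) (EFin \o f).
Proof.
move=> cf cK f0.
have := integrable_continuous_compact cf cK.
move/(integrable_mkcond _ (compact_measurable2 cK)).
apply: eq_integrable => // x _.
rewrite /= patchE; case: ifPn => // /negP; rewrite inE => nK.
by rewrite f0.
Qed.

Lemma integral_compact_support1 (h H : R -> R) (L : R) : 0 < L -> continuous h ->
  (forall x : R, is_derive x 1 H (h x)) -> (forall x : R, L <= `|x| -> H x = 0 /\ h x = 0) ->
  (\int[mu]_x (h x)%:E = 0)%E.
Proof.
move=> L0 ch dH HL.
have -> : (fun x => (h x)%:E) = ((fun x => (h x)%:E) \_ `[- L, L]).
  apply/funext => x; rewrite patchE; case: ifPn => //.
  rewrite mem_setE in_itv /= -ler_norml -ltNge => /ltW xL.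
  by have [_ ->] := HL x xL.
rewrite -integral_mkcond.
have cH x : {for x, continuous H}.
  by apply: differentiable_continuous; apply/derivable1_diffP; have [] := dH x.
rewrite (@continuous_FTC2 _ h H).
- have [|-> _] := HL L; first exact: ler_norm.
  have [|-> _] := HL (- L); first by rewrite normrN ler_norm.
  by rewrite subee.
- by lra.
- exact: continuous_subspaceT.
- split.
  + by move=> x _; have [] := dH x.
  + exact: (cvg_at_right_filter (cH _)).
  + exact: (cvg_at_left_filter (cH _)).
- by move=> x _; rewrite derive1E; have [_ ->] := dH x.
Qed.

Lemma continuous_pairl (y : R) : continuous (fun x : R => (x, y)).
Proof.
move=> x; apply/cvgrPdist_lt => e e0; apply/nbhs_normP; exists e => //= t te.
by rewrite norm_pair_lt /= te subrr normr0.
Qed.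

Lemma continuous_pairr (x : R) : continuous (fun y : R => (x, y)).
Proof.
move=> y; apply/cvgrPdist_lt => e e0; apply/nbhs_normP; exists e => //= t te.
by rewrite norm_pair_lt /= subrr normr0 e0.
Qed.

(** Fubini with the direction of differentiation as inner variable; on each line the fundamental
    theorem of calculus gives zero. *)
Lemma integral_derive_compact_support (d : R * R) (h H : R * R -> R) (K : set (R * R)) :
  d = (1, 0) \/ d = (0, 1) -> compact K -> continuous h ->
  (forall x, is_derive x d H (h x)) -> (forall x, ~ K x -> H x = 0 /\ h x = 0) ->
  (\int[mu2]_x (h x)%:E = 0)%E.
Proof.
move=> Hd cK ch dH HK; have [L L0 KL] := compact_sub_cbox cK.
have int := integrable_continuous_support ch cK (fun x nK => (HK x nK).2).
(* [K] may touch the sides of the box of half-width [L]; at [L + 1] a coordinate is certainly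
   outside. *)
have out (x : R * R) : L + 1 <= `|x.1| \/ L + 1 <= `|x.2| -> H x = 0 /\ h x = 0.
  move=> hx; apply: HK => /KL; rewrite /cbox /= subr0 norm_pair_le => /andP[? ?].
  by case: hx; lra.
have L1 : 0 < L + 1 by lra.
case: Hd => dE; rewrite {d}dE in dH.
  rewrite -(integral21_prod_meas1 int) /fubini_G.
  apply: integral0_eq => y _.
  apply: (@integral_compact_support1 (fun x => h (x, y)) (fun x => H (x, y)) _ L1).
  - move=> x; apply: (@continuous_comp _ _ _ (fun x => (x, y)) h); last exact: ch.
    exact: continuous_pairl.
  - by move=> x; have /is_derive_fst := dH (x, y).
  - by move=> x hx; apply: out; left.
rewrite -(integral12_prod_meas1 int) /fubini_F.
apply: integral0_eq => x _.
apply: (@integral_compact_support1 (fun y => h (x, y)) (fun y => H (x, y)) _ L1).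
- move=> y; apply: (@continuous_comp _ _ _ (fun y => (x, y)) h); last exact: ch.
  exact: continuous_pairr.
- by move=> y; have /is_derive_snd := dH (x, y).
- by move=> y hy; apply: out; right.
Qed.

Lemma continuous_glue0 (O K : set (R * R)) (f : R * R -> R) : open O ->
  compact K -> K `<=` O -> (forall x, ~ K x -> f x = 0) ->
  (forall x, O x -> {for x, continuous f}) -> continuous f.
Proof.
move=> oO cK KO f0 cf x.
have [Ox|nO] := pselect (O x); first exact: cf.
have oKc : open (~` K).
  by apply: closed_openC; apply: compact_closed => //; exact: norm_hausdorff.
apply/(@cvgrPdist_lt _ _ _ (nbhs x)) => e e0.
have : \forall y \near x, (~` K) y.
  by apply: open_nbhs_nbhs; split=> // /KO.
apply: filterS => y nKy; rewrite f0; last by move=> /KO.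
by rewrite (f0 _ nKy) subrr normr0.
Qed.

(** The product [phi * chi] vanishes off [K], so it is differentiable on the whole plane whatever
    [phi] does outside [O], and the integral of its derivative is zero. *)
Lemma integration_by_parts2 (d : R * R) (O K : set (R * R)) (phi g chi chi' : R * R -> R) :
  d = (1, 0) \/ d = (0, 1) -> open O -> compact K -> K `<=` O ->
  (forall x, O x -> {for x, continuous phi}) -> (forall x, O x -> {for x, continuous g}) ->
  (forall x, O x -> is_derive x d phi (g x)) ->
  continuous chi -> continuous chi' -> (forall x, is_derive x d chi (chi' x)) ->
  (forall x, ~ K x -> chi x = 0 /\ chi' x = 0) ->
  \int[mu2]_(x in O) (phi x * chi' x) = - \int[mu2]_(x in O) (g x * chi x).
Proof.
move=> Hd oO cK KO cphi cg dphi cchi cchi' dchi chi0.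
have oKc : open (~` K).
  by apply: closed_openC; apply: compact_closed => //; exact: norm_hausdorff.
have c1 : continuous (fun x => phi x * chi' x).
  apply: (continuous_glue0 oO cK KO) => [x nK|x Ox]; first by rewrite (chi0 x nK).2 mulr0.
  by apply: cvgM; [exact: cphi|exact: cchi'].
have c2 : continuous (fun x => g x * chi x).
  apply: (continuous_glue0 oO cK KO) => [x nK|x Ox]; first by rewrite (chi0 x nK).1 mulr0.
  by apply: cvgM; [exact: cg|exact: cchi].
have onO (f : R * R -> R) : (forall x, ~ K x -> f x = 0) ->
    \int[mu2]_(x in O) f x = \int[mu2]_x f x.
  move=> f0; rewrite Rintegral_mkcond; congr (Rintegral _ _ _).
  apply/funext => x; rewrite patchE; case: ifPn => // /negP; rewrite inE => nO.
  by rewrite f0 // => /KO.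
have i1 := integrable_continuous_support c1 cK (fun x nK => etrans (congr1 _ (chi0 x nK).2) (mulr0 _)).
have i2 := integrable_continuous_support c2 cK (fun x nK => etrans (congr1 _ (chi0 x nK).1) (mulr0 _)).
rewrite !onO; first last.
- by move=> x /chi0[_ ->]; rewrite mulr0.
- by move=> x /chi0[-> _]; rewrite mulr0.
apply/eqP; rewrite -subr_eq0 opprK -RintegralD //; apply/eqP.
suff E : (\int[mu2]_x (phi x * chi' x + g x * chi x)%:E = 0)%E by rewrite /Rintegral E.
apply: (@integral_derive_compact_support d _ (fun x => phi x * chi x) K) => //.
- by move=> x; apply: cvgD; [exact: c1|exact: c2].
- move=> x; have [Ox|nO] := pselect (O x).
    have dp := dphi x Ox; have dc := dchi x.
    have := @is_deriveM _ _ phi chi x d _ _ dp dc.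
    by apply: is_derive_ext => //; rewrite /GRing.scale /= [chi x * _]mulrC.
  have nK : ~ K x by move=> /KO.
  have [e1 e2] := chi0 x nK.
  have d0 : is_derive x d (fun=> 0 : R) (0 : R) by exact: is_derive_cst.
  rewrite e1 e2 !mulr0 addr0; apply: near_eq_is_derive d0.
  have : \forall y \near x, (~` K) y by apply: open_nbhs_nbhs; split.
  by apply: filterS => y /chi0[-> _]; rewrite mulr0.
- by move=> x nK; have [-> ->] := chi0 x nK; rewrite !mulr0 addr0.
Qed.

End PlaneMeasure.

(** * From weak derivatives to a bound on a single value of the gradient *)

Section WeakIdentity.
Context {R : realType}.
Local Notation plane := (measurableTypeR R * measurableTypeR R)%type.

Lemma derive_support (d : R * R) (K : set (R * R)) (f : R * R -> R) : compact K ->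
  (forall x, ~ K x -> f x = 0) -> forall x, ~ K x -> 'D_d f x = 0.
Proof.
move=> cK f0 x nK.
have oKc : open (~` K).
  by apply: closed_openC; apply: compact_closed => //; exact: norm_hausdorff.
have d0 : is_derive x d (fun=> 0 : R) (0 : R) by exact: is_derive_cst.
have : is_derive x d f 0.
  apply: near_eq_is_derive d0.
  have : \forall y \near x, (~` K) y by apply: open_nbhs_nbhs; split.
  by apply: filterS => y /f0 ->.
by move=> [_ ->].
Qed.

Lemma Rintegral_support (O K : set (R * R)) (f : R * R -> R) : K `<=` O ->
  (forall x, ~ K x -> f x = 0) -> \int[mu2]_(x in O) f x = \int[mu2]_(x in K) f x.
Proof.
move=> KO f0; rewrite Rintegral_mkcond [RHS]Rintegral_mkcond; congr (Rintegral _ _ _).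
apply/funext => x; rewrite !patchE.
case: ifPn => [xO|/negP]; case: ifPn => // /negP; rewrite !inE => h.
- by rewrite f0.
- by move=> nO; case: h => /KO.
Qed.

Lemma integrable_mul_bounded (K : set (R * R)) (f g : R * R -> R) : compact K ->
  mu2.-integrable (K : set plane) (EFin \o f) -> continuous g ->
  mu2.-integrable (K : set plane) (EFin \o (fun x => f x * g x)).
Proof.
move=> cK int_f cg; have mK := compact_measurable2 cK.
have [M M0 HM] := within_bounded cK (continuous_subspaceT cg).
have mf : measurable_fun (K : set plane) f by apply/measurable_EFinP; apply: measurable_int int_f.
have mg : measurable_fun (K : set plane) g.
  by apply: measurable_funTS; exact: continuous_measurable2.
apply: (@le_integrable _ _ _ _ _ mK _ (EFin \o (fun x => M * f x))).
- by apply/measurable_EFinP; exact: measurable_funM.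
- move=> x Kx /=; rewrite lee_fin !normrM mulrC ler_wpM2r //.
  by apply: (le_trans (HM x Kx)); exact: ler_norm.
- exact: (@integrableZl _ _ _ _ _ mK M _ int_f).
Qed.

(* The derivative of [psi] in the direction [e] splits into a part [chi1] near
   one end of the support and a part [chi2] at the other end.  Classical
   integration by parts is used for [chi1] only and weak derivatives for the
   rest; [wa] stands for a first and [wb], [wc] for second weak derivatives. *)
Lemma weak_identity (d e : R * R) (O K : set (R * R)) (phi g wa wb wc psi chi1 chi2 : R * R -> R) :
  d = (1, 0) \/ d = (0, 1) -> open O -> compact K -> K `<=` O ->
  (forall x, O x -> {for x, continuous phi}) -> (forall x, O x -> {for x, continuous g}) ->
  (forall x, O x -> is_derive x d phi (g x)) ->
  tensor_smooth psi -> tensor_smooth chi1 -> tensor_smooth chi2 ->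
  (forall x, ~ K x -> [/\ psi x = 0, chi1 x = 0 & chi2 x = 0]) ->
  (forall x, e.1 * pd1 psi x + e.2 * pd2 psi x = chi1 x + chi2 x) ->
  \int[mu2]_(x in O) (phi x * 'D_d chi2 x) = - (\int[mu2]_(x in O) (wa x * chi2 x)) ->
  \int[mu2]_(x in O) (phi x * 'D_d (pd1 psi) x) = \int[mu2]_(x in O) (wb x * psi x) ->
  \int[mu2]_(x in O) (phi x * 'D_d (pd2 psi) x) = \int[mu2]_(x in O) (wc x * psi x) ->
  \int[mu2]_(x in O) (g x * chi1 x) =
    - (\int[mu2]_(x in O) (wa x * chi2 x) + e.1 * \int[mu2]_(x in O) (wb x * psi x)
       + e.2 * \int[mu2]_(x in O) (wc x * psi x)).
Proof.
have aux (I a b c : R) : - I + - a = b + c -> I = - (a + b + c) by move=> h; lra.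
move=> Hd oO cK KO cphi cg dphi tp t1 t2 supp Hde Ha Hb Hc.
have [d1 td1] := tensor_smooth_derive d t1; have [d2 td2] := tensor_smooth_derive d t2.
have [_ tp1] := tensor_smooth_derive (1, 0) tp.
have [_ tp2] := tensor_smooth_derive (0, 1) tp.
have [dp1 tdp1] := tensor_smooth_derive d tp1; have [dp2 tdp2] := tensor_smooth_derive d tp2.
have IBP : \int[mu2]_(x in O) (phi x * 'D_d chi1 x) = - (\int[mu2]_(x in O) (g x * chi1 x)).
  apply: (integration_by_parts2 Hd oO cK KO cphi cg dphi).
  - exact: tensor_smooth_continuous.
  - exact: tensor_smooth_continuous.
  - by move=> x; exact: derivableP.
  - move=> x nK; have [_ -> _] := supp x nK; split=> //.
    by apply: (@derive_support d K chi1 cK _ x nK) => y /supp[].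
have int f : tensor_smooth f -> (forall x, ~ K x -> f x = 0) ->
    mu2.-integrable (O : set plane) (EFin \o (fun x => phi x * f x)).
  move=> tf f0; apply: (@integrableS _ _ _ _ setT) => //; first exact: open_measurable2.
  apply: (integrable_continuous_support _ cK).
    apply: (continuous_glue0 oO cK KO) => [x nK|x Ox]; first by rewrite f0 // mulr0.
    by apply: cvgM; [exact: cphi|exact: tensor_smooth_continuous].
  by move=> x nK; rewrite f0 // mulr0.
have s1 x : ~ K x -> chi1 x = 0 by move=> /supp[].
have s2 x : ~ K x -> chi2 x = 0 by move=> /supp[].
have sp x : ~ K x -> psi x = 0 by move=> /supp[].
have sp1 := derive_support (1, 0) cK sp; have sp2 := derive_support (0, 1) cK sp.
have i1 := int _ td1 (derive_support d cK s1); have i2 := int _ td2 (derive_support d cK s2).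
have ip1 := int _ tdp1 (derive_support d cK sp1); have ip2 := int _ tdp2 (derive_support d cK sp2).
have mO := open_measurable2 oO.
(* This is the splitting of the derivative of [psi] along [e], differentiated once more in the
   direction [d] and paired with [phi]. *)
have E : \int[mu2]_(x in O) (phi x * 'D_d chi1 x) + \int[mu2]_(x in O) (phi x * 'D_d chi2 x) =
   e.1 * \int[mu2]_(x in O) (phi x * 'D_d (pd1 psi) x) +
   e.2 * \int[mu2]_(x in O) (phi x * 'D_d (pd2 psi) x).
  have z1 : mu2.-integrable (O : set plane) (EFin \o (fun x => e.1 * (phi x * 'D_d (pd1 psi) x))).
    exact: (@integrableZl _ _ _ _ _ mO e.1 _ ip1).
  have z2 : mu2.-integrable (O : set plane) (EFin \o (fun x => e.2 * (phi x * 'D_d (pd2 psi) x))).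
    exact: (@integrableZl _ _ _ _ _ mO e.2 _ ip2).
  rewrite -(RintegralZl e.1 mO ip1) -(RintegralZl e.2 mO ip2).
  rewrite -(RintegralD mO i1 i2) -(RintegralD mO z1 z2).
  apply: eq_Rintegral => x _.
  have Ex : 'D_d chi1 x + 'D_d chi2 x = e.1 * 'D_d (pd1 psi) x + e.2 * 'D_d (pd2 psi) x.
    rewrite -deriveD // -[e.1 * _]/(e.1 *: _) -[e.2 * _]/(e.2 *: _) -!deriveZ //.
    rewrite -deriveD; [|exact: derivableZ|exact: derivableZ].
    by congr ('D_d _ x); apply/funext => y; exact: (esym (Hde y)).
  have aux2 (p a b k c l m : R) : a + b = k * c + l * m ->
    p * a + p * b = k * (p * c) + l * (p * m) by move=> h; rewrite -mulrDr h; ring.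
  exact: aux2.
apply: aux; exact: (etrans (etrans (f_equal2 +%R (esym IBP) (esym Ha)) E)
  (f_equal2 +%R (f_equal ( *%R e.1) Hb) (f_equal ( *%R e.2) Hc))).
Qed.

(** On the support of [chi1] the classical derivative [g] is frozen at [g0] with error [om], so the
    left side of [weak_identity] is nearly [g0] times the mass of [chi1]; its right side only
    involves weak derivatives, with bounded weights. *)
Lemma local_bound (d e : R * R) (O K : set (R * R)) (phi g wa wb wc psi chi1 chi2 : R * R -> R)
    (g0 om B : R) :
  d = (1, 0) \/ d = (0, 1) -> open O -> compact K -> K `<=` O ->
  (forall x, O x -> {for x, continuous phi}) -> (forall x, O x -> {for x, continuous g}) ->
  (forall x, O x -> is_derive x d phi (g x)) ->
  tensor_smooth psi -> tensor_smooth chi1 -> tensor_smooth chi2 ->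
  (forall x, ~ K x -> [/\ psi x = 0, chi1 x = 0 & chi2 x = 0]) ->
  (forall x, e.1 * pd1 psi x + e.2 * pd2 psi x = chi1 x + chi2 x) ->
  \int[mu2]_(x in O) (phi x * 'D_d chi2 x) = - (\int[mu2]_(x in O) (wa x * chi2 x)) ->
  \int[mu2]_(x in O) (phi x * 'D_d (pd1 psi) x) = \int[mu2]_(x in O) (wb x * psi x) ->
  \int[mu2]_(x in O) (phi x * 'D_d (pd2 psi) x) = \int[mu2]_(x in O) (wc x * psi x) ->
  mu2.-integrable (K : set plane) (EFin \o wa) ->
  mu2.-integrable (K : set plane) (EFin \o wb) ->
  mu2.-integrable (K : set plane) (EFin \o wc) ->
  (forall x, 0 <= chi1 x) -> (forall x, chi1 x != 0 -> `|g x - g0| <= om) ->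
  (forall x, [/\ `|chi2 x| <= B, `|e.1 * psi x| <= B & `|e.2 * psi x| <= B]) ->
  `|g0| * \int[mu2]_(x in K) chi1 x <= om * \int[mu2]_(x in K) chi1 x +
    B * \int[mu2]_(x in K) (`|wa x| + `|wb x| + `|wc x|).
Proof.
move=> Hd oO cK KO cphi cg dphi tp t1 t2 supp Hde Ha Hb Hc ia ib ic chi0 gg0 HB.
have ID := weak_identity Hd oO cK KO cphi cg dphi tp t1 t2 supp Hde Ha Hb Hc.
have mK := compact_measurable2 cK.
have s1 x : ~ K x -> chi1 x = 0 by move=> /supp[].
have s2 x : ~ K x -> chi2 x = 0 by move=> /supp[].
have sp x : ~ K x -> psi x = 0 by move=> /supp[].
have onK (f h : R * R -> R) : (forall x, ~ K x -> h x = 0) ->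
    \int[mu2]_(x in O) (f x * h x) = \int[mu2]_(x in K) (f x * h x).
  by move=> h0; apply: (Rintegral_support KO) => x /h0 ->; rewrite mulr0.
rewrite !onK // in ID.
have i1 : mu2.-integrable (K : set plane) (EFin \o chi1).
  by apply: integrable_continuous_compact => //; exact: tensor_smooth_continuous.
have ig : mu2.-integrable (K : set plane) (EFin \o (fun x => g x * chi1 x)).
  apply: integrable_continuous_compact => //.
  apply: (continuous_glue0 oO cK KO) => [x nK|x Ox]; first by rewrite s1 // mulr0.
  by apply: cvgM; [exact: cg|exact: tensor_smooth_continuous].
have iga := integrable_mul_bounded cK ia (tensor_smooth_continuous t2).
have igb := integrable_mul_bounded cK ib (tensor_smooth_continuous tp).
have igc := integrable_mul_bounded cK ic (tensor_smooth_continuous tp).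
have iaa : mu2.-integrable (K : set plane) (EFin \o (fun x => `|wa x|)) by exact: integrable_abse ia.
have iab : mu2.-integrable (K : set plane) (EFin \o (fun x => `|wb x|)) by exact: integrable_abse ib.
have iac : mu2.-integrable (K : set plane) (EFin \o (fun x => `|wc x|)) by exact: integrable_abse ic.
have bnd (w h : R * R -> R) (k : R) : mu2.-integrable (K : set plane) (EFin \o w) ->
    continuous h -> (forall x, `|k * h x| <= B) ->
    `|k * \int[mu2]_(x in K) (w x * h x)| <= B * \int[mu2]_(x in K) `|w x|.
  move=> iw ch hB; have iwh := integrable_mul_bounded cK iw ch.
  have iaw : mu2.-integrable (K : set plane) (EFin \o (fun x => `|w x|)) by exact: integrable_abse iw.
  rewrite -RintegralZl //.
  have ik : mu2.-integrable (K : set plane) (EFin \o (fun x => k * (w x * h x))).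
    exact: (@integrableZl _ _ _ _ _ mK k _ iwh).
  apply: (le_trans (le_normr_Rintegral mK ik)); rewrite -RintegralZl //.
  apply: le_Rintegral => //; first exact: integrable_abse ik.
    exact: (@integrableZl _ _ _ _ _ mK B _ iaw).
  by move=> x _; rewrite mulrCA normrM mulrC ler_wpM2r.
have ba := bnd wa chi2 1 ia (tensor_smooth_continuous t2) (fun x => let: And3 a _ _ := HB x in ltac:(by rewrite mul1r)).
have bb := bnd wb psi e.1 ib (tensor_smooth_continuous tp) (fun x => let: And3 _ a _ := HB x in a).
have bc := bnd wc psi e.2 ic (tensor_smooth_continuous tp) (fun x => let: And3 _ _ a := HB x in a).
have -> : \int[mu2]_(x in K) (`|wa x| + `|wb x| + `|wc x|) =
   \int[mu2]_(x in K) `|wa x| + \int[mu2]_(x in K) `|wb x| + \int[mu2]_(x in K) `|wc x|.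
  rewrite -!RintegralD //.
  exact: (@integrableD _ _ _ _ _ mK _ _ iaa iab).
have i0 : mu2.-integrable (K : set plane) (EFin \o (fun x => g0 * chi1 x)).
  exact: (@integrableZl _ _ _ _ _ mK g0 _ i1).
have idf : mu2.-integrable (K : set plane) (EFin \o (fun x => g0 * chi1 x - g x * chi1 x)).
  exact: (@integrableB _ _ _ _ _ mK _ _ i0 ig).
have bd : `|\int[mu2]_(x in K) (g0 * chi1 x - g x * chi1 x)| <= om * \int[mu2]_(x in K) chi1 x.
  apply: (le_trans (le_normr_Rintegral mK idf)); rewrite -RintegralZl //.
  apply: le_Rintegral => //; first exact: integrable_abse idf.
    exact: (@integrableZl _ _ _ _ _ mK om _ i1).
  move=> x _; rewrite -mulrBl normrM (ger0_norm (chi0 x)).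
  have [->|c0] := eqVneq (chi1 x) 0; first by rewrite !mulr0.
  by rewrite ler_wpM2r // distrC; exact: gg0.
have M0 : 0 <= \int[mu2]_(x in K) chi1 x by apply: Rintegral_ge0.
rewrite -{1}(ger0_norm M0) -normrM -(RintegralZl g0 mK i1).
have -> : \int[mu2]_(x in K) (g0 * chi1 x) =
    \int[mu2]_(x in K) (g0 * chi1 x - g x * chi1 x) + \int[mu2]_(x in K) (g x * chi1 x).
  by rewrite RintegralB // subrK.
apply: (le_trans (ler_normD _ _)); apply: lerD => //.
rewrite ID normrN !mulrDr; rewrite mul1r in ba.
exact: (le_trans (ler_normD _ _) (lerD (le_trans (ler_normD _ _) (lerD ba bb)) bc)).
Qed.

(** Pointwise, [f <= t / 2 + f^2 / (2 t)]. The parameter stays free because its best value depends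
    on the quantity being estimated, see [absorb]. *)
Lemma young_integral (K : set (R * R)) (f : R * R -> R) (t : R) : compact K ->
  mu2.-integrable (K : set plane) (EFin \o f) -> (forall x, 0 <= f x) -> 0 < t ->
  ((\int[mu2]_(x in K) f x)%:E <=
    (t / 2)%:E * mu2 K + ((2 * t)^-1)%:E * \int[mu2]_(x in K) (f x ^+ 2)%:E)%E.
Proof.
move=> cK int_f f0 t0; have mK := compact_measurable2 cK.
have mf : measurable_fun (K : set plane) f by apply/measurable_EFinP; apply: measurable_int int_f.
rewrite /Rintegral fineK; last exact: integrable_fin_num.
rewrite -integral_cst // -ge0_integralZl //; first last.
- by rewrite lee_fin invr_ge0 mulr_ge0 // ltW.
- by move=> x _; rewrite lee_fin sqr_ge0.
- by apply/measurable_EFinP; exact: measurable_funX.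
rewrite -ge0_integralD //; first last.
- apply: emeasurable_funM => //.
  by apply/measurable_EFinP; exact: measurable_funX.
- by move=> x _; rewrite -EFinM lee_fin mulr_ge0 ?sqr_ge0 // invr_ge0 mulr_ge0 // ltW.
- by move=> x _; rewrite lee_fin divr_ge0 // ltW.
apply: ge0_le_integral => //.
- by move=> x _; rewrite lee_fin.
- exact/measurable_EFinP.
- apply/measurable_EFinP; apply: measurable_funD => //.
  by apply: measurable_funM => //; exact: measurable_funX.
move=> x _ /=; rewrite -EFinM -EFinD lee_fin -subr_ge0.
have -> : t / 2 + (2 * t)^-1 * f x ^+ 2 - f x = (2 * t)^-1 * (t - f x) ^+ 2.
  by field; rewrite gt_eqF.
by rewrite mulr_ge0 ?sqr_ge0 // invr_ge0 mulr_ge0 // ltW.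
Qed.

(** Here [X] stands for the absolute value of the gradient component, [M] for the mass of [chi1],
    and [C * eps] for the bound on the area of the strip. The point is that the factor of [Y] in the
    conclusion is free of [eps]. *)
Lemma absorb (X om eps B c C I M Y : R) : 0 <= X -> 0 < eps -> 0 < B -> 0 < c -> 0 < C ->
  0 <= om -> c * eps <= M -> X * M <= om * M + B * I -> 0 <= Y -> 0 <= I ->
  (forall t, 0 < t -> I <= t / 2 * (C * eps) + (2 * t)^-1 * Y) ->
  eps * X ^+ 2 <= 4 * om ^+ 2 * eps + 2 * B ^+ 2 * C / c ^+ 2 * Y.
Proof.
move=> X0 e0 B0 c0 C0 om0 cM XM Y0 I0 HI.
have C2 : 0 <= 2 * B ^+ 2 * C / c ^+ 2 * Y.
  by rewrite mulr_ge0 // divr_ge0 ?sqr_ge0 // mulr_ge0 ?(ltW C0) // mulr_ge0 // sqr_ge0.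
have [Xle|omX] := leP X om.
  apply: (@le_trans _ _ (4 * om ^+ 2 * eps)); last by rewrite lerDl.
  rewrite mulrC ler_wpM2r ?(ltW e0) //.
  have : X ^+ 2 <= om ^+ 2 by rewrite ler_sqr ?nnegrE.
  by have := sqr_ge0 om; lra.
have Xp : 0 < X by exact: le_lt_trans omX.
have h1 : (X - om) * (c * eps) <= B * I.
  apply: (@le_trans _ _ ((X - om) * M)); last by rewrite mulrBl lerBlDl.
  by rewrite ler_wpM2l // subr_ge0 ltW.
(* For this [t] the area term of Young's inequality, multiplied by [B], is exactly
   [c * eps * X / 2], which the left side of [h1] absorbs. *)
have tp : 0 < c * X / (B * C) by rewrite divr_gt0 // mulr_gt0.
have h2 := HI _ tp.
have h3 : B * I <= c * eps * X / 2 + B ^+ 2 * C / (2 * c * X) * Y.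
  apply: (le_trans (ler_wpM2l (ltW B0) h2)).
  rewrite le_eqVlt; apply/orP; left; apply/eqP.
  by field; rewrite !gt_eqF.
have h4 : (X / 2 - om) * (c * eps) <= B ^+ 2 * C / (2 * c * X) * Y by lra.
(* The factor [4 * X / c] removes [X] from the denominator on the right and leaves
   [eps * (2 X^2 - 4 om X)] on the left, which is [eps * (X^2 - 4 om^2)] plus a multiple of the
   square of [X - 2 om]. *)
have h5 : (X / 2 - om) * (c * eps) * (4 * X / c) <= B ^+ 2 * C / (2 * c * X) * Y * (4 * X / c).
  by rewrite ler_wpM2r // divr_ge0 ?mulr_ge0 // ltW.
have e1 : B ^+ 2 * C / (2 * c * X) * Y * (4 * X / c) = 2 * B ^+ 2 * C / c ^+ 2 * Y.
  by field; rewrite !gt_eqF.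
have e2 : (X / 2 - om) * (c * eps) * (4 * X / c) = eps * (2 * X ^+ 2 - 4 * om * X).
  by field; rewrite gt_eqF.
rewrite e1 e2 in h5.
have : 0 <= eps * (X - 2 * om) ^+ 2 by rewrite mulr_ge0 ?sqr_ge0 // ltW.
by rewrite expr2 in h5 *; rewrite !expr2; clear -h5; nra.
Qed.

Definition weak_square (w : nat -> nat -> R * R -> R) (x : R * R) : R :=
  \sum_(i < 3) \sum_(j < 3 | (i + j <= 2)%N) (w i j x) ^+ 2.

Lemma weak_squareE w x : weak_square w x =
  w 0%N 0%N x ^+ 2 + w 0%N 1%N x ^+ 2 + w 0%N 2%N x ^+ 2 + w 1%N 0%N x ^+ 2 +
  w 1%N 1%N x ^+ 2 + w 2%N 0%N x ^+ 2.
Proof.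
rewrite /weak_square !big_ord_recl big_ord0 /=.
rewrite !(big_mkcond (fun j : 'I_3 => (_ + j <= 2)%N)) /= !big_ord_recl !big_ord0 /=.
by rewrite /fintype.bump /addn /=; ring.
Qed.

Lemma weak_square_ge0 w x : 0 <= weak_square w x.
Proof. by rewrite weak_squareE !addr_ge0 // sqr_ge0. Qed.

Lemma measurable_weak_square (O : set (R * R)) phi w : open O ->
  (forall i j, (i + j <= 2)%N -> weak_derivative O i j phi (w i j)) ->
  (forall i j, (i + j <= 2)%N -> measurable_fun (O : set plane) (fun x => w i j x ^+ 2)) /\
  measurable_fun (O : set plane) (weak_square w).
Proof.
move=> oO Hw.
have mw i j : (i + j <= 2)%N -> measurable_fun (O : set plane) (fun x => w i j x ^+ 2).
  move=> ij; apply: measurable_on_open => // K cK KO.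
  apply: measurable_funX; apply/measurable_EFinP.
  by have [_ h _] := Hw i j ij; exact: measurable_int (h K cK KO).
split=> //; rewrite (funext (weak_squareE w)).
by do 5 (apply: measurable_funD; last exact: mw); exact: mw.
Qed.

(** The weak derivative of index [(1, 1)] is tested against [pd1 (pd2 psi)]; for the derivative of
    [phi] in the direction [(0, 1)] the opposite order occurs. *)
Lemma derive_comm (h : R * R -> R) (d e : R * R) : tensor_smooth h ->
  forall x, 'D_d ('D_e h) x = 'D_e ('D_d h) x.
Proof.
elim=> [k a b p q sa sb|h1 h2 t1 IH1 t2 IH2] x; last first.
  have [d1 s1] := tensor_smooth_derive d t1; have [d2 s2] := tensor_smooth_derive d t2.
  have [e1 u1] := tensor_smooth_derive e t1; have [e2 u2] := tensor_smooth_derive e t2.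
  have Ed : 'D_d (fun x => h1 x + h2 x) = 'D_d h1 + 'D_d h2.
    by apply/funext => y; rewrite -[RHS](@deriveD _ _ _ _ _ y d).
  have Ee : 'D_e (fun x => h1 x + h2 x) = 'D_e h1 + 'D_e h2.
    by apply/funext => y; rewrite -[RHS](@deriveD _ _ _ _ _ y e).
  rewrite Ed Ee (@deriveD _ _ _ ('D_e h1) ('D_e h2)) ?(@deriveD _ _ _ ('D_d h1) ('D_d h2)).
  - exact: (f_equal2 +%R (IH1 x) (IH2 x)).
  - by have [] := tensor_smooth_derive e s1.
  - by have [] := tensor_smooth_derive e s2.
  - by have [] := tensor_smooth_derive d u1.
  - by have [] := tensor_smooth_derive d u2.
have E (n : R * R) : 'D_n (fun x => k * (a (dot p x) * b (dot q x))) =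
    (fun x => k * dot p n * (derive1 a (dot p x) * b (dot q x)) +
              k * dot q n * (a (dot p x) * derive1 b (dot q x))).
  by apply/funext => y; have [_ ->] := is_derive_tensor k p q y n sa sb.
have sa' := smooth1_derive1 sa; have sb' := smooth1_derive1 sb.
have E2 (m n : R * R) : 'D_m ('D_n (fun x => k * (a (dot p x) * b (dot q x)))) x =
   k * dot p n * dot p m * (derive1 (derive1 a) (dot p x) * b (dot q x)) +
   k * dot p n * dot q m * (derive1 a (dot p x) * derive1 b (dot q x)) +
   (k * dot q n * dot p m * (derive1 a (dot p x) * derive1 b (dot q x)) +
    k * dot q n * dot q m * (a (dot p x) * derive1 (derive1 b) (dot q x))).
  rewrite E.
  have d1 := is_derive_tensor (k * dot p n) p q x m sa' sb.
  have d2 := is_derive_tensor (k * dot q n) p q x m sa sb'.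
  by have [_ ->] := @is_deriveD _ _ _ _ _ x m _ _ d1 d2.
rewrite !E2.
move: (dot p d) (dot p e) (dot q d) (dot q e) => x1 x2 x3 x4.
move: (derive1 (derive1 a) _ * _) (derive1 a _ * derive1 b _) (_ * derive1 (derive1 b) _) => y1 y2 y3.
by ring.
Qed.

End WeakIdentity.

(** * Strips and the test functions supported on them *)

Section BoxTest.
Context {R : realType}.
Local Notation plane := (measurableTypeR R * measurableTypeR R)%type.

Lemma smooth_bump_lower : exists2 m : R, 0 < m & forall t : R, `|t| <= 1/2 -> m <= smooth_bump t.
Proof.
have c : {within `[- (1/2), 1/2], continuous (@smooth_bump R)}.
  by apply: continuous_subspaceT; apply: smooth1_continuous; exact: smooth1_bump.
have [|y] := EVT_min _ c; first by lra.
rewrite in_itv /= => /andP[y1 y2] Hy; exists (smooth_bump y).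
  by apply: smooth_bump_gt0; rewrite ltr_norml; apply/andP; split; lra.
by move=> t; rewrite ler_norml => th; apply: Hy; rewrite in_itv.
Qed.

Lemma step_derive_lower : exists2 m : R, 0 < m &
  forall t : R, 1/4 <= t <= 3/4 -> m <= derive1 step t.
Proof.
have c : {within `[1/4, 3/4], continuous (derive1 (@step R))}.
  apply: continuous_subspaceT; apply: smooth1_continuous; apply: smooth1_derive1.
  exact: smooth1_step.
have [|y] := EVT_min _ c; first by lra.
rewrite in_itv /= => /andP[y1 y2] Hy; exists (derive1 step y).
  by apply: step_derive_gt0; apply/andP; split; lra.
by move=> t th; apply: Hy; rewrite in_itv.
Qed.

(* In the coordinates [q = sol U T (x - P)] this is the strip of width [2 eps]
   around the ray in direction [(1, c)], without its end near the origin. *)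
Definition strip (U T P : R * R) (c eps delta : R) : set (R * R) :=
  [set x | `|(sol U T (x - P)).2 - c * (sol U T (x - P)).1| <= eps /\
           8 * eps <= (sol U T (x - P)).1 <= delta].

(** Vectors representing the strip coordinates as dot products: with [q = sol U T x], [vec_s] gives
    [q.1] and [vec_r] gives the transversal coordinate [q.2 - c * q.1]. They are the ridge
    directions of the test functions. *)
Definition vec_s (U T : R * R) : R * R := (T.2 / det2 U T, - T.1 / det2 U T).
Definition vec_r (U T : R * R) (c : R) : R * R :=
  (- U.2 / det2 U T - c * (T.2 / det2 U T), U.1 / det2 U T + c * (T.1 / det2 U T)).

Lemma dot_vec_s U T (x : R * R) : dot (vec_s U T) x = (sol U T x).1.
Proof. by rewrite /dot /vec_s /sol /det2 /=; ring. Qed.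

Lemma dot_vec_r U T c (x : R * R) :
  dot (vec_r U T c) x = (sol U T x).2 - c * (sol U T x).1.
Proof. by rewrite /dot /vec_r /sol /det2 /=; ring. Qed.

Lemma compact_strip U T P (c eps delta : R) (M : R) : det2 U T != 0 ->
  `|U| <= M -> `|T| <= M -> `|c| <= 1 -> 0 < eps -> 0 < delta ->
  compact (strip U T P c eps delta).
Proof.
move=> D0 UM TM c1 e0 d0.
have M0 : 0 <= M by exact: le_trans UM.
have cf (p : R * R) : continuous (fun x : R * R => dot p (x - P)).
  move=> x; apply: (@continuous_comp _ _ _ (fun x : R * R => x - P) (dot p)).
    by apply: cvgB; [exact: cvg_id|exact: cvg_cst].
  exact: continuous_dot.
have -> : strip U T P c eps delta = strip U T P c eps delta `&` cbox P (2 * M * (delta + eps)).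
  apply/seteqP; split => [x Sx|x []] //; split => //.
  case: Sx => h1 /andP[h2 h3]; rewrite /cbox /= -(lin_sol (x - P) D0).
  apply: (le_trans (norm_lin_le _ UM TM)); rewrite ler_wpM2l ?mulr_ge0 //.
  rewrite norm_pair_le; apply/andP; split.
    by rewrite ger0_norm; lra.
  have -> : (sol U T (x - P)).2 = ((sol U T (x - P)).2 - c * (sol U T (x - P)).1)
     + c * (sol U T (x - P)).1 by ring.
  apply: (le_trans (ler_normD _ _)); rewrite addrC; apply: lerD => //.
  rewrite normrM (ger0_norm (_ : 0 <= (sol U T (x - P)).1)); last by lra.
  by apply: le_trans h3; rewrite ler_piMl //; lra.
rewrite setIC; apply: compact_closedI; first exact: compact_cball.
have -> : strip U T P c eps delta =
   (fun x => dot (vec_r U T c) (x - P)) @^-1` `[- eps, eps] `&`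
   (fun x => dot (vec_s U T) (x - P)) @^-1` `[8 * eps, delta].
  apply/seteqP; split => x; rewrite /strip /= !in_itv /= dot_vec_r dot_vec_s ler_norml.
    by move=> [-> ->].
  by move=> [-> ->].
by apply: closedI; apply: preimage_closed => //; exact: itv_closed.
Qed.

(** Covering in place of a change of variables: at most [2 * delta / eps] squares of half-width
    [4 * M * eps], centred at equal steps on the ray, contain the strip. *)
Lemma mu2_strip U T P (c eps delta : R) (M : R) : det2 U T != 0 ->
  `|U| <= M -> `|T| <= M -> `|c| <= 1 -> 0 < eps -> eps <= delta ->
  (mu2 (strip U T P c eps delta) <= (128 * M ^+ 2 * delta * eps)%:E)%E.
Proof.
move=> D0 UM TM c1 e0 ed.
have M0 : 0 <= M by exact: le_trans UM.
have d0 : 0 < delta by exact: lt_le_trans ed.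
pose N := (Num.truncn (delta / eps)).+1.
pose ctr (i : nat) : R * R := P + lin U T (i%:R * eps, c * (i%:R * eps)).
pose C (i : nat) := cbox (ctr i) (4 * M * eps) : set plane.
have mC i : measurable (C i) by exact: measurable_cbox.
have mS : measurable (strip U T P c eps delta : set plane).
  by apply: compact_measurable2; exact: (compact_strip D0 UM TM).
apply: (@le_trans _ _ (\sum_(i < N) mu2 (C i))%E).
  apply: content_subadditive => // x [h1 /andP[h2 h3]].
  have s0 : 0 <= (sol U T (x - P)).1 / eps by rewrite divr_ge0 ?(ltW e0) //; lra.
  pose i := Num.truncn ((sol U T (x - P)).1 / eps).
  have /andP[i1 i2] := truncn_itv s0.
  rewrite ler_pdivlMr // in i1; rewrite ltr_pdivrMr // -natr1 mulrDl mul1r in i2.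
  have iN : (i < N)%N.
    rewrite /N ltnS /i; apply: le_truncn; rewrite ler_pM2r ?invr_gt0 //.
  rewrite -bigcup_mkord; exists i => //=.
  rewrite /C /cbox /=.
  have -> : x - ctr i = lin U T (sol U T (x - P) - (i%:R * eps, c * (i%:R * eps))).
    rewrite /ctr opprD addrA -{1}(lin_sol (x - P) D0) !linE.
    by congr pair => /=; ring.
  apply: (le_trans (norm_lin_le _ UM TM)).
  have -> : 4 * M * eps = 2 * M * (2 * eps) by ring.
  rewrite ler_wpM2l ?mulr_ge0 //.
  have n1 : `|(sol U T (x - P)).1 - i%:R * eps| <= eps.
    by rewrite ler_norml; apply/andP; split; rewrite /i; lra.
  rewrite norm_pair_le /=; apply/andP; split; first by lra.
  have -> : (sol U T (x - P)).2 - c * (i%:R * eps) =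
     ((sol U T (x - P)).2 - c * (sol U T (x - P)).1) + c * ((sol U T (x - P)).1 - i%:R * eps).
    by ring.
  apply: (le_trans (ler_normD _ _)); rewrite normrM.
  have : `|c| * `|(sol U T (x - P)).1 - i%:R * eps| <= 1 * eps by exact: ler_pM.
  lra.
have E (i : 'I_N) : true -> mu2 (C i) = ((2 * (4 * M * eps)) ^+ 2)%:E.
  by move=> _; rewrite mu2_cbox // !mulr_ge0 // ltW.
rewrite (eq_bigr _ E) sumEFin lee_fin sumr_const card_ord -[_ *+ N]mulr_natl.
have NN : N%:R * eps <= 2 * delta.
  have : 0 <= delta / eps by rewrite divr_ge0 // ltW.
  move=> /truncn_itv/andP[+ _]; rewrite ler_pdivlMr // /N -natr1 mulrDl mul1r.
  lra.
have -> : N%:R * (2 * (4 * M * eps)) ^+ 2 = 64 * M ^+ 2 * eps * (N%:R * eps) by ring.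
have -> : 128 * M ^+ 2 * delta * eps = 64 * M ^+ 2 * eps * (2 * delta) by ring.
by rewrite ler_wpM2l // !mulr_ge0 // ?sqr_ge0 // ltW.
Qed.

(** In strip coordinates, [test_a] is a bump across the strip, [test_up] rises for [q.1] between
    [8 eps] and [9 eps], and [test_down] falls between [delta / 2] and [delta]. [test_chi1] and
    [test_chi2] carry the derivative of the rising and of the falling profile. All arguments are
    affine in a dot product, and the leading [1 *] is the coefficient of [TensorSmooth]. *)
Definition test_a (U T P : R * R) (c eps t : R) : R :=
  smooth_bump (eps^-1 * t + - dot (vec_r U T c) P / eps).
Definition test_up (U T P : R * R) (eps t : R) : R :=
  step (eps^-1 * t + (- dot (vec_s U T) P / eps - 8)).
Definition test_down (U T P : R * R) (delta t : R) : R :=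
  step (- 2 / delta * t + (2 + 2 * dot (vec_s U T) P / delta)).
Definition test_b1 (U T P : R * R) (eps delta t : R) : R :=
  (eps^-1 * derive1 step (eps^-1 * t + (- dot (vec_s U T) P / eps - 8))) *
  test_down U T P delta t.
Definition test_b2 (U T P : R * R) (eps delta t : R) : R :=
  test_up U T P eps t *
  ((- 2 / delta) * derive1 step (- 2 / delta * t + (2 + 2 * dot (vec_s U T) P / delta))).
Definition test_psi (U T P : R * R) (c eps delta : R) (x : R * R) : R :=
  1 * (test_a U T P c eps (dot (vec_r U T c) x) *
    (test_up U T P eps (dot (vec_s U T) x) * test_down U T P delta (dot (vec_s U T) x))).
Definition test_chi1 (U T P : R * R) (c eps delta : R) (x : R * R) : R :=
  1 * (test_a U T P c eps (dot (vec_r U T c) x) * test_b1 U T P eps delta (dot (vec_s U T) x)).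
Definition test_chi2 (U T P : R * R) (c eps delta : R) (x : R * R) : R :=
  1 * (test_a U T P c eps (dot (vec_r U T c) x) * test_b2 U T P eps delta (dot (vec_s U T) x)).

Section Fixed.
Variables (U T P : R * R) (c eps delta : R).
Hypotheses (D0 : det2 U T != 0) (e0 : 0 < eps) (ed : 18 * eps <= delta).
Let d0 : 0 < delta. Proof. by have := e0; have := ed; lra. Qed.

Lemma smooth1_test_a : smooth1 (test_a U T P c eps).
Proof. by apply: smooth1_affine; exact: smooth1_bump. Qed.

Lemma smooth1_test_up : smooth1 (test_up U T P eps).
Proof. by apply: smooth1_affine; exact: smooth1_step. Qed.

Lemma smooth1_test_down : smooth1 (test_down U T P delta).
Proof. by apply: smooth1_affine; exact: smooth1_step. Qed.

Lemma smooth1_test_b1 : smooth1 (test_b1 U T P eps delta).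
Proof.
apply: smooth1M; last exact: smooth1_test_down.
apply: smooth1M; first exact: smooth1_cst.
by apply: smooth1_affine; apply: smooth1_derive1; exact: smooth1_step.
Qed.

Lemma smooth1_test_b2 : smooth1 (test_b2 U T P eps delta).
Proof.
apply: smooth1M; first exact: smooth1_test_up.
apply: smooth1M; first exact: smooth1_cst.
by apply: smooth1_affine; apply: smooth1_derive1; exact: smooth1_step.
Qed.

Lemma tensor_test_psi : tensor_smooth (test_psi U T P c eps delta).
Proof.
apply: (@TensorSmooth _ 1 _ (fun t => test_up U T P eps t * test_down U T P delta t)).
  exact: smooth1_test_a.
by apply: smooth1M; [exact: smooth1_test_up|exact: smooth1_test_down].
Qed.

Lemma tensor_test_chi1 : tensor_smooth (test_chi1 U T P c eps delta).
Proof. by apply: TensorSmooth; [exact: smooth1_test_a|exact: smooth1_test_b1]. Qed.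

Lemma tensor_test_chi2 : tensor_smooth (test_chi2 U T P c eps delta).
Proof. by apply: TensorSmooth; [exact: smooth1_test_a|exact: smooth1_test_b2]. Qed.

Lemma arg_a x : eps^-1 * dot (vec_r U T c) x + - dot (vec_r U T c) P / eps =
  ((sol U T (x - P)).2 - c * (sol U T (x - P)).1) / eps.
Proof. by rewrite -dot_vec_r /dot /=; ring. Qed.

Lemma arg_up x : eps^-1 * dot (vec_s U T) x + (- dot (vec_s U T) P / eps - 8) =
  (sol U T (x - P)).1 / eps - 8.
Proof. by rewrite -dot_vec_s /dot /=; ring. Qed.

Lemma arg_down x : - 2 / delta * dot (vec_s U T) x + (2 + 2 * dot (vec_s U T) P / delta) =
  2 - 2 * (sol U T (x - P)).1 / delta.
Proof. by rewrite -dot_vec_s /dot /=; ring. Qed.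

Lemma strip_a x : eps < `|(sol U T (x - P)).2 - c * (sol U T (x - P)).1| ->
  test_a U T P c eps (dot (vec_r U T c) x) = 0.
Proof.
move=> h; rewrite /test_a arg_a smooth_bump_eq0 // normrM normfV (gtr0_norm e0).
by rewrite ler_pdivlMr // mul1r ltW.
Qed.

Lemma strip_up x : (sol U T (x - P)).1 <= 8 * eps ->
  test_up U T P eps (dot (vec_s U T) x) = 0 /\
  derive1 step (eps^-1 * dot (vec_s U T) x + (- dot (vec_s U T) P / eps - 8)) = 0.
Proof.
rewrite /test_up arg_up => h.
have h' : (sol U T (x - P)).1 / eps - 8 <= 0 by rewrite subr_le0 ler_pdivrMr.
by rewrite step_eq0 // step_derive_eq0 //; left.
Qed.

Lemma strip_down x : delta <= (sol U T (x - P)).1 ->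
  test_down U T P delta (dot (vec_s U T) x) = 0 /\
  derive1 step (- 2 / delta * dot (vec_s U T) x + (2 + 2 * dot (vec_s U T) P / delta)) = 0.
Proof.
rewrite /test_down arg_down => h.
have h' : 2 - 2 * (sol U T (x - P)).1 / delta <= 0.
  by rewrite subr_le0 ler_pdivlMr // ler_pM2l.
by rewrite step_eq0 // step_derive_eq0 //; left.
Qed.

Lemma strip_support x : ~ strip U T P c eps delta x ->
  [/\ test_psi U T P c eps delta x = 0, test_chi1 U T P c eps delta x = 0 &
      test_chi2 U T P c eps delta x = 0].
Proof.
move=> nS; rewrite /test_psi /test_chi1 /test_chi2 /test_b1 /test_b2.
have [h|h] := ltP eps `|(sol U T (x - P)).2 - c * (sol U T (x - P)).1|.
  by rewrite (strip_a h) !mul0r !mulr0.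
have [h1|h1] := leP (sol U T (x - P)).1 (8 * eps).
  by have [-> ->] := strip_up h1; rewrite !(mul0r,mulr0).
have [h2|h2] := leP delta (sol U T (x - P)).1.
  by have [-> ->] := strip_down h2; rewrite !(mul0r,mulr0).
by exfalso; apply: nS; split=> //; rewrite !ltW.
Qed.

(** Along the ray direction [lin U T (1, c)] the transversal coordinate is constant and [q.1] has
    slope one, so the bump across the strip is not differentiated. A derivative falling on it would
    be of order [1 / eps] over the full length of the strip. *)
Lemma test_derive x :
  (lin U T (1, c)).1 * pd1 (test_psi U T P c eps delta) x +
  (lin U T (1, c)).2 * pd2 (test_psi U T P c eps delta) x =
  test_chi1 U T P c eps delta x + test_chi2 U T P c eps delta x.
Proof.
have aux (s1 s2 t1 t2 k1 k2 : R) : s1 * (t2 * k2) + s2 * (t1 * k1) = k1 * t1 * s2 + s1 * (k2 * t2).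
  by ring.
pose b t := test_up U T P eps t * test_down U T P delta t.
have sb : smooth1 b by apply: smooth1M; [exact: smooth1_test_up|exact: smooth1_test_down].
have db t : derive1 b t = test_b1 U T P eps delta t + test_b2 U T P eps delta t.
  have d1 := is_derive_affine (smooth1_is_derive smooth1_step (eps^-1 * t + (- dot (vec_s U T) P / eps - 8))).
  have d2 := is_derive_affine (smooth1_is_derive smooth1_step (- 2 / delta * t + (2 + 2 * dot (vec_s U T) P / delta))).
  have d3 := @is_deriveM _ _ _ _ t 1 _ _ d1 d2.
  rewrite derive1E (@derive_val _ _ _ _ _ _ _ d3) /GRing.scale /= /test_b1 /test_b2.
  exact: aux.
have E (d : R * R) := is_derive_tensor 1 (vec_r U T c) (vec_s U T) x d smooth1_test_a sb.
have -> : pd1 (test_psi U T P c eps delta) x = _ := @derive_val _ _ _ _ _ _ _ (E (1, 0)).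
have -> : pd2 (test_psi U T P c eps delta) x = _ := @derive_val _ _ _ _ _ _ _ (E (0, 1)).
rewrite db /test_chi1 /test_chi2 -/(b _).
set a' := derive1 _ _; set a := test_a _ _ _ _ _ _; set b1 := test_b1 _ _ _ _ _ _.
set b2 := test_b2 _ _ _ _ _ _; set bb := b _.
have -> : (lin U T (1, c)).1 * (1 * dot (vec_r U T c) (1, 0) * (a' * bb) +
    1 * dot (vec_s U T) (1, 0) * (a * (b1 + b2))) +
  (lin U T (1, c)).2 * (1 * dot (vec_r U T c) (0, 1) * (a' * bb) +
    1 * dot (vec_s U T) (0, 1) * (a * (b1 + b2))) =
  dot (vec_r U T c) (lin U T (1, c)) * (a' * bb) +
  dot (vec_s U T) (lin U T (1, c)) * (a * (b1 + b2)).
  by rewrite /dot /=; ring.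
rewrite dot_vec_r dot_vec_s sol_lin //=.
by ring.
Qed.

Lemma test_chi1_ge0 x : 0 <= test_chi1 U T P c eps delta x.
Proof.
rewrite /test_chi1 mul1r mulr_ge0 ?smooth_bump_ge0 // mulr_ge0 ?step_ge0 // mulr_ge0 ?step_derive_ge0 //.
by rewrite invr_ge0 ltW.
Qed.

(** The rise is over at [q.1 = 9 eps], and [q.2] differs from [c * q.1] by at most [eps]; this gives
    the 10. *)
Lemma test_chi1_support x : `|c| <= 1 -> test_chi1 U T P c eps delta x != 0 ->
  strip U T P c eps delta x /\ `|sol U T (x - P)| <= 10 * eps.
Proof.
have E0 := e0; have E1 := ed; move=> c1 h.
have [h1|h1] := ltP eps `|(sol U T (x - P)).2 - c * (sol U T (x - P)).1|.
  by move: h; rewrite /test_chi1 (strip_a h1) mul0r mulr0 eqxx.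
have [h2|h2] := leP (sol U T (x - P)).1 (8 * eps).
  by move: h; rewrite /test_chi1 /test_b1; have [_ ->] := strip_up h2; rewrite !(mul0r,mulr0) eqxx.
have [h3|h3] := leP (9 * eps) (sol U T (x - P)).1.
  move: h; rewrite /test_chi1 /test_b1 arg_up step_derive_eq0 ?(mul0r,mulr0) ?eqxx //.
  right; rewrite lerBrDl ler_pdivlMr //; lra.
split; first by split=> //; apply/andP; split; lra.
rewrite norm_pair_le; apply/andP; split.
  by rewrite ger0_norm; lra.
have -> : (sol U T (x - P)).2 = ((sol U T (x - P)).2 - c * (sol U T (x - P)).1)
   + c * (sol U T (x - P)).1 by ring.
apply: (le_trans (ler_normD _ _)).
rewrite normrM (ger0_norm (_ : 0 <= (sol U T (x - P)).1)); last by lra.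
have : `|c| * (sol U T (x - P)).1 <= 1 * (sol U T (x - P)).1 by rewrite ler_wpM2r //; lra.
lra.
Qed.

Lemma test_psi_bound x : `|test_psi U T P c eps delta x| <= 1.
Proof.
rewrite /test_psi mul1r ger0_norm; last first.
  exact: (mulr_ge0 (smooth_bump_ge0 _) (mulr_ge0 (step_ge0 _) (step_ge0 _))).
exact: (mulr_ile1 (smooth_bump_ge0 _) (mulr_ge0 (step_ge0 _) (step_ge0 _)) (smooth_bump_le1 _)
  (mulr_ile1 (step_ge0 _) (step_ge0 _) (step_le1 _) (step_le1 _))).
Qed.

(** The fall takes place over the length [delta / 2], so the bound does not deteriorate as [eps]
    tends to 0. *)
Lemma test_chi2_bound x (C : R) : (forall t : R, derive1 step t <= C) ->
  `|test_chi2 U T P c eps delta x| <= 2 / delta * C.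
Proof.
have dn : 0 <= 2 / delta by rewrite divr_ge0 // ltW.
move=> HC; rewrite /test_chi2 /test_b2.
set y := derive1 _ _; set a := test_a _ _ _ _ _ _; set b := test_up _ _ _ _ _.
have -> : 1 * (a * (b * (- 2 / delta * y))) = - (a * b * (2 / delta * y)) by ring.
have ab0 : 0 <= a * b by exact: (mulr_ge0 (smooth_bump_ge0 _) (step_ge0 _)).
have ab1 : a * b <= 1.
  exact: (mulr_ile1 (smooth_bump_ge0 _) (step_ge0 _) (smooth_bump_le1 _) (step_le1 _)).
have y0 : 0 <= y by exact: step_derive_ge0.
rewrite normrN ger0_norm; last exact: (mulr_ge0 ab0 (mulr_ge0 dn y0)).
rewrite -[leRHS]mul1r; apply: ler_pM => //; first exact: mulr_ge0.
exact: (ler_wpM2l dn (HC _)).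
Qed.

(** On a square of size proportional to [eps], placed in the middle of the rise at [q.1 = 17/2 eps],
    both profiles are bounded below; the area of order [eps^2] and the slope of order [1 / eps]
    leave a mass of order [eps]. *)
Lemma test_mass (M c0 m1 m2 : R) : 0 < c0 -> c0 <= `|det2 U T| -> 0 < M ->
  `|U| <= M -> `|T| <= M -> `|c| <= 1 -> 0 < m1 -> 0 < m2 ->
  (forall t : R, `|t| <= 1/2 -> m1 <= smooth_bump t) ->
  (forall t : R, 1/4 <= t <= 3/4 -> m2 <= derive1 step t) ->
  4 * m1 * m2 * (c0 / (16 * M)) ^+ 2 * eps <=
    \int[mu2]_(x in strip U T P c eps delta) test_chi1 U T P c eps delta x.
Proof.
have E0 := e0; have E1 := ed; move=> c00 cD M0 UM TM c1 m10 m20 Hm1 Hm2.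
have cK : compact (strip U T P c eps delta) by exact: (compact_strip D0 UM TM).
have mK := compact_measurable2 cK.
(* The bound [2 * M / c0] for [sol] turns the radius [r * eps] into [eps / 8] in strip
   coordinates. *)
pose r := c0 / (16 * M).
have r0 : 0 < r by rewrite divr_gt0 // mulr_gt0.
pose ctr : R * R := P + lin U T (17/2 * eps, c * (17/2 * eps)).
pose Q : set (R * R) := cbox ctr (r * eps).
have inQ x : Q x -> `|(sol U T (x - P)).1 - 17/2 * eps| <= eps / 8 /\
   `|(sol U T (x - P)).2 - c * (sol U T (x - P)).1| <= eps / 4.
  move=> Qx; have hx : `|x - ctr| <= r * eps by exact: Qx.
  have E : sol U T (x - P) = sol U T (x - ctr) + (17/2 * eps, c * (17/2 * eps)).
    rewrite -[X in _ = _ + X](sol_lin _ D0) -solD; congr (sol U T _).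
    by rewrite /ctr opprD [x + (_ - _)]addrA subrK.
  have : `|sol U T (x - ctr)| <= eps / 8.
    apply: (le_trans (norm_sol_le _ c00 cD UM TM)).
    apply: (le_trans (ler_wpM2l _ hx)); first by rewrite divr_ge0 ?mulr_ge0 // ltW.
    rewrite le_eqVlt; apply/orP; left; apply/eqP; rewrite /r.
    by field; rewrite !gt_eqF.
  move: (sol U T (x - P)) (sol U T (x - ctr)) E => _ q' ->.
  rewrite norm_pair_le /= => /andP[h1 h2]; split; first by rewrite addrK.
  have -> : q'.2 + c * (17 / 2 * eps) - c * (q'.1 + 17 / 2 * eps) = q'.2 - c * q'.1 by ring.
  apply: (le_trans (ler_normB _ _)); rewrite normrM.
  have : `|c| * `|q'.1| <= 1 * (eps / 8) by exact: ler_pM.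
  lra.
have QK : Q `<=` strip U T P c eps delta.
  move=> x /inQ[]; rewrite ler_norml => /andP[h1 h2] h3; split; first by lra.
  by apply/andP; split; lra.
have lowQ x : Q x -> m1 * m2 / eps <= test_chi1 U T P c eps delta x.
  move=> /inQ[]; rewrite ler_norml => /andP[h1 h2] h3.
  rewrite /test_chi1 mul1r /test_a arg_a /test_b1 /test_down arg_down arg_up.
  (* On [Q] the falling profile is still 1, because [q.1 < 9 eps <= delta / 2]. *)
  rewrite step_eq1; last first.
    rewrite lerBrDl -lerBrDr ler_pdivrMr //; lra.
  rewrite mulr1 -mulrA [m2 / eps]mulrC; apply: ler_pM.
  - exact: ltW.
  - by rewrite mulr_ge0 ?invr_ge0 // ltW.
  - by apply: Hm1; rewrite normrM normfV (gtr0_norm e0) ler_pdivrMr //; lra.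
  - rewrite ler_wpM2l ?invr_ge0 ?(ltW e0) //; apply: Hm2.
    rewrite lerBrDl ler_pdivlMr // lerBlDl ler_pdivrMr //.
    by apply/andP; split; lra.
have mQ : measurable (Q : set plane) by exact: measurable_cbox.
have i1 : mu2.-integrable (strip U T P c eps delta : set plane) (EFin \o test_chi1 U T P c eps delta).
  apply: integrable_continuous_compact => //; apply: tensor_smooth_continuous.
  exact: tensor_test_chi1.
have muQ : mu2 Q = ((2 * (r * eps)) ^+ 2)%:E by rewrite mu2_cbox // mulr_ge0 // ltW.
rewrite -lee_fin /Rintegral fineK; last exact: integrable_fin_num.
apply: (@le_trans _ _ (\int[mu2]_(x in Q) (test_chi1 U T P c eps delta x)%:E)%E); last first.
  apply: ge0_subset_integral => //; first exact: measurable_int i1.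
  by move=> x _; rewrite lee_fin; exact: test_chi1_ge0.
apply: (@le_trans _ _ (\int[mu2]_(x in Q) (m1 * m2 / eps)%:E)%E).
  rewrite integral_cst // muQ -EFinM lee_fin le_eqVlt; apply/orP; left; apply/eqP.
  by rewrite -/r; field; rewrite gt_eqF.
apply: ge0_le_integral => //.
- by move=> x _; rewrite lee_fin divr_ge0 // ?mulr_ge0 // ltW.
- apply/measurable_EFinP; apply: measurable_funTS; apply: continuous_measurable2.
  by apply: tensor_smooth_continuous; exact: tensor_test_chi1.
Qed.

End Fixed.
End BoxTest.

(** * Sums of integrals over adjacent intervals and over disjoint sets *)

Section StepBound.
Context {R : realType}.
Local Notation mu := (@lebesgue_measure R).

Lemma integral_itv_sum (u : R -> R) (a h : R) (n : nat) (B : nat -> R) : 0 <= h ->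
  measurable_fun `[a, a + n%:R * h] u -> (forall v, 0 <= u v) ->
  (forall i, (i < n)%N ->
    (\int[mu]_(v in `[(a + i%:R * h)%R, (a + i.+1%:R * h)%R]) (u v)%:E <= (B i)%:E)%E) ->
  (\int[mu]_(v in `[a, (a + n%:R * h)%R]) (u v)%:E <= (\sum_(i < n) B i)%:E)%E.
Proof.
move=> h0; elim: n => [|n IH] mu_ u0 HB.
  by rewrite mul0r addr0 set_itv1 integral_set1 big_ord0.
have nn : a + n%:R * h <= a + n.+1%:R * h by rewrite lerD2l ler_wpM2r // ler_nat.
have an : a <= a + n%:R * h by rewrite lerDl mulr_ge0.
have U : `[a, a + n.+1%:R * h]%classic =
   `[a, a + n%:R * h]%classic `|` `]a + n%:R * h, a + n.+1%:R * h]%classic.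
  by rewrite -itv_bndbnd_setU // bnd_simp.
have m1 : measurable_fun `[a, a + n%:R * h] u.
  by apply: (measurable_funS _ _ mu_) => //; rewrite U; exact: subsetUl.
have m2 : measurable_fun `]a + n%:R * h, a + n.+1%:R * h] u.
  by apply: (measurable_funS _ _ mu_) => //; rewrite U; exact: subsetUr.
rewrite U ge0_integral_setU //; first last.
- apply/disj_set2P; rewrite -subset0 => x [] /=; rewrite !in_itv /= => /andP[_ h1] /andP[h2 _].
  by move: (lt_le_trans h2 h1); rewrite ltxx.
- by move=> x _; rewrite lee_fin.
- by rewrite -U; apply/measurable_EFinP.
rewrite big_ord_recr /= EFinD; apply: leeD.
  by apply: IH => // i ni; apply: HB; exact: ltnW.
apply: le_trans (HB n (ltnSn n)).
rewrite integral_itv_obnd_cbnd //.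
exact/measurable_EFinP.
Qed.

Lemma integral_itv_le (u : R -> R) (a b B : R) : a <= b ->
  measurable_fun `[a, b] u -> (forall v, 0 <= u v) -> 0 <= B ->
  (forall v, a <= v <= b -> u v <= B) ->
  (\int[mu]_(v in `[a, b]) (u v)%:E <= (B * (b - a))%:E)%E.
Proof.
move=> ab mu_ u0 B0 HB.
apply: (@le_trans _ _ (\int[mu]_(v in `[a, b]) B%:E)%E).
  apply: ge0_le_integral => //.
  - by move=> x _; rewrite lee_fin.
  - exact/measurable_EFinP.
rewrite integral_cst //= lebesgue_measure_itv /= lte_fin.
case: ltP => [h|h]; first by rewrite -EFinD -EFinM.
by rewrite mule0 lee_fin mulr_ge0 // subr_ge0.
Qed.

Lemma disjoint_sum_le (d : measure_display) (X : measurableType d)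
    (m : {measure set X -> \bar R}) (D : set X) (K : nat -> set X) (J : nat) (u : X -> R) :
  measurable D -> (forall i, measurable (K i)) -> (forall i, (i < J)%N -> K i `<=` D) ->
  (forall i j, (i < J)%N -> (j < J)%N -> i != j -> K i `&` K j = set0) ->
  measurable_fun D u -> (forall x, 0 <= u x) ->
  (\sum_(k < J) \int[m]_(x in K k) (u x)%:E <= \int[m]_(x in D) (u x)%:E)%E.
Proof.
move=> mD mK KD dis mu_ u0.
rewrite -(big_mkord xpredT (fun k => \int[m]_(x in K k) (u x)%:E)%E) /index_iota subn0.
have sub : \big[setU/set0]_(i <- iota 0 J) K i `<=` D.
  move=> x; rewrite -bigcup_seq => -[i /=]; rewrite mem_iota add0n => /andP[_ iJ] Kx.
  exact: (KD i iJ).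
rewrite -ge0_integral_bigsetU //.
- apply: ge0_subset_integral => //; first exact: bigsetU_measurable.
  + exact/measurable_EFinP.
  + by move=> x _; rewrite lee_fin.
- exact: iota_uniq.
- apply/trivIsetP => i j /=; rewrite !mem_iota !add0n => /andP[_ iJ] /andP[_ jJ].
  exact: dis.
- by apply/measurable_EFinP; exact: measurable_funS mu_.
- by move=> x _; rewrite lee_fin.
Qed.

End StepBound.

(** * The trace inequality on one patch *)

Section Trace.
Context {R : realType}.
Local Notation plane := (measurableTypeR R * measurableTypeR R)%type.
Local Notation mu := (@lebesgue_measure R).
Variables (f fu fv g gu gv : R * R -> R) (c0 : R).
Hypothesis Cf : C1_with f fu fv.
Hypothesis Cg : C1_with g gu gv.
Let F (z : R * R) : R * R := (f z, g z).
Let U (z : R * R) : R * R := (fu z, gu z).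
Let T (z : R * R) : R * R := (fv z, gv z).
Hypothesis inj : set_inj square F.
Hypothesis c00 : 0 < c0.
Hypothesis detF : forall z, square z -> c0 <= `|det2 (U z) (T z)|.
Let O : set (R * R) := F @` osquare.
Hypothesis oO : open O.

Let det_neq0 z : square z -> det2 (U z) (T z) != 0.
Proof. by move=> /detF h; rewrite -normr_gt0 (lt_le_trans _ h) // c00. Qed.

Lemma jacobian_bound : exists2 M : R, 0 < M &
  forall z, square z -> `|U z| <= M /\ `|T z| <= M.
Proof.
have [_ cfu cfv _] := Cf; have [_ cgu cgv _] := Cg.
have [M1 M10 H1] := within_bounded compact_square cfu.
have [M2 M20 H2] := within_bounded compact_square cfv.
have [M3 M30 H3] := within_bounded compact_square cgu.
have [M4 M40 H4] := within_bounded compact_square cgv.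
exists (M1 + M2 + M3 + M4); first by rewrite !addr_gt0.
move=> z sz; have := H1 z sz; have := H2 z sz; have := H3 z sz; have := H4 z sz.
move=> h4 h3 h2 h1; rewrite !norm_pair_le /=; split; apply/andP; split; lra.
Qed.

(* The derivative in the direction [d] of [p] transported by [(f, g)^-1],
   extended by continuity to the closed square. *)
Definition grad_hat (pu pv : R * R -> R) (d z : R * R) : R :=
  dot (pu z, pv z) (sol (U z) (T z) d).

Lemma grad_hat_continuous p pu pv d : C1_with p pu pv ->
  {within square, continuous (grad_hat pu pv d)}.
Proof.
move=> [_ cpu cpv _]; have [_ cfu cfv _] := Cf; have [_ cgu cgv _] := Cg.
apply/subspace_continuousP => z sz.
have C (k : R * R -> R) : {within square, continuous k} -> k @ within square (nbhs z) --> k z.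
  by move=> /subspace_continuousP; exact.
have cst (a : R) : (fun=> a) @ within square (nbhs z) --> a by exact: cvg_cst.
have det x y : @det2 R x y = x.1 * y.2 - x.2 * y.1 by [].
rewrite /grad_hat /sol /dot /det2 /=.
apply: cvgD; apply: cvgM; try exact: C; apply: cvgM.
- by apply: cvgB; apply: cvgM; (try exact: cst); exact: C.
- apply: cvgV; first by have := det_neq0 sz.
  by apply: cvgB; apply: cvgM; exact: C.
- by apply: cvgB; apply: cvgM; (try exact: cst); exact: C.
- apply: cvgV; first by have := det_neq0 sz.
  by apply: cvgB; apply: cvgM; exact: C.
Qed.

Lemma derive_pullback p pu pv phi d z : C1_with p pu pv ->
  (forall w, osquare w -> phi (F w) = p w) -> osquare z ->
  is_derive (F z) d phi (grad_hat pu pv d z).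
Proof.
move=> Cp Hphi oz; apply: (is_derive_comp_inverse d Cf Cg Cp oz) => //.
exact: det_neq0 (osquare_square oz).
Qed.

Lemma pullback_continuous (phi p : R * R -> R) x : {within square, continuous p} ->
  (forall w, osquare w -> phi (F w) = p w) -> O x -> {for x, continuous phi}.
Proof.
move=> cp Hphi Ox; case: (Ox) => z oz Fz; have sz := osquare_square oz.
have [cf _ _ _] := Cf; have [cg _ _ _] := Cg.
apply/(@cvgrPdist_lt _ _ _ (nbhs x)) => e e0.
have [d d0 Hd] := within_dist cp sz e0.
have [r r0 Hr] := inverse_continuous cf cg inj sz d0.
have : \forall y \near x, O y /\ ball x r y.
  near=> y; split; near: y; first exact: open_nbhs_nbhs.
  exact: nbhsx_ballx.
apply: filterS => y [[w ow <-]]; rewrite -ball_normE /= -Fz !Hphi // => h.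
rewrite distrC; apply: Hd; first exact: osquare_square.
by apply: Hr; [exact: osquare_square|rewrite distrC].
Unshelve. all: end_near. Qed.

(** Uniform continuity of the Jacobian makes [eta] independent of the base point. The distortion
    1/64 leaves room for the strips to stay inside the patch and to stay apart; [eta <= 1/2] keeps
    them away from the opposite end of the interface. *)
Lemma uniform_chart : exists2 eta : R, 0 < eta <= 1/2 &
  forall z0, square z0 -> near_id (1/64) (fun z => sol (U z0) (T z0) (F z))
    [set z | square z /\ `|z - z0| < eta].
Proof.
have [M M0 HM] := jacobian_bound.
have [_ cfu cfv _] := Cf; have [_ cgu cgv _] := Cg.
pose k := c0 / (256 * M).
have p256 : 0 < 256 :> R by rewrite ltr0n.
have k0 : 0 < k by exact: (divr_gt0 c00 (mulr_gt0 p256 M0)).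
have [d1 d10 H1] := within_unif compact_square cfu k0.
have [d2 d20 H2] := within_unif compact_square cfv k0.
have [d3 d30 H3] := within_unif compact_square cgu k0.
have [d4 d40 H4] := within_unif compact_square cgv k0.
exists (Num.min (1/2) (Num.min (Num.min d1 d2) (Num.min d3 d4))).
  rewrite !lt_min d10 d20 d30 d40 ge_min lexx /= !andbT; lra.
move=> z0 sz0; have [UM TM] := HM z0 sz0.
have -> : 1/64 = 4 * M / c0 * k.
  by rewrite /k; field; rewrite !gt_eqF.
apply: (near_id_C1 Cf Cg (ltW k0) c00 (detF sz0) UM TM) => z oz.
have sz := osquare_square oz.
rewrite !lt_min => /andP[_ /andP[/andP[n1 n2] /andP[n3 n4]]].
by split; apply: ltW; [exact: H1|exact: H2|exact: H3|exact: H4].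
Qed.

(* Directions [(1, c)] leading from [(0, v)] into the square. *)
Definition admissible_side (c v : R) : Prop :=
  (c = 1 /\ 0 <= v <= 1/2) \/ (c = -1 /\ 1/2 <= v <= 1).

(** [near_id_solve] locates the preimage within [q.1 / 16] of [(0, v) + q]. As the strip begins at
    [q.1 = 8 eps], its half-width is at most [q.1 / 8]; since the slope [c] points away from the
    nearer corner, these deviations cannot carry the preimage out of the open square. *)
Lemma strip_preimage eta v0 v c eps : 0 < eta <= 1/2 ->
  near_id (1/64) (fun z => sol (U (0, v0)) (T (0, v0)) (F z))
    [set z | square z /\ `|z - (0, v0)| < eta] ->
  square (0, v0) -> admissible_side c v -> `|v - v0| <= eta / 4 -> 0 < eps ->
  forall x, strip (U (0, v0)) (T (0, v0)) (F (0, v)) c eps (eta / 16) x ->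
  exists w, [/\ osquare w, F w = x &
    `|w - (0, v)| <= 2 * `|sol (U (0, v0)) (T (0, v0)) (x - F (0, v))|].
Proof.
have aux1 (q1 q2 w2 v' e h : R) : - e <= q2 - 1 * q1 -> q2 - 1 * q1 <= e -> 0 <= v' -> v' <= 1/2 ->
    v' + q2 - q1 / 16 <= w2 -> w2 <= v' + q2 + q1 / 16 -> 8 * e <= q1 -> q1 <= h / 16 ->
    0 < e -> h <= 1/2 -> 0 < w2 < 1.
  by move=> *; apply/andP; split; lra.
have aux2 (q1 q2 w2 v' e h : R) : - e <= q2 - -1 * q1 -> q2 - -1 * q1 <= e -> 1/2 <= v' -> v' <= 1 ->
    v' + q2 - q1 / 16 <= w2 -> w2 <= v' + q2 + q1 / 16 -> 8 * e <= q1 -> q1 <= h / 16 ->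
    0 < e -> h <= 1/2 -> 0 < w2 < 1.
  by move=> *; apply/andP; split; lra.
move=> /andP[eta0 eta12] NI sz0 side vv0 e0 x.
move Eq : (sol (U (0, v0)) (T (0, v0)) (x - F (0, v))) => q Sx.
have [h1 /andP[h2 h3]] : `|q.2 - c * q.1| <= eps /\ 8 * eps <= q.1 <= eta / 16.
  by rewrite -Eq; exact: Sx.
have D0 := det_neq0 sz0.
have v01 : 0 <= v <= 1 by case: side => -[_ /andP[? ?]]; apply/andP; split; lra.
have c1 : `|c| = 1 by case: side => -[-> _]; rewrite ?normrN normr1.
have s0 : 0 < q.1 by lra.
have q2 : `|q.2| <= 9/8 * q.1.
  have -> : q.2 = (q.2 - c * q.1) + c * q.1 by ring.
  apply: (le_trans (ler_normD _ _)); rewrite normrM c1 mul1r (gtr0_norm s0).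
  lra.
have nq : `|q| <= 9/8 * q.1.
  by rewrite norm_pair_le q2 andbT ger0_norm; lra.
have inb w : `|w - ((0, v) + q)| <= 2 * (1/64) * `|q| ->
    [/\ osquare w, `|w - (0, v0)| < eta & `|w - (0, v)| <= 2 * `|q|].
  move=> h; have hq : `|w - ((0, v) + q)| <= q.1 / 16 by lra.
  move: (hq); rewrite norm_pair_le /= !ler_distl => /andP[/andP[w1 w2] /andP[w3 w4]].
  have side2 : 0 < w.2 < 1.
    move: h1; rewrite ler_norml => /andP[r1 r2].
    case: side => -[cE /andP[v1 v2]]; rewrite cE in r1 r2.
      exact: (aux1 _ _ _ _ _ _ r1 r2 v1 v2 w3 w4 h2 h3 e0 eta12).
    exact: (aux2 _ _ _ _ _ _ r1 r2 v1 v2 w3 w4 h2 h3 e0 eta12).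
  have wz : `|w - (0, v)| <= q.1 / 16 + `|q|.
    have -> : w - (0, v) = w - ((0, v) + q) + q by rewrite opprD [w + (_ - _)]addrA subrK.
    by apply: (le_trans (ler_normD _ _)); rewrite lerD2r.
  have qge : q.1 <= `|q| by apply: le_trans (norm_fst_le q); exact: ler_norm.
  split.
  - by apply/osquareP; split=> //; apply/andP; split; lra.
  - have -> : w - (0, v0) = (w - (0, v)) + ((0, v) - (0, v0)) by rewrite addrA subrK.
    apply: (le_lt_trans (ler_normD _ _)).
    have -> : `|(0, v) - (0, v0) : R * R| = `|v - v0|.
      rewrite prod_normE /= subr0 normr0; apply/max_idPr; exact: normr_ge0.
    lra.
  - lra.
have [||w hw Gw] := @near_id_solve R (1/64) (fun z => sol (U (0, v0)) (T (0, v0)) (F z)) (0, v) q.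
- by apply/andP; split; lra.
- have sub w : ((0, v) |` [set w | `|w - ((0, v) + q)| <= 2 * (1/64) * `|q|]) w ->
     square w /\ `|w - (0, v0)| < eta.
    move=> [->|/inb[ow nw _]]; last by split=> //; exact: osquare_square.
    split; first by apply/squareP => /=; rewrite lexx ler01.
    by rewrite norm_pair_lt /= subr0 normr0 eta0 /=; lra.
  by move=> w1 w2 /sub s1 /sub s2; exact: NI.
have [ow _ nw] := inb w hw.
exists w; split=> //.
apply: (can_inj (fun y => lin_sol y D0)).
by rewrite Gw -Eq -solD addrCA subrr addr0.
Qed.

(** For a common point [x], the difference of its coordinates relative to the two origins is
    [(0, v' - v)] up to [|v' - v| / 64], while its transversal part is at most [2 eps]. Hence
    [|v' - v| <= |v' - v| / 32 + 2 eps], which contradicts [4 eps <= |v' - v|]. *)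
Lemma strip_disjoint eta v0 v v' c eps delta : 0 < eta ->
  near_id (1/64) (fun z => sol (U (0, v0)) (T (0, v0)) (F z))
    [set z | square z /\ `|z - (0, v0)| < eta] ->
  `|c| <= 1 -> 0 <= v <= 1 -> 0 <= v' <= 1 -> `|v - v0| < eta -> `|v' - v0| < eta ->
  0 < eps -> 4 * eps <= `|v' - v| ->
  forall x, strip (U (0, v0)) (T (0, v0)) (F (0, v)) c eps delta x ->
    ~ strip (U (0, v0)) (T (0, v0)) (F (0, v')) c eps delta x.
Proof.
move=> eta0 NI c1 v1 v1' n n' e0 far x [h _] [h' _].
have inK t : 0 <= t <= 1 -> `|t - v0| < eta ->
    [set z | square z /\ `|z - (0, v0)| < eta] (0, t).
  move=> t1 tn; split; first by apply/squareP => /=; rewrite lexx ler01.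
  by rewrite norm_pair_lt /= subr0 normr0 eta0.
have := NI _ _ (inK v v1 n) (inK v' v1' n').
set A := U (0, v0) in h h' *; set B := T (0, v0) in h h' *.
have E : sol A B (F (0, v')) - sol A B (F (0, v)) =
   sol A B (x - F (0, v)) - sol A B (x - F (0, v')).
  by rewrite -!solB opprB addrCA addrAC subrr add0r addrC.
rewrite E; move: (sol A B (x - F (0, v))) (sol A B (x - F (0, v'))) h h' => q q' h h'.
have -> : `|(0, v') - (0, v) : R * R| = `|v' - v|.
  by rewrite prod_normE /= subr0 normr0; apply/max_idPr; exact: normr_ge0.
rewrite norm_pair_le /= => /andP[k1 k2].
rewrite subr0 subr0 in k1.
have k3 : `|v' - v| <= `|q.2 - q'.2 - (v' - v)| + `|c| * `|q.1 - q'.1| + `|q.2 - c * q.1| + `|q'.2 - c * q'.1|.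
  have Ev : v' - v = - (q.2 - q'.2 - (v' - v)) + c * (q.1 - q'.1) + (q.2 - c * q.1) - (q'.2 - c * q'.1) by ring.
  rewrite [X in `|X| <= _]Ev; apply: (le_trans (ler_normB _ _)); rewrite lerD2r.
  apply: (le_trans (ler_normD _ _)); rewrite lerD2r.
  by apply: (le_trans (ler_normD _ _)); rewrite normrN normrM.
have k4 : `|c| * `|q.1 - q'.1| <= 1 * (1 / 64 * `|v' - v|) by exact: ler_pM.
lra.
Qed.

(* The strip has area of order [eps]; by Young's inequality the square of the
   value at its end is controlled by the integral over the strip alone. *)
Lemma point_estimate (eta : R) : 0 < eta <= 1/2 ->
  (forall z0, square z0 -> near_id (1/64) (fun z => sol (U z0) (T z0) (F z))
    [set z | square z /\ `|z - z0| < eta]) ->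
  exists2 C : R, 0 < C & forall v0 v c eps : R, square (0, v0) -> admissible_side c v ->
    `|v - v0| <= eta / 4 -> 0 < eps -> 18 * eps <= eta / 16 ->
  forall (p pu pv phi : R * R -> R) w (d : R * R) (om : R), C1_with p pu pv -> (forall z, osquare z -> phi (F z) = p z) ->
    (forall i j, (i + j <= 2)%N -> weak_derivative O i j phi (w i j)) ->
    d = (1, 0) \/ d = (0, 1) -> 0 <= om ->
    (forall z, square z -> `|z - (0, v)| <= 20 * eps ->
       `|grad_hat pu pv d z - grad_hat pu pv d (0, v)| <= om) ->
    ((eps * grad_hat pu pv d (0%R, v) ^+ 2)%:E <= (4 * om ^+ 2 * eps)%:E +
      C%:E * \int[mu2]_(x in strip (U (0%R, v0)) (T (0%R, v0)) (F (0%R, v)) c eps (eta / 16))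
        (weak_square w x)%:E)%E.
Proof.
have aux3 (x y z : R) : (x + y + z) ^+ 2 <= 3 * (x ^+ 2 + y ^+ 2 + z ^+ 2).
  have := sqr_ge0 (x - y); have := sqr_ge0 (x - z); have := sqr_ge0 (y - z).
  by rewrite !expr2; lra.
have sqle (x y z t u v : R) :
    z ^+ 2 + v ^+ 2 + u ^+ 2 <= x ^+ 2 + y ^+ 2 + t ^+ 2 + z ^+ 2 + u ^+ 2 + v ^+ 2 /\
    y ^+ 2 + u ^+ 2 + t ^+ 2 <= x ^+ 2 + y ^+ 2 + t ^+ 2 + z ^+ 2 + u ^+ 2 + v ^+ 2.
  have := sqr_ge0 x; have := sqr_ge0 y; have := sqr_ge0 z; have := sqr_ge0 t; have := sqr_ge0 v.
  by split; lra.
have aux5 (x e : R) : x <= 10 * e -> 2 * x <= 20 * e by move=> *; lra.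
have aux7 c v : admissible_side c v -> 0 <= v <= 1.
  by case=> -[_ /andP[? ?]]; apply/andP; split; lra.
have aux6 (e h : R) : 0 < e -> 18 * e <= h -> e <= h by move=> *; lra.
move=> eta1 NI; have [M M0 HM] := jacobian_bound.
have [Cs Cs0 HCs] := @step_derive_bounded R.
have [m1 m10 Hm1] := @smooth_bump_lower R; have [m2 m20 Hm2] := @step_derive_lower R.
have eta0 : 0 < eta by case/andP: eta1.
pose delta := eta / 16.
have delta0 : 0 < delta by rewrite divr_gt0.
pose B := 2 / delta * Cs + 2 * M.
have B0 : 0 < B by rewrite addr_gt0 // !mulr_gt0 // invr_gt0.
pose cm := 4 * m1 * m2 * (c0 / (16 * M)) ^+ 2.
have p4 : 0 < 4 :> R by rewrite ltr0n.
have p16 : 0 < 16 :> R by rewrite ltr0n.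
have cm0 : 0 < cm.
  apply: mulr_gt0; first exact: (mulr_gt0 (mulr_gt0 p4 m10) m20).
  by apply: exprn_gt0; exact: (divr_gt0 c00 (mulr_gt0 p16 M0)).
pose C1 := 128 * M ^+ 2 * delta.
have p128 : 0 < 128 :> R by rewrite ltr0n.
have C10 : 0 < C1 by exact: (mulr_gt0 (mulr_gt0 p128 (exprn_gt0 _ M0)) delta0).
(* The constant of [absorb], times the 3 from squaring the sum of three weak derivatives. *)
pose C := 2 * B ^+ 2 * C1 / cm ^+ 2 * 3.
have C0 : 0 < C.
  rewrite mulr_gt0 // divr_gt0 ?exprn_gt0 // mulr_gt0 // mulr_gt0 //.
  exact: exprn_gt0.
exists C => // v0 v c eps sz0 side vv0 e0 ed p pu pv phi w d om Cp Hphi Hw Hd om0 Hom.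
have D0 := det_neq0 sz0; have [UM TM] := HM _ sz0.
have c1 : `|c| <= 1 by case: side => -[-> _]; rewrite ?normrN normr1.
set A := U (0, v0) in D0 UM *; set A' := T (0, v0) in D0 TM *.
set P := F (0, v); set K := strip A A' P c eps delta.
have v01 : 0 <= v <= 1 by exact: aux7 side.
have sv : square (0, v) by apply/squareP => /=; rewrite lexx ler01.
have cK : compact K by exact: (compact_strip D0 UM TM).
have mK := compact_measurable2 cK.
have KO : K `<=` O.
  by move=> x /(strip_preimage eta1 (NI _ sz0) sz0 side vv0 e0)[z [oz <- _]]; exists z.
pose psi := test_psi A A' P c eps delta; pose chi1 := test_chi1 A A' P c eps delta.
pose chi2 := test_chi2 A A' P c eps delta; pose e := lin A A' (1, c).
have tp : tensor_smooth psi by exact: tensor_test_psi.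
have t1 : tensor_smooth chi1 by exact: tensor_test_chi1.
have t2 : tensor_smooth chi2 by exact: tensor_test_chi2.
have supp x : ~ K x -> [/\ psi x = 0, chi1 x = 0 & chi2 x = 0] by exact: strip_support.
have test2 : test_function O chi2.
  by split; [exact: tensor_smooth2|exists K; split=> // x /supp[]].
have testp : test_function O psi.
  by split; [exact: tensor_smooth2|exists K; split=> // x /supp[]].
have intw i j : (i + j <= 2)%N -> mu2.-integrable (K : set plane) (EFin \o w i j).
  by move=> /Hw[_ h _]; apply: h.
have [pc _ _ _] := Cp.
have cphi x : O x -> {for x, continuous phi} by exact: pullback_continuous.
pose gphi := 'D_d phi.
have dphi x : O x -> is_derive x d phi (gphi x).
  move=> [z oz <-]; have dz := derive_pullback d Cp Hphi oz.
  by rewrite /gphi (@derive_val _ _ _ _ _ _ _ dz).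
have gphiE z : osquare z -> gphi (F z) = grad_hat pu pv d z.
  by move=> oz; have dz := derive_pullback d Cp Hphi oz; exact: (@derive_val _ _ _ _ _ _ _ dz).
have cgphi x : O x -> {for x, continuous gphi}.
  have cgh := @grad_hat_continuous p pu pv d Cp.
  exact: (@pullback_continuous gphi (grad_hat pu pv d) x cgh gphiE).
(* These are the weak counterparts of the derivative of [phi] along [d] and of its two first partial
   derivatives; the minus sign in the first identity is that of an odd order. *)
have [wa [wb [wc [Ia Ib Ic [Ha Hb Hc] Hwabc]]]] : exists wa wb wc : R * R -> R,
  [/\ mu2.-integrable (K : set plane) (EFin \o wa), mu2.-integrable (K : set plane) (EFin \o wb),
      mu2.-integrable (K : set plane) (EFin \o wc),
   [/\ \int[mu2]_(x in O) (phi x * 'D_d chi2 x) = - (\int[mu2]_(x in O) (wa x * chi2 x)),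
    \int[mu2]_(x in O) (phi x * 'D_d (pd1 psi) x) = \int[mu2]_(x in O) (wb x * psi x) &
    \int[mu2]_(x in O) (phi x * 'D_d (pd2 psi) x) = \int[mu2]_(x in O) (wc x * psi x)] &
    forall x, wa x ^+ 2 + wb x ^+ 2 + wc x ^+ 2 <= weak_square w x].
  have W10 := Hw 1%N 0%N isT; have W01 := Hw 0%N 1%N isT; have W11 := Hw 1%N 1%N isT.
  have W20 := Hw 2%N 0%N isT; have W02 := Hw 0%N 2%N isT.
  case: Hd => ->.
    exists (w 1%N 0%N), (w 2%N 0%N), (w 1%N 1%N); split; try exact: intw.
      split.
      - by have [_ _ /(_ _ test2)] := W10; rewrite /= expr1 mulN1r.
      - by have [_ _ /(_ _ testp)] := W20; rewrite /= addn0 sqrrN expr1n mul1r.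
      - by have [_ _ /(_ _ testp)] := W11; rewrite /= sqrrN expr1n mul1r.
    by move=> x; rewrite weak_squareE; apply sqle.
  exists (w 0%N 1%N), (w 1%N 1%N), (w 0%N 2%N); split; try exact: intw.
    split.
    - by have [_ _ /(_ _ test2)] := W01; rewrite /= expr1 mulN1r.
    - have [_ _ /(_ _ testp)] := W11; rewrite /= sqrrN expr1n mul1r => <-.
      apply: eq_Rintegral => x _.
      exact: (congr1 ( *%R (phi x)) (@derive_comm R psi (0, 1) (1, 0) tp x)).
    - by have [_ _ /(_ _ testp)] := W02; rewrite /= sqrrN expr1n mul1r.
  by move=> x; rewrite weak_squareE; apply sqle.
(* The 10 of [test_chi1_support] doubles to 20 because [strip_preimage] loses a factor 2 in going
   back to the square. *)
have omchi x : chi1 x != 0 -> `|gphi x - grad_hat pu pv d (0, v)| <= om.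
  move=> /(test_chi1_support e0 ed c1)[Sx q10].
  have [z [oz Fz nz]] := strip_preimage eta1 (NI _ sz0) sz0 side vv0 e0 Sx.
  rewrite -Fz gphiE //; apply: Hom; first exact: osquare_square.
  by apply: (le_trans nz); rewrite -/A -/A' -/P; exact: aux5.
have ebound : `|e| <= 2 * M.
  apply: (le_trans (norm_lin_le _ UM TM)); rewrite ler_piMr ?mulr_ge0 ?(ltW M0) //.
  by rewrite norm_pair_le /= normr1 lexx c1.
have dC : 0 <= 2 / delta * Cs by rewrite mulr_ge0 ?(ltW Cs0) // divr_ge0 // ltW.
have bounds x : [/\ `|chi2 x| <= B, `|e.1 * psi x| <= B & `|e.2 * psi x| <= B].
  have pb : `|psi x| <= 1 by exact: test_psi_bound.
  have ep (k : R) : `|k| <= `|e| -> `|k * psi x| <= B.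
    move=> ke; rewrite normrM; apply: (@le_trans _ _ (`|e| * 1)).
      by apply: ler_pM.
    by rewrite mulr1 /B; apply: (le_trans ebound); rewrite lerDr.
  split; [|exact/ep/norm_fst_le|exact/ep/norm_snd_le].
  apply: (@le_trans _ _ (2 / delta * Cs)).
    exact: test_chi2_bound.
  by rewrite /B lerDl mulr_ge0 // ltW.
have chi10 x : 0 <= chi1 x by exact: test_chi1_ge0.
have Hde x : e.1 * pd1 psi x + e.2 * pd2 psi x = chi1 x + chi2 x by exact: test_derive.
have LB := local_bound Hd oO cK KO cphi cgphi dphi tp t1 t2 supp Hde
  Ha Hb Hc Ia Ib Ic chi10 omchi bounds.
pose W x := `|wa x| + `|wb x| + `|wc x|.
have iW : mu2.-integrable (K : set plane) (EFin \o W).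
  have i1 : mu2.-integrable (K : set plane) (EFin \o (fun x => `|wa x|)) by exact: integrable_abse Ia.
  have i2 : mu2.-integrable (K : set plane) (EFin \o (fun x => `|wb x|)) by exact: integrable_abse Ib.
  have i3 : mu2.-integrable (K : set plane) (EFin \o (fun x => `|wc x|)) by exact: integrable_abse Ic.
  have i12 := @integrableD _ _ _ _ _ mK _ _ i1 i2.
  exact: (@integrableD _ _ _ _ _ mK _ _ i12 i3).
have W0 x : 0 <= W x by rewrite !addr_ge0.
have mW : measurable_fun (K : set plane) W by apply/measurable_EFinP; exact: measurable_int iW.
have mS : measurable_fun (K : set plane) (weak_square w).
  by apply: measurable_funS (measurable_weak_square oO Hw).2 => //; exact: open_measurable2.
have WS : (\int[mu2]_(x in K) (W x ^+ 2)%:E <= 3%:E * \int[mu2]_(x in K) (weak_square w x)%:E)%E.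
  rewrite -ge0_integralZl //; last 2 first.
  - exact/measurable_EFinP.
  - by move=> x _; rewrite lee_fin weak_square_ge0.
  apply: ge0_le_integral => //.
  - by move=> x _; rewrite lee_fin sqr_ge0.
  - by apply/measurable_EFinP; exact: measurable_funX.
  - by apply/measurable_EFinP; exact: measurable_funM.
  move=> x _; rewrite -EFinM lee_fin.
  apply: (@le_trans _ _ (3 * (wa x ^+ 2 + wb x ^+ 2 + wc x ^+ 2))); last by rewrite ler_pM2l.
  rewrite -(real_normK (num_real (wa x))) -(real_normK (num_real (wb x))) -(real_normK (num_real (wc x))).
  exact: aux3.
have I0 : 0 <= \int[mu2]_(x in K) W x by apply: Rintegral_ge0.
have muK : (mu2 K <= (C1 * eps)%:E)%E.
  by apply: (mu2_strip P D0 UM TM) => //; exact: aux6.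
have mass : cm * eps <= \int[mu2]_(x in K) chi1 x.
  exact: (test_mass P D0 e0 ed c00 (detF sz0) M0 UM TM c1 m10 m20 Hm1 Hm2).
have S0 : (0 <= \int[mu2]_(x in K) (weak_square w x)%:E)%E.
  by apply: integral_ge0 => x _; rewrite lee_fin weak_square_ge0.
have Y0 : (0 <= \int[mu2]_(x in K) (W x ^+ 2)%:E)%E.
  by apply: integral_ge0 => x _; rewrite lee_fin sqr_ge0.
(* An infinite integral over the strip makes the claim trivial; otherwise [absorb] can be applied to
   real numbers. *)
have [Sfin|] := boolP ((\int[mu2]_(x in K) (weak_square w x)%:E)%E \is a fin_num); last first.
  rewrite ge0_fin_numE // -leNgt leye_eq => /eqP ->.
  by rewrite gt0_muley ?lte_fin // addey ?leey.
have Yfin : (\int[mu2]_(x in K) (W x ^+ 2)%:E)%E \is a fin_num.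
  rewrite ge0_fin_numE //; apply: (le_lt_trans WS).
  by rewrite -(fineK Sfin) -EFinM ltry.
rewrite -(fineK Sfin) -EFinM -EFinD lee_fin.
have Y0' := fine_ge0 Y0.
have young t : 0 < t -> \int[mu2]_(x in K) W x <= t / 2 * (C1 * eps) +
    (2 * t)^-1 * fine (\int[mu2]_(x in K) (W x ^+ 2)%:E)%E.
  move=> t0; rewrite -lee_fin EFinD; apply: (le_trans (young_integral cK iW W0 t0)).
  apply: leeD; last by rewrite [X in (_ <= X)%E]EFinM (fineK Yfin).
  rewrite [X in (_ <= X)%E]EFinM; apply: lee_wpmul2l => //.
  by rewrite lee_fin divr_ge0 // ltW.
have XM := absorb (normr_ge0 _) e0 B0 cm0 C10 om0 mass LB Y0' I0 young.
rewrite real_normK ?num_real // in XM.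
apply: (le_trans XM); rewrite lerD2l /C -[leRHS]mulrA ler_wpM2l //.
  by rewrite divr_ge0 ?sqr_ge0 // mulr_ge0 ?(ltW C10) // mulr_ge0 // sqr_ge0.
by rewrite -lee_fin EFinM !fineK.
Qed.

Lemma measurable_edge p pu pv d (a b : R) : C1_with p pu pv -> 0 <= a -> b <= 1 ->
  measurable_fun `[a, b] (fun v => grad_hat pu pv d (0, v) ^+ 2).
Proof.
move=> Cp a0 b1; apply: measurable_funX; apply: (@measurable_funS _ _ _ _ (`[0, 1]%classic : set (measurableTypeR R))) => //.
  by apply: subset_itv; rewrite bnd_simp.
apply: subspace_continuous_measurable_fun => //.
apply: continuous_edge; exact: (@grad_hat_continuous p pu pv d Cp).
Qed.

(** The interval is cut into cells of length [4 ep], one strip per cell starting at its left end.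
    Disjointness replaces the sum of the strip integrals by a single integral over [O], so the
    constant is independent of the number of cells; the oscillation within the cells vanishes in the
    limit. *)
Lemma chart_estimate (eta : R) : 0 < eta <= 1/2 ->
  (forall z0, square z0 -> near_id (1/64) (fun z => sol (U z0) (T z0) (F z))
    [set z | square z /\ `|z - z0| < eta]) ->
  exists2 C : R, 0 < C & forall v0 l c : R, 0 <= v0 -> v0 + l <= 1 -> 0 < l -> l <= eta / 4 ->
    (forall v, v0 <= v <= v0 + l -> admissible_side c v) ->
  forall (p pu pv phi : R * R -> R) w (d : R * R), C1_with p pu pv -> (forall z, osquare z -> phi (F z) = p z) ->
    (forall i j, (i + j <= 2)%N -> weak_derivative O i j phi (w i j)) ->
    d = (1, 0) \/ d = (0, 1) ->
    (\int[mu2]_(x in O) (weak_square w x)%:E)%E \is a fin_num ->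
    (\int[mu]_(v in `[v0, (v0 + l)%R]) (grad_hat pu pv d (0%R, v) ^+ 2)%:E <=
     C%:E * \int[mu2]_(x in O) (weak_square w x)%:E)%E.
Proof.
have aux1 (q qk om : R) : `|q - qk| <= om -> q ^+ 2 <= 2 * qk ^+ 2 + 2 * om ^+ 2.
  move=> h; have h2 : (q - qk) ^+ 2 <= om ^+ 2.
    by rewrite -real_normK ?num_real // lerXn2r ?nnegrE // (le_trans _ h).
  by have := sqr_ge0 (q - 2 * qk); move: h2; rewrite !expr2; lra.
have aux2 (e q om I : R) : e * q ^+ 2 <= 4 * om ^+ 2 * e + I ->
    (2 * q ^+ 2 + 2 * om ^+ 2) * (4 * e) <= 40 * om ^+ 2 * e + 8 * I.
  by move=> *; lra.
have aux3 (x e : R) : 0 < e -> x <= 4 * e -> x <= 20 * e by move=> *; lra.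
move=> eta1 NI; have eta0 : 0 < eta by case/andP: eta1.
have [C C0 HC] := point_estimate eta1 NI.
have C80 : 0 < 8 * C by rewrite mulr_gt0 // ltr0n.
exists (8 * C) => // v0 l c v00 vl1 l0 leta side p pu pv phi w d Cp Hphi Hw Hd Sfin.
pose q v := grad_hat pu pv d (0, v).
have [_ mS] := measurable_weak_square oO Hw.
have sz (v : R) : 0 <= v <= 1 -> square (0, v) by move=> h; apply/squareP; rewrite /= lexx ler01.
have cq : {within square, continuous (grad_hat pu pv d)} by exact: (@grad_hat_continuous p pu pv d Cp).
apply/lee_addgt0Pr => e e0.
(* The cells contribute [40 om^2 ep] each, and [4 ep] times their number is [l]; the total is
   [10 om^2 l]. *)
have [om om0 omE] : exists2 om : R, 0 < om & 10 * om ^+ 2 * l <= e.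
  exists (Num.sqrt (e / (10 * l))); first by rewrite sqrtr_gt0 divr_gt0 // mulr_gt0.
  rewrite sqr_sqrtr; last by rewrite divr_ge0 ?(ltW e0) // mulr_ge0 // ltW.
  suff -> : 10 * (e / (10 * l)) * l = e by [].
  by field; rewrite gt_eqF.
have [r r0 Hr] := within_unif compact_square cq om0.
(* The first term ensures [20 ep < r], so that the gradient oscillates by less than [om]; the second
   ensures [18 ep <= eta / 16], as the test functions require. *)
pose J := (Num.truncn (5 * l / r + 72 * l / eta)).+1.
pose ep := l / (4 * J%:R).
have J0 : 0 < J%:R :> R by rewrite ltr0n.
have lJ : 5 * l / r + 72 * l / eta < J%:R.
  exact: truncnS_gt.
have ep0 : 0 < ep by rewrite divr_gt0 // mulr_gt0.
have JE : J%:R * (4 * ep) = l by rewrite /ep; field; rewrite gt_eqF.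
have a1 : 0 <= 5 * l / r by rewrite divr_ge0 ?(ltW r0) // mulr_ge0 // ltW.
have a2 : 0 <= 72 * l / eta by rewrite divr_ge0 ?(ltW eta0) // mulr_ge0 // ltW.
have ep1 : 20 * ep < r.
  have -> : 20 * ep = 5 * l / J%:R by rewrite /ep; field; rewrite gt_eqF.
  rewrite ltr_pdivrMr // -ltr_pdivrMl // mulrC; apply: le_lt_trans lJ; by rewrite lerDl.
have ep2 : 18 * ep <= eta / 16.
  have -> : 18 * ep = 72 * l / J%:R / 16 by rewrite /ep; field; rewrite gt_eqF.
  rewrite ler_pM2r ?invr_gt0 ?ltr0n // ler_pdivrMr // -ler_pdivrMl // mulrC.
  by apply: ltW; apply: le_lt_trans lJ; rewrite lerDr.
pose vk k := v0 + k%:R * (4 * ep).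
have vkI k : (k <= J)%N -> v0 <= vk k <= v0 + l.
  have h4 : 0 <= 4 * ep by rewrite mulr_ge0 // ltW.
  move=> kJ; apply/andP; split; first by rewrite lerDl mulr_ge0.
  by rewrite lerD2l -JE ler_wpM2r // ler_nat.
have vkl k : (k < J)%N -> `|vk k - v0| <= eta / 4.
  move=> /ltnW /vkI /andP[h1 h2]; rewrite ger0_norm ?subr_ge0 //.
  by apply: le_trans leta; rewrite lerBlDl.
pose K k := strip (U (0, v0)) (T (0, v0)) (F (0, vk k)) c ep (eta / 16).
have sz0 : square (0, v0) by apply: sz; rewrite v00; apply: le_trans vl1; rewrite lerDl ltW.
have D0 : det2 (U (0, v0)) (T (0, v0)) != 0.
  by rewrite -normr_gt0 (lt_le_trans c00) // detF.
have [M M0 HM] := jacobian_bound; have [UM TM] := HM _ sz0.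
have c1 : `|c| <= 1.
  have := side v0; rewrite lexx lerDl (ltW l0) => /(_ isT).
  by case=> -[-> _]; rewrite ?normrN normr1.
have eta16 : 0 < eta / 16 by rewrite divr_gt0 // ltr0n.
have cK k : compact (K k) by exact: (compact_strip D0 UM TM c1 ep0 eta16).
have KO k : (k < J)%N -> K k `<=` O.
  move=> kJ x /(strip_preimage eta1 (NI _ sz0) sz0 (side _ (vkI _ (ltnW kJ))) (vkl _ kJ) ep0).
  by move=> [z [oz <- _]]; exists z.
have vk1 k : (k <= J)%N -> 0 <= vk k <= 1.
  by move=> /vkI /andP[h1 h2]; rewrite (le_trans v00 h1) (le_trans h2).
have dis i j : (i < J)%N -> (j < J)%N -> i != j -> K i `&` K j = set0.
  move=> iJ jJ ij; rewrite -subset0 => x [Ki Kj].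
  have eta4 : eta / 4 < eta by rewrite ltr_pdivrMr ?ltr0n // ltr_pMr // ltr1n.
  apply: (strip_disjoint eta0 (NI _ sz0) c1 (vk1 i (ltnW iJ)) (vk1 j (ltnW jJ)) _ _ ep0 _ Ki Kj).
  - exact: le_lt_trans (vkl _ iJ) eta4.
  - exact: le_lt_trans (vkl _ jJ) eta4.
  have -> : vk j - vk i = (j%:R - i%:R) * (4 * ep) by rewrite /vk; ring.
  rewrite normrM (ger0_norm (_ : 0 <= 4 * ep)); last by rewrite mulr_ge0 // ltW.
  rewrite ler_peMl //; first by rewrite mulr_ge0 // ltW.
  move: ij; rewrite neq_ltn => /orP[] h.
    by rewrite ger0_norm -natrB ?(ltnW h) // ler1n subn_gt0.
  by rewrite distrC ger0_norm -natrB ?(ltnW h) // ler1n subn_gt0.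
have mK k : measurable (K k : set plane) by exact: compact_measurable2.
have mO : measurable (O : set plane) by exact: open_measurable2.
have SE := disjoint_sum_le mu2 mO mK KO dis mS (weak_square_ge0 w).
have S0 (A : set plane) : (0 <= \int[mu2]_(x in A) (weak_square w x)%:E)%E.
  by apply: integral_ge0 => x _; rewrite lee_fin weak_square_ge0.
have Kfin k : (k < J)%N -> (\int[mu2]_(x in K k) (weak_square w x)%:E)%E \is a fin_num.
  move=> kJ; rewrite ge0_fin_numE //; apply: (@le_lt_trans _ _ (\int[mu2]_(x in O) (weak_square w x)%:E)%E).
    apply: ge0_subset_integral => //; last exact: KO.
    + exact/measurable_EFinP.
    + by move=> x _; rewrite lee_fin weak_square_ge0.
  by rewrite -ge0_fin_numE.
pose I k := fine (\int[mu2]_(x in K k) (weak_square w x)%:E)%E.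
have cell k : (k < J)%N ->
   (\int[mu]_(v in `[(v0 + k%:R * (4 * ep))%R, (v0 + k.+1%:R * (4 * ep))%R]) (q v ^+ 2)%:E <=
      (40 * om ^+ 2 * ep + 8 * (C * I k))%:E)%E.
  move=> kJ; have /andP[k0 k1] := vk1 k (ltnW kJ); have /andP[b0 b1] := vk1 k.+1 kJ.
  have ab : vk k.+1 - vk k = 4 * ep by rewrite /vk -natr1; ring.
  have Hom z : square z -> `|z - (0, vk k)| <= 20 * ep -> `|grad_hat pu pv d z - q (vk k)| <= om.
    move=> sqz h; apply: ltW; apply: Hr => //; first by apply: sz; rewrite k0 k1.
    exact: le_lt_trans ep1.
  (* On the cell the value differs from that at the left end by at most [om]. Over the length
     [4 ep], [point_estimate] then yields [8 * 4 om^2 ep + 8 om^2 ep = 40 om^2 ep] besides the strip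
     integral. *)
  apply: (@le_trans _ _ ((2 * q (vk k) ^+ 2 + 2 * om ^+ 2) * (vk k.+1 - vk k))%:E).
    apply: integral_itv_le.
    - by rewrite -subr_ge0 ab mulr_ge0 // ltW.
    - exact: measurable_edge Cp _ _.
    - by move=> v; exact: sqr_ge0.
    - by rewrite addr_ge0 // mulr_ge0 // sqr_ge0.
    move=> v /andP[va vb]; apply: aux1; apply: Hom.
      by apply: sz; rewrite (le_trans k0 va) (le_trans vb b1).
    rewrite norm_pair_le /= subrr normr0 mulr_ge0 ?(ltW ep0) //=.
    rewrite ger0_norm ?subr_ge0 //; apply: (aux3 _ _ ep0); by rewrite -ab lerD2r.
  rewrite ab lee_fin; apply: aux2.
  rewrite -lee_fin EFinD (EFinM C) fineK ?Kfin //.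
  exact: (HC v0 (vk k) c ep sz0 (side _ (vkI _ (ltnW kJ))) (vkl _ kJ) ep0 ep2 p pu pv phi w d om Cp Hphi Hw Hd (ltW om0) Hom).
have h40 : 0 <= 4 * ep by rewrite mulr_ge0 // ltW.
rewrite -{1}JE.
apply: (le_trans (integral_itv_sum h40 _ (fun v => sqr_ge0 (q v)) cell)).
  by rewrite JE; exact: measurable_edge Cp v00 vl1.
rewrite big_split /= sumr_const card_ord -mulr_sumr -mulr_sumr EFinD addeC.
apply: leeD.
  rewrite mulrA EFinM; apply: lee_wpmul2l; first by rewrite lee_fin ltW.
  apply: le_trans SE; rewrite -sumEFin; apply: lee_sum => k _.
  by rewrite fineK ?Kfin.
rewrite lee_fin; apply: le_trans omE.
suff -> : 10 * om ^+ 2 * l = (40 * om ^+ 2 * ep) *+ J by [].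
 by rewrite -mulr_natr -JE; ring.
Qed.

Lemma trace_estimate :
  exists2 C : R, 0 < C & forall (p pu pv phi : R * R -> R) w (d : R * R), C1_with p pu pv ->
    (forall z, osquare z -> phi (F z) = p z) ->
    (forall i j, (i + j <= 2)%N -> weak_derivative O i j phi (w i j)) ->
    d = (1, 0) \/ d = (0, 1) ->
    (\int[mu]_(v in `[0%R, 1%R]) (grad_hat pu pv d (0%R, v) ^+ 2)%:E <=
     C%:E * \int[mu2]_(x in O) (weak_square w x)%:E)%E.
Proof.
have [eta eta1 NI] := uniform_chart.
have [C C0 HC] := chart_estimate eta1 NI.
have eta0 : 0 < eta by case/andP: eta1.
(* The number of cells is even so that none straddles [v = 1/2]; one direction [c] then serves a
   whole cell. *)
pose N0 := (Num.truncn (2 / eta)).+1; pose N := (N0 + N0)%N.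
have N0' : 0 < N0%:R :> R by rewrite ltr0n.
have NN : 0 < N%:R :> R by rewrite ltr0n.
have NE : N%:R = 2 * N0%:R :> R by rewrite natrD; ring.
have Neta : (N%:R)^-1 <= eta / 4.
  have h : 2 / eta < N0%:R by exact: truncnS_gt.
  rewrite -[leLHS]mul1r ler_pdivrMr // NE.
  move: h; rewrite ltr_pdivrMr // => h; lra.
exists (N%:R * C); first exact: mulr_gt0.
move=> p pu pv phi w d Cp Hphi Hw Hd.
have S0 : (0 <= \int[mu2]_(x in O) (weak_square w x)%:E)%E.
  by apply: integral_ge0 => x _; rewrite lee_fin weak_square_ge0.
have [Sfin|] := boolP ((\int[mu2]_(x in O) (weak_square w x)%:E)%E \is a fin_num); last first.
  rewrite ge0_fin_numE // -leNgt leye_eq => /eqP ->.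
  by rewrite gt0_muley ?lte_fin ?leey // mulr_gt0.
have cell m : (m < N)%N ->
   (\int[mu]_(v in `[(0 + m%:R * N%:R^-1)%R, (0 + m.+1%:R * N%:R^-1)%R]) (grad_hat pu pv d (0%R, v) ^+ 2)%:E <=
      (C * fine (\int[mu2]_(x in O) (weak_square w x)%:E))%:E)%E.
  move=> mN; rewrite EFinM fineK // !add0r -natr1 mulrDl mul1r.
  have m1 : m%:R * N%:R^-1 + N%:R^-1 = m.+1%:R / N%:R :> R by rewrite -natr1 mulrDl mul1r.
  apply: (HC (m%:R * N%:R^-1) N%:R^-1 (if (m < N0)%N then 1 else -1) _ _ _ Neta _ p pu pv phi w d Cp Hphi Hw Hd Sfin).
  - by rewrite mulr_ge0.
  - by rewrite m1 ler_pdivrMr // mul1r ler_nat.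
  - by rewrite invr_gt0.
  move=> v; rewrite m1 ler_pdivrMr // ler_pdivlMr // NE.
  case: ltnP => h /andP[h1 h2]; [left|right]; split=> //; apply/andP; split.
  - have := ler0n R m; nra.
  - have : m.+1%:R <= N0%:R :> R by rewrite ler_nat.
    nra.
  - have : N0%:R <= m%:R :> R by rewrite ler_nat.
    nra.
  - have : m.+1%:R <= N%:R :> R by rewrite ler_nat.
    rewrite NE; nra.
have Nv : N%:R * N%:R^-1 = 1 :> R by rewrite mulfV ?gt_eqF.
have Ni : 0 <= N%:R^-1 :> R by rewrite invr_ge0 ltW.
have mq : measurable_fun (`[0, 0 + N%:R * N%:R^-1] : set R) (fun v : R => grad_hat pu pv d (0, v) ^+ 2).
  rewrite Nv add0r; exact: measurable_edge Cp _ _.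
have := integral_itv_sum Ni mq (fun v : R => sqr_ge0 (grad_hat pu pv d (0, v))) cell.
rewrite Nv add0r => h; apply: (le_trans h).
by rewrite sumr_const card_ord -[(C * _) *+ _]mulr_natl mulrA EFinM fineK.
Qed.

End Trace.

(** * Passing to the infimum in the Sobolev norm *)

Section SobolevLink.
Context {R : realType}.
Local Notation plane := (measurableTypeR R * measurableTypeR R)%type.

Lemma le_sqrte (x y : \bar R) : (0 <= x)%E -> (x <= y)%E -> (sqrte x <= sqrte y)%E.
Proof.
move=> x0 xy; rewrite -lee_sqr ?sqrte_ge0 // !sqr_sqrte //.
exact: le_trans xy.
Qed.

Lemma integral_weak_square (O : set (R * R)) phi w : open O ->
  (forall i j, (i + j <= 2)%N -> weak_derivative O i j phi (w i j)) ->
  (\sum_(i < 3) \sum_(j < 3 | (i + j <= 2)%N) \int[mu2]_(x in O) ((w i j x) ^+ 2)%:E =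
   \int[mu2]_(x in O) (weak_square w x)%:E)%E.
Proof.
move=> oO Hw.
have mO : measurable (O : set plane) by exact: open_measurable2.
have mw i j : (i + j <= 2)%N -> measurable_fun (O : set plane) (fun x => (w i j x ^+ 2)%:E).
  by move=> ij; apply/measurable_EFinP; exact: (measurable_weak_square oO Hw).1.
have w0 i j x : O x -> (0 <= (w i j x ^+ 2)%:E)%E by rewrite lee_fin sqr_ge0.
under [RHS]eq_integral => x _ do rewrite weak_squareE 5!EFinD.
rewrite !ge0_integralD //; do ?[by move=> x Ox; rewrite ?adde_ge0 ?w0 //|
  by repeat (apply: emeasurable_funD; last exact: mw); exact: mw].
under eq_bigr => i _ do rewrite big_mkcond !big_ord_recl big_ord0.
by rewrite !big_ord_recl big_ord0 /= !adde0 ?add0e !addeA.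
Qed.

(* No uniqueness of weak derivatives is needed: the bound passes to the infimum. *)
Lemma sobolev_lower (O : set (R * R)) phi (C : R) (T : \bar R) : open O -> 0 < C -> (0 <= T)%E ->
  (forall w, (forall i j, (i + j <= 2)%N -> weak_derivative O i j phi (w i j)) ->
     (T <= C%:E * \int[mu2]_(x in O) (weak_square w x)%:E)%E) ->
  (T <= C%:E * sobolev_norm 2 O phi ^+ 2)%E.
Proof.
move=> oO C0 T0 H; have Ci : 0 < C^-1 by rewrite invr_gt0.
pose t := sqrte (C^-1%:E * T).
have CT0 : (0 <= C^-1%:E * T)%E by rewrite mule_ge0 // lee_fin ltW.
have h : (t <= sobolev_norm 2 O phi)%E.
  apply: le_ereal_inf_tmp => N [w [Hw ->]].
  rewrite (integral_weak_square oO Hw) poweR12_sqrt; last first.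
    by apply: integral_ge0 => x _; rewrite lee_fin weak_square_ge0.
  by apply: le_sqrte => //; rewrite lee_pdivrMl //; exact: H.
rewrite -lee_pdivrMl // -(sqr_sqrte CT0) lee_sqr //.
- exact: sqrte_ge0.
- exact: le_trans (sqrte_ge0 _) h.
Qed.

End SobolevLink.

(** * One-sided derivatives on the unit interval *)

Section OneSided.
Context {R : realType}.

(** Properness of this filter is what makes the limit in [D01] unique. A nearby point is found by
    moving from [v] into the longer part of the interval. *)
Lemma unit_limit_point (v : R) : v \in `[0, 1] -> ProperFilter (within `[0, 1] v^').
Proof.
rewrite in_itv /= => /andP[v0 v1]; apply: Build_ProperFilter_ex => A.
rewrite /within /= /dnbhs /within /= => /nbhs_ballP[e /= e0 H].
have [vh|vh] := lerP v (1/2).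
- have m0 : 0 < Num.min (e / 2) (1/2) by rewrite lt_min divr_gt0 //=; lra.
  have m1 : Num.min (e / 2) (1/2) <= e / 2 by rewrite ge_min lexx.
  have m2 : Num.min (e / 2) (1/2) <= 1/2 by rewrite ge_min lexx orbT.
  exists (v + Num.min (e / 2) (1/2)); apply: H.
  + rewrite -ball_normE /= opprD addrA subrr add0r normrN gtr0_norm //; lra.
  + by rewrite gt_eqF // ltrDl.
  + by rewrite /= in_itv /=; apply/andP; split; lra.
- have m0 : 0 < Num.min (e / 2) (1/2) by rewrite lt_min divr_gt0 //=; lra.
  have m1 : Num.min (e / 2) (1/2) <= e / 2 by rewrite ge_min lexx.
  have m2 : Num.min (e / 2) (1/2) <= 1/2 by rewrite ge_min lexx orbT.
  exists (v - Num.min (e / 2) (1/2)); apply: H.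
  + rewrite -ball_normE /= opprB addrCA subrr addr0 gtr0_norm //; lra.
  + by rewrite lt_eqF // gtrBl.
  + by rewrite /= in_itv /=; apply/andP; split; lra.
Qed.

Lemma D01E (f : R -> R) (v l : R) : v \in `[0, 1] ->
  (forall e : R, 0 < e -> exists2 d : R, 0 < d & forall w, w \in `[0, 1] -> `|w - v| < d ->
     `|f w - f v - l * (w - v)| <= e * `|w - v|) ->
  D01 f v = l.
Proof.
move=> v01 H; have pf := unit_limit_point v01.
apply: cvg_lim => //; apply/cvgrPdist_le => e e0.
have [d d0 Hd] := H e e0.
rewrite near_withinE /dnbhs near_withinE; apply/nbhs_ballP; exists d => //= w.
rewrite -ball_normE /= distrC => wd wv w01.
have wv0 : w - v != 0 by rewrite subr_eq0.
have -> : l - (f w - f v) / (w - v) = - ((f w - f v - l * (w - v)) / (w - v)) by field.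
rewrite normrN normrM normfV ler_pdivrMr ?normr_gt0 //; exact: Hd.
Qed.

Lemma is_derive1_norm (f : R -> R) (x l : R) : is_derive x 1 f l ->
  forall e : R, 0 < e -> exists2 r : R, 0 < r & forall w : R, `|w - x| < r ->
     `|f w - f x - l * (w - x)| <= e * `|w - x|.
Proof.
move=> [dv dl] e e0; have L : (fun h : R => h^-1 *: (f (h *: (1 : R) + x) - f x)) @ 0^' --> l.
  by rewrite -dl; exact: dv.
move/cvgrPdist_le : L => /(_ e e0); rewrite near_withinE => /nbhs_ballP[r /= r0 H].
exists r => // w wr; have [->|wx] := eqVneq w x; first by rewrite !subrr mulr0 subrr normr0 mulr0.
have wx0 : w - x != 0 by rewrite subr_eq0.
have := H (w - x); rewrite -ball_normE /= sub0r normrN => /(_ wr wx0).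
rewrite /GRing.scale /= mulr1 subrK => h.
have -> : f w - f x - l * (w - x) = - (l - (w - x)^-1 * (f w - f x)) * (w - x) by field.
by rewrite normrM normrN ler_wpM2r.
Qed.

Lemma D01_poly0 (k : R -> R) (q : {poly R}) (h : R) : 0 < h ->
  (forall x, 0 <= x < h -> k x = q.[x]) -> D01 k 0 = q^`().[0].
Proof.
move=> h0 E; apply: D01E; first by rewrite in_itv /= lexx ler01.
move=> e e0; have [d d0 Hd] := is_derive1_norm (is_derive_poly q 0) e0.
exists (Num.min d h); first by rewrite lt_min d0 h0.
move=> w; rewrite in_itv /= => /andP[w0 _]; rewrite lt_min => /andP[wd wh].
rewrite subr0 ger0_norm // in wh.
by rewrite !E ?lexx ?h0 ?w0 ?wh //; exact: Hd.
Qed.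

(** On the sides of the square [fu] and [fv] are given as continuous extensions;
    [C1_linear_estimate] holds up to the boundary and shows that they are one-sided derivatives
    there. *)
Lemma D01_C1 (f fu fv : R * R -> R) z : C1_with f fu fv -> square z ->
  D01 (fun t => f (t, z.2)) z.1 = fu z /\ D01 (fun t => f (z.1, t)) z.2 = fv z.
Proof.
move=> Cf sz; have /squareP[z1 z2] := sz.
have key (e : R) : 0 < e -> exists2 d : R, 0 < d & forall w, square w -> `|w - z| < d ->
    `|f w - f z - (fu z * (w.1 - z.1) + fv z * (w.2 - z.2))| <= e * (`|w.1 - z.1| + `|w.2 - z.2|).
  move=> e0; have [d d0 Hd] := C1_near Cf sz e0.
  exists d => // w sw nw; apply: (@C1_linear_estimate R f fu fv z d _ _ _ Cf (ltW e0)) => //.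
    by move=> y oy ny; apply: Hd => //; exact: osquare_square.
  by rewrite subrr normr0.
split; apply: D01E => //; try by rewrite in_itv.
- move=> e /key[d d0 Hd]; exists d => // w w01 nw.
  have sw : square (w, z.2) by apply/squareP; split=> //; move: w01; rewrite in_itv.
  have := Hd _ sw; rewrite norm_pair_lt /= subrr normr0 d0 nw => /(_ isT).
  by rewrite mulr0 !addr0 -surjective_pairing.
- move=> e /key[d d0 Hd]; exists d => // w w01 nw.
  have sw : square (z.1, w) by apply/squareP; split=> //; move: w01; rewrite in_itv.
  have := Hd _ sw; rewrite norm_pair_lt /= subrr normr0 d0 nw => /(_ isT).
  by rewrite mulr0 !add0r -surjective_pairing.
Qed.

End OneSided.

(** * Tensor product splines are C^1 and piecewise polynomial on the edge *)

Section TensorSplines.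
Context {R : realType}.

Definition C1_interval (k k' : R -> R) : Prop :=
  [/\ {within `[0, 1], continuous k}, {within `[0, 1], continuous k'} &
    forall x : R, x \in `]0, 1[ -> is_derive x 1 k (k' x)].

Lemma within_eq (T : topologicalType) (A : set T) (f g : T -> R) : (forall x, A x -> f x = g x) ->
  {within A, continuous f} -> {within A, continuous g}.
Proof.
move=> E /subspace_continuousP H; apply/subspace_continuousP => x Ax.
suff: g y @[y --> within A (nbhs x)] --> g x by [].
rewrite -(E x Ax); apply: cvg_trans (H x Ax); apply: near_eq_cvg.
by rewrite near_withinE; near=> y => Ay; exact: E.
Unshelve. all: end_near.
Qed.

Lemma Ck_C1_interval r f : (1 <= r)%N -> Ck r 0 1 f -> exists k', C1_interval f k'.
Proof.
case: r => // r _ [g [g0 cg dg]]; exists (g 1%N).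
have E (x : R) : x \in `]0, 1[ -> \forall y \near x, g 0%N y = f y.
  move=> x01; have : \forall y \near x, y \in `]0, 1[ by exact: near_in_itvoo.
  by apply: filterS => y y01; apply: g0; move: y01; exact: subset_itv_oo_cc.
split.
- apply: (@within_eq _ _ (g 0%N)); last exact: cg.
  by move=> x /=; exact: g0.
- exact: cg.
- move=> x x01; apply: near_eq_is_derive (dg 0%N x _ x01) => //.
  exact: E.
Qed.

Lemma within_sum (I : Type) (r : seq I) (A : set (R * R)) (F : I -> R * R -> R) :
  (forall i, {within A, continuous (F i)}) ->
  {within A, continuous (fun z => \sum_(i <- r) F i z)}.
Proof.
move=> H; elim: r => [|i r IH].
  under eq_fun do rewrite big_nil.
  exact: cst_continuous.
under eq_fun do rewrite big_cons.
by move=> z; apply: cvgD; [exact: H|exact: IH].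
Qed.

Lemma is_derive_bigsum (I : Type) (r : seq I) (V : normedModType R) (F : I -> V -> R) (l : I -> R) (z d : V) :
  (forall i, is_derive z d (F i) (l i)) ->
  is_derive z d (fun y => \sum_(i <- r) F i y) (\sum_(i <- r) l i).
Proof.
move=> H; elim: r => [|i r IH].
  rewrite big_nil; under eq_fun do rewrite big_nil.
  exact: is_derive_cst.
rewrite big_cons; under eq_fun do rewrite big_cons.
exact: is_deriveD.
Qed.

Lemma within_fst (k : R -> R) : {within `[0, 1], continuous k} ->
  {within square, continuous (fun z : R * R => k z.1)}.
Proof.
move=> /subspace_continuousP H; apply/subspace_continuousP => z sz.
have /squareP[z1 _] := sz; have z01 : `[0, 1]%classic z.1 by rewrite /= in_itv.
apply: (@cvg_comp _ _ _ fst k _ (within `[0, 1] (nbhs z.1)) _ _ (H z.1 z01)).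
move=> A; rewrite /within /= => /nbhs_ballP[e /= e0 HA]; apply/nbhs_ballP; exists e => //= w [w1 w2] sw.
by apply: HA => //; have /squareP[h _] := sw; rewrite in_itv.
Qed.

Lemma within_snd (k : R -> R) : {within `[0, 1], continuous k} ->
  {within square, continuous (fun z : R * R => k z.2)}.
Proof.
move=> /subspace_continuousP H; apply/subspace_continuousP => z sz.
have /squareP[_ z2] := sz; have z01 : `[0, 1]%classic z.2 by rewrite /= in_itv.
apply: (@cvg_comp _ _ _ snd k _ (within `[0, 1] (nbhs z.2)) _ _ (H z.2 z01)).
move=> A; rewrite /within /= => /nbhs_ballP[e /= e0 HA]; apply/nbhs_ballP; exists e => //= w [w1 w2] sw.
by apply: HA => //; have /squareP[_ h] := sw; rewrite in_itv.
Qed.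

Lemma C1_with_ext (f g fu fv : R * R -> R) : (forall z, square z -> f z = g z) ->
  C1_with f fu fv -> C1_with g fu fv.
Proof.
move=> E [cf cu cv D]; split=> //; first exact: within_eq cf.
move=> x ox; have [d1 d2] := D x ox.
have nE : \near x, f x = g x.
  have [d d0 H] := osquare_open ox.
  apply/nbhs_ballP; exists d => // w; rewrite -ball_normE /= distrC => wd.
  by apply: E; apply: osquare_square; exact: H.
by split; apply: near_eq_is_derive nE _.
Qed.

Lemma tensor_C1 N (a b da db : 'I_N -> R -> R) :
  (forall i, C1_interval (a i) (da i)) -> (forall i, C1_interval (b i) (db i)) ->
  C1_with (fun z => \sum_i a i z.1 * b i z.2)
    (fun z => \sum_i da i z.1 * b i z.2) (fun z => \sum_i a i z.1 * db i z.2).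
Proof.
move=> Ha Hb.
have C (p q : 'I_N -> R -> R) : (forall i, {within `[0, 1], continuous (p i)}) ->
    (forall i, {within `[0, 1], continuous (q i)}) ->
    {within square, continuous (fun z : R * R => \sum_i p i z.1 * q i z.2)}.
  move=> cp cq; apply: within_sum => i z.
  by apply: cvgM; [exact: (within_fst (cp i))|exact: (within_snd (cq i))].
split; try by apply: C => i; have [] := Ha i; have [] := Hb i.
move=> z /osquareP[z1 z2]; split.
- apply/is_derive_fst; apply: is_derive_bigsum => i.
  have [_ _ /(_ z.1)] := Ha i; rewrite in_itv => /(_ z1) d.
  by apply: is_derive_ext (is_deriveZ (b i z.2) d) => [y|]; rewrite /= mulrC.
- apply/is_derive_snd; apply: is_derive_bigsum => i.
  have [_ _ /(_ z.2)] := Hb i; rewrite in_itv => /(_ z2) d.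
  exact: is_derive_ext (is_deriveZ (a i z.1) d).
Qed.

Lemma continuous_zero_closure (f : R -> R) (a b : R) : a < b ->
  {within `[a, b], continuous f} -> (forall x, a < x < b -> f x = 0) ->
  forall x, a <= x <= b -> f x = 0.
Proof.
move=> ab /subspace_continuousP cf f0 x /andP[ax xb].
have x01 : `[a, b]%classic x by rewrite /= in_itv /= ax.
apply/eqP; rewrite -normr_le0; apply/ler_addgt0Pl => e e0; rewrite addr0.
have /cvgrPdist_lt /(_ e e0) := cf x x01.
rewrite near_withinE => /nbhs_ballP[d /= d0 H].
pose t := Num.min (1/2) (d / (2 * (b - a))).
have ba : 0 < b - a by rewrite subr_gt0.
have t0 : 0 < t by rewrite lt_min; apply/andP; split; [lra|rewrite divr_gt0 // mulr_gt0].
have t1 : t <= 1/2 by rewrite ge_min lexx.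
have t2 : t * (b - a) <= d / 2.
  rewrite -ler_pdivlMr //; have -> : d / 2 / (b - a) = d / (2 * (b - a)) by field; rewrite gt_eqF.
  by rewrite ge_min lexx orbT.
pose m := (a + b) / 2; pose y := x + t * (m - x).
have ya : a < y by rewrite /y /m; nra.
have yb : y < b by rewrite /y /m; nra.
have yI : y \in `[a, b] by rewrite in_itv /= !ltW.
have fy : f y = 0 by apply: f0; rewrite ya.
rewrite -[f x]subr0 -fy.
apply: ltW; apply: (H y _ yI); rewrite -ball_normE /=.
rewrite /y opprD addrA subrr add0r normrN normrM (gtr0_norm t0).
have hm : `|m - x| <= b - a by rewrite ler_norml /m; apply/andP; split; lra.
apply: (le_lt_trans (ler_wpM2l (ltW t0) hm)); lra.
Qed.

(** Inside the interval [k] and [q] agree near every point; continuity of [k'] carries the identity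
    to the knots, where the pieces of [k] on the two sides may differ. *)
Lemma C1_interval_poly (k k' : R -> R) (a b : R) (q : {poly R}) : C1_interval k k' ->
  0 <= a -> a < b -> b <= 1 -> (forall x, x \in `[a, b] -> k x = q.[x]) ->
  forall x, x \in `[a, b] -> k' x = q^`().[x].
Proof.
move=> [_ ck' dk] a0 ab b1 E x; rewrite in_itv /= => xab.
apply/eqP; rewrite -subr_eq0; apply/eqP.
apply: (@continuous_zero_closure (fun y => k' y - q^`().[y]) a b ab) xab.
  move=> y; apply: cvgB; last exact: (continuous_subspaceT (@continuous_horner _ _)).
  apply: (continuous_subspaceW _ ck').
  by apply: subset_itv; rewrite bnd_simp.
move=> y yab.
have y01 : y \in `]0, 1[.
  by rewrite in_itv /=; case/andP: yab => h1 h2; rewrite (le_lt_trans a0 h1) (lt_le_trans h2).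
have [_ <-] := dk y y01; have [_ <-] := is_derive_poly q y.
apply/eqP; rewrite subr_eq0; apply/eqP; apply: near_eq_derive.
have : \forall z \near y, z \in `]a, b[ by apply: near_in_itvoo; rewrite in_itv.
by apply: filterS => z zab; apply: E; move: zab; exact: subset_itv_oo_cc.
Qed.

Lemma knot_lt (n i : nat) : (i < n)%N -> knot n i < knot n i.+1 :> R.
Proof.
move=> i_n; have n0 : 0 < n%:R :> R by rewrite ltr0n (leq_ltn_trans _ i_n).
by rewrite /knot ltr_pM2r ?invr_gt0 // ltr_nat.
Qed.

Lemma knot_itv (n i : nat) : (i <= n)%N -> 0 <= (knot n i : R) <= 1.
Proof.
rewrite /knot; case: n => [|n] ln.
  by rewrite invr0 mulr0 lexx ler01.
by rewrite divr_ge0 //= ler_pdivrMr ?ltr0n // mul1r ler_nat.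
Qed.

Lemma spline_C1 (p r n : nat) (k : R -> R) : (1 <= r)%N -> spline p r n k -> exists2 k', C1_interval k k' &
  forall j, (j < n)%N -> exists q : {poly R}, forall v, v \in `[knot n j, knot n j.+1] ->
    k v = q.[v] /\ k' v = q^`().[v].
Proof.
move=> r1 [pk /(Ck_C1_interval r1)[k' Ck']]; exists k' => // j jn.
have [q [_ E]] := pk j jn; exists q => v vj; split; first exact: E.
have /andP[a0 _] := knot_itv (ltnW jn).
have /andP[_ b1] := knot_itv jn.
exact: (C1_interval_poly Ck' a0 (knot_lt jn) b1 E).
Qed.

(** At [u = 0] the first factors become constant coefficients, so both partial derivatives are
    polynomial in [v] on each coarse element. This is the source of the rationality of the gluing
    data. *)
Lemma tensor_spline_C1 (p r n p' r' n' : nat) (f : R * R -> R) : (1 <= r)%N -> (1 <= r')%N ->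
  tensor (spline p r n) (spline p' r' n') f ->
  exists fu fv, C1_with f fu fv /\
    forall j, (j < n')%N -> exists q1 q2 : {poly R}, forall v, v \in `[knot n' j, knot n' j.+1] ->
      fu (0, v) = q1.[v] /\ fv (0, v) = q2.[v].
Proof.
move=> r1 r1' [N [a [b [Hab E]]]].
have /choice[da Hda] i := (let: ex_intro2 k' h _ := spline_C1 r1 (Hab i).1 in ex_intro (C1_interval (a i)) k' h).
have /choice[db Hdb] i : exists k', C1_interval (b i) k' /\ forall j, (j < n')%N -> exists q : {poly R}, forall v, v \in `[knot n' j, knot n' j.+1] ->
    b i v = q.[v] /\ k' v = q^`().[v].
  by have [k' h1 h2] := spline_C1 r1' (Hab i).2; exists k'.
exists (fun z => \sum_i da i z.1 * b i z.2), (fun z => \sum_i a i z.1 * db i z.2); split.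
  apply: (C1_with_ext _ (tensor_C1 Hda (fun i => (Hdb i).1))) => -[u v] /squareP[u1 v1] /=.
  by rewrite E // in_itv.
move=> j jn; have /choice[q Hq] i := (Hdb i).2 j jn.
exists (\sum_i da i 0 *: q i), (\sum_i a i 0 *: (q i)^`()) => v vj /=.
rewrite !horner_sum; split; apply: eq_bigr => i _; rewrite hornerZ.
  by have [-> _] := Hq i v vj.
by have [_ ->] := Hq i v vj.
Qed.

End TensorSplines.

(** * Rational functions and the approximation property *)

Section Rational.
Context {R : realType}.
Local Notation mu := (@lebesgue_measure R).

Definition ratfun (q : {poly R} * {poly R}) (v : R) : R := q.1.[v] / q.2.[v].

(** The quotient rule on unreduced fractions: the denominator is only squared, so it acquires no new
    zeros and one nonvanishing assumption serves all orders. *)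
Definition ratder (q : {poly R} * {poly R}) : {poly R} * {poly R} :=
  (q.1^`() * q.2 - q.1 * q.2^`(), q.2 ^+ 2).

Lemma is_derive_ratfun q (v : R) : q.2.[v] != 0 -> is_derive v 1 (ratfun q) (ratfun (ratder q) v).
Proof.
move=> q0; have d1 := is_derive_poly q.1 v.
have d2 := is_deriveV q0 (is_derive_poly q.2 v).
apply: is_derive_ext (is_deriveM d1 d2) => //.
rewrite /ratfun /ratder /GRing.scale /= !(hornerD, hornerN, hornerM, horner_exp).
by move: q.1.[v] q.2.[v] q.1^`().[v] q.2^`().[v] q0 => x y x' y' y0; field.
Qed.

Lemma iter_ratder_neq0 q (v : R) n : q.2.[v] != 0 -> (iter n ratder q).2.[v] != 0.
Proof. by move=> q0; elim: n => //= n IH; rewrite horner_exp expf_neq0. Qed.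

Definition rational_on (a b : R) (s : R -> R) : Prop :=
  exists q : {poly R} * {poly R}, forall v, v \in `[a, b] -> q.2.[v] != 0 /\ s v = ratfun q v.

Lemma rational_continuous q (a b : R) n : (forall v, v \in `[a, b] -> q.2.[v] != 0) ->
  {within `[a, b], continuous (ratfun (iter n ratder q))}.
Proof.
move=> q0; apply: continuous_in_subspaceT => x; rewrite inE => xab.
have [d _] := is_derive_ratfun (iter_ratder_neq0 n (q0 x xab)).
by apply: differentiable_continuous; apply/derivable1_diffP.
Qed.

Lemma rational_Cinfty (a b : R) s : rational_on a b s -> Cinfty a b s.
Proof.
move=> [q Hq] k; exists (fun i => ratfun (iter i ratder q)); split.
- by move=> x /Hq[_ ->].
- by move=> i _; apply: rational_continuous => v /Hq[].
- move=> i x _ xab; apply: is_derive_ratfun; apply: iter_ratder_neq0.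
  by have [] := Hq x (subset_itv_oo_cc xab).
Qed.

(** Stated on the open interval, since at a knot the two-sided [derive1n] also sees the neighbouring
    piece of [s]. *)
Lemma rational_derive1n (a b : R) s q : (forall v, v \in `[a, b] -> q.2.[v] != 0 /\ s v = ratfun q v) ->
  forall n x, x \in `]a, b[ -> derive1n n s x = ratfun (iter n ratder q) x.
Proof.
move=> Hq; elim=> [|n IH] x xab; first by rewrite derive1n0; have [_ ->] := Hq x (subset_itv_oo_cc xab).
rewrite derive1nS derive1E.
have [q0 _] := Hq x (subset_itv_oo_cc xab).
have [_ <-] := is_derive_ratfun (iter_ratder_neq0 n q0).
apply: near_eq_derive.
have : \forall z \near x, z \in `]a, b[ by exact: near_in_itvoo.
by apply: filterS => z; exact: IH.
Qed.

Lemma lebesgue_measure_gt0 : (0 < mu [set: R])%E.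
Proof.
apply: (@lt_le_trans _ _ (mu `[0%R, 1%R])).
  by rewrite lebesgue_measure_itv /= lte_fin ltr01 -EFinD lte_fin subr0 ltr01.
by apply: le_measure; rewrite ?inE.
Qed.

(** The end points form a null set; this bridges the gap left by derivatives that are controlled
    only between knots. *)
Lemma Linfty_le (a b : R) f (M : R) : 0 <= M -> (forall x, x \in `]a, b[ -> `|f x| <= M) ->
  (Linfty_norm a b f <= M%:E)%E.
Proof.
move=> M0 H; rewrite /Linfty_norm unlock /= lebesgue_measure_gt0; apply/ess_supP.
exists [set a; b]; split.
- exact: measurableU.
- by apply: countable_lebesgue_measure0; exact: finite_set_countable.
move=> x; rewrite /= patchE; case: ifPn => [|_].
  rewrite inE /= in_itv /= => /andP[ax xb] nH; apply: contrapT => /not_orP[xa xb'].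
  apply: nH; rewrite lee_fin; apply: H; rewrite in_itv /= !lt_neqAle ax xb !andbT.
  by apply/andP; split; [rewrite eq_sym|]; apply/eqP.
by rewrite /= normr0 lee_fin.
Qed.

Lemma Linfty_ae (a b : R) f (M : R) : (Linfty_norm a b f <= M%:E)%E ->
  {ae mu, forall x, x \in `[a, b] -> `|f x| <= M}.
Proof.
rewrite /Linfty_norm unlock /= lebesgue_measure_gt0 => /ess_supP.
apply: filterS => x; rewrite /= patchE => h xab; move: h.
by rewrite mem_set // lee_fin.
Qed.

Lemma rational_Linfty (a b : R) s n : rational_on a b s ->
  exists2 M : R, 0 <= M & (Linfty_norm a b (derive1n n s) <= M%:E)%E.
Proof.
move=> [q Hq].
have c : {within `[a, b], continuous (ratfun (iter n ratder q))}.
  by apply: rational_continuous => v /Hq[].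
have /compact_bounded/ex_strict_bound_gt0[M M0 H] := continuous_compact c (@segment_compact _ a b).
exists M; first exact: ltW.
apply: Linfty_le; first exact: ltW.
move=> x xab; rewrite (rational_derive1n Hq n xab); apply/ltW/H; exists x => //.
exact: subset_itv_oo_cc xab.
Qed.

Lemma knot_find (n : nat) (v : R) : v \in `[0, 1[ -> (0 < n)%N -> exists2 j, (j < n)%N & v \in `[knot n j, knot n j.+1].
Proof.
rewrite in_itv /= => /andP[v0 v1] n0; have n0' : 0 < n%:R :> R by rewrite ltr0n.
have nv : 0 <= v * n%:R by rewrite mulr_ge0 // ltW.
have /andP[h1 h2] := truncn_itv nv.
exists (Num.truncn (v * n%:R)).
  rewrite -(ltr_nat R); apply: (le_lt_trans h1); by rewrite gtr_pMl.
by rewrite in_itv /= /knot ler_pdivrMr // ler_pdivlMr // h1 ltW.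
Qed.

(** [M] is built from derivatives of [s] on the elements of the mesh of the parametrization, which
    is fixed; hence it is uniform in [k2] and [P]. The essential supremum norm gives a pointwise
    bound almost everywhere. *)
Lemma approximation_bound (G : geometry R) (D : degrees) (Cst Capp : R) (s : R -> R) :
  (0 < gn2 G)%N -> Ck (gr2 G - 1) 0 1 s ->
  (forall j, (j < gn2 G)%N -> rational_on (knot (gn2 G) j) (knot (gn2 G) j.+1) s) ->
  exists2 M : R, 0 <= M & forall k2 P, projector G D k2 Cst Capp P ->
    {ae mu, forall v, v \in `]0, 1[ -> `|s v - P s v| <= M * h2 G k2 ^+ (pt D).+1}.
Proof.
move=> n0 Cs rs.
have /choice[M HM] (j : nat) : exists M : R, 0 <= M /\ ((j < gn2 G)%N ->
  (Linfty_norm (knot (gn2 G) j) (knot (gn2 G) j.+1) (derive1n (pt D).+1 s) <= M%:E)%E).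
  case: (ltnP j (gn2 G)) => jn; last by exists 0.
  by have [M M0 h] := rational_Linfty (pt D).+1 (rs j jn); exists M.
pose B := \sum_(j < gn2 G) M j.
have B0 : 0 <= B by apply: sumr_ge0 => j _; exact: (HM j).1.
have MB j : (j < gn2 G)%N -> M j <= B.
  move=> jn; rewrite /B (bigD1 (Ordinal jn)) //= lerDl; apply: sumr_ge0 => i _; exact: (HM i).1.
(* No sign is assumed for [Capp], whence the absolute value. *)
exists (`|Capp| * B); first exact: mulr_ge0.
move=> k2 P [_ _ _ _ happ].
have hp : 0 <= h2 G k2 ^+ (pt D).+1 :> R by rewrite exprn_ge0 // /h2 invr_ge0.
have E (j : nat) : {ae mu, forall v, (j < gn2 G)%N -> v \in `[knot (gn2 G) j, knot (gn2 G) j.+1] ->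
    `|s v - P s v| <= `|Capp| * B * h2 G k2 ^+ (pt D).+1}.
  case: (ltnP j (gn2 G)) => jn; last by apply: aeW.
  have := happ s Cs (fun i ji => rational_Cinfty (rs i ji)) j jn.
  set X := Linfty_norm _ _ _; set Y := Linfty_norm _ _ _ => XY.
  have Y0 : (0 <= Y)%E by exact: Lnorm_ge0.
  have YB : (Y <= B%:E)%E by apply: (le_trans ((HM j).2 jn)); rewrite lee_fin MB.
  have : (X <= (`|Capp| * B * h2 G k2 ^+ (pt D).+1)%:E)%E.
    apply: (le_trans XY).
    apply: (@le_trans _ _ ((`|Capp| * h2 G k2 ^+ (pt D).+1)%:E * Y)%E).
      by apply: lee_wpmul2r => //; rewrite lee_fin ler_wpM2r // ler_norm.
    rewrite mulrAC [leRHS]EFinM; apply: lee_wpmul2l => //.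
    by rewrite lee_fin mulr_ge0.
  move=> /Linfty_ae; apply: (@filterS _ _ (ae_filter_ringOfSetsType _)) => v h _; exact: h.
move/ae_foralln : E; apply: filterS => v H v01.
have [|j jn vj] := @knot_find (gn2 G) v _ n0.
  by move: v01; rewrite !in_itv /= => /andP[h1 h2]; rewrite ltW.
exact: H vj.
Qed.

End Rational.

(** * The first two B-splines on the first knot span *)

Section CoxDeBoor.
Context {R : realType}.
Implicit Type t : seq R.

Lemma bspline0E t i x : bspline t 0 i x =
  if (t`_i <= x < t`_i.+1) || [&& t`_i < t`_i.+1, t`_i.+1 == last 0 t & x == last 0 t]
  then 1 else 0.
Proof. by []. Qed.

Lemma bsplineSE t q i x : bspline t q.+1 i x =
    (x - t`_i) / (t`_(i + q.+1) - t`_i) * bspline t q i x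
  + (t`_(i + q.+1).+1 - x) / (t`_(i + q.+1).+1 - t`_i.+1) * bspline t q i.+1 x.
Proof. by []. Qed.

End CoxDeBoor.

Section BoundaryKnots.
Context {R : realType}.
Variables (p r rh n k : nat).
Hypotheses (n0 : (0 < n)%N) (rp : (r < p)%N) (rhp : (rh < p)%N).
Let t : seq R := knots p r rh n k.
Let h : R := n%:R^-1.

Let h0 : 0 < h. Proof. by rewrite invr_gt0 ltr0n. Qed.

Lemma knots_start i : (i <= p)%N -> t`_i = 0.
Proof. by move=> ip; rewrite /t /knots nth_cat size_nseq ltnS ip nth_nseq ltnS ip. Qed.

Lemma knots_first : t`_p.+1 = h.
Proof.
rewrite /t /knots nth_cat size_nseq ltnn subnn /h.
case: n n0 => // -[|m] _ /=; first by rewrite invr1.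
have : (0 < p - knot_reg r rh k 1)%N by rewrite subn_gt0 /knot_reg; case: ifP.
by case: (p - _)%N => //= j _; rewrite /knot mul1r.
Qed.

(** The value of this knot depends on the multiplicity of the first inner knot and may be [h] again;
    it cancels from the slope in [bspline_second], where it occurs as a denominator. *)
Lemma knots_second_gt0 : 0 < t`_p.+2.
Proof.
have p0 : (0 < p)%N by exact: leq_trans rp.
rewrite /t /knots nth_cat size_nseq ltnNge leqnSn /= subSnn.
set s := _ ++ _; have /(all_nthP 0) : all (fun x : R => 0 < x) s.
  rewrite all_cat; apply/andP; split; last by rewrite /= ltr01 all_nseq ltr01 orbT.
  apply/allP => x /flattenP[l /mapP[i]]; rewrite mem_iota => /andP[i0 _] ->.
  by rewrite mem_nseq => /andP[_ /eqP ->]; rewrite /knot divr_gt0 // ltr0n.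
by apply; rewrite size_cat /= size_nseq; move: p0; case: p => //= m _; rewrite !addnS.
Qed.

Lemma knots_last : last 0 t = 1.
Proof. by rewrite /t /knots !last_cat /= ; elim: p. Qed.

End BoundaryKnots.

Section BoundaryBSplines.
Context {R : realType}.
Variables (t : seq R) (p : nat) (h : R).
Hypotheses (h0 : 0 < h) (h_le1 : h <= 1).
Hypothesis knots_start : forall i, (i <= p)%N -> t`_i = 0.
Hypothesis knots_first : t`_p.+1 = h.
Hypothesis knots_second_gt0 : 0 < t`_p.+2.
Hypothesis knots_last : last 0 t = 1.

(** All knots up to index [p] are zero, so the first summand of the recursion has denominator zero
    and drops out by convention; each degree adds one factor [(h - x) / h]. *)
Lemma bspline_first q x : (q <= p)%N -> 0 <= x < h ->
  bspline t q (p - q) x = (1 - x / h) ^+ q.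
Proof.
move=> + /andP[x0 xh]; elim: q => [|q IH] qp.
  by rewrite subn0 bspline0E knots_start // knots_first x0 xh.
rewrite bsplineSE subnK // -subSn // subSS IH ?(ltnW qp) //.
rewrite knots_first !knots_start ?leq_subr // !subr0 invr0 mulr0 mul0r add0r exprS; congr (_ * _).
by rewrite mulrBl mulfV // gt_eqF.
Qed.

Lemma bspline_second q : (q <= p)%N -> exists Q : {poly R},
  [/\ Q.[0] = 0, Q^`().[0] = q%:R / h &
      forall x, 0 <= x < h -> bspline t q (p - q).+1 x = Q.[x]].
Proof.
elim: q => [|q IH] qp.
  exists 0; split; rewrite ?horner0 ?deriv0 ?horner0 ?mul0r // => x /andP[x0 xh].
  rewrite subn0 bspline0E knots_first leNgt xh /= knots_last [x == 1]lt_eqF ?andbF ?horner0 //.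
  exact: lt_le_trans h_le1.
have [Q [Q0 dQ EQ]] := IH (ltnW qp).
pose a := t`_p.+2; pose b := a - t`_(p - q).+1.
exists ((h^-1 *: 'X) * (1 - h^-1 *: 'X) ^+ q + b^-1 *: ((a%:P - 'X) * Q)); split.
- by rewrite hornerD hornerM !hornerZ hornerX hornerM Q0 !mulr0 mul0r addr0.
- rewrite derivD derivM !derivZ derivX derivM derivB derivX derivC.
  rewrite !(hornerD, hornerN, hornerM, hornerZ, hornerC, hornerX, horner_exp, Q0, dQ).
  rewrite !(mulr0, mul0r, oppr0, addr0, sub0r, add0r, expr1n, mulr1).
  (* For [q = 0] the denominator [b] is [a - h] and may vanish, but the slope of [Q] is then zero as
     well. *)
  have [->|q0] := posnP q; first by rewrite !(mul0r, mulr0, addr0) mul1r.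
  have -> : b = a by rewrite /b knots_start ?subr0 // ltn_subrL q0 (leq_trans q0 (ltnW qp)).
  have a0 : a != 0 by rewrite gt_eqF // knots_second_gt0.
  by rewrite mulrA mulVf // mul1r -[in RHS]natr1 mulrDl mul1r addrC.
- move=> x xh; rewrite !(hornerD, hornerN, hornerM, hornerZ, hornerC, hornerX, horner_exp) -EQ // bsplineSE.
  rewrite -subSn // subSS addnS subnK ?(ltnW qp) //.
  rewrite bspline_first ?(ltnW qp) // knots_first knots_start ?leq_subr // !subr0.
  rewrite -/a -/b; rewrite -[h^-1 * x]mulrC; congr (_ + _).
  by rewrite mulrA [b^-1 * _]mulrC.
Qed.

Lemma boundary_bsplines : exists Q1 Q2 : {poly R},
  [/\ Q1.[0] = 1, Q2.[0] = 0, Q1^`().[0] = - (p%:R / h), Q2^`().[0] = p%:R / h &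
      forall x, 0 <= x < h -> bspline t p 0 x = Q1.[x] /\ bspline t p 1 x = Q2.[x]].
Proof.
have [Q2 [H1 H2 H3]] := bspline_second (leqnn p).
exists ((1 - h^-1 *: 'X) ^+ p), Q2; split=> //.
- by rewrite !(horner_exp, hornerE) /= ?mulr0 subr0 expr1n.
- rewrite deriv_exp derivB derivC derivZ derivX !(horner_exp, hornerE, hornerMn) /= ?mulr0 subr0 expr1n.
  by rewrite mulr1 mulNrn mulr_natl.
- move=> x xh; have := bspline_first (leqnn p) xh; have := H3 x xh; rewrite subnn => -> ->.
  by rewrite horner_exp !hornerE [_ / h]mulrC.
Qed.

End BoundaryBSplines.

Lemma bspline_near0 (R : realType) (p r rh n k : nat) : (0 < n)%N -> (r < p)%N -> (rh < p)%N ->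
  exists Q1 Q2 : {poly R},
  [/\ Q1.[0] = 1, Q2.[0] = 0, Q1^`().[0] = - (p%:R * n%:R), Q2^`().[0] = p%:R * n%:R &
      forall x, 0 <= x < n%:R^-1 ->
        bspline (knots p r rh n k) p 0 x = Q1.[x] /\ bspline (knots p r rh n k) p 1 x = Q2.[x]].
Proof.
move=> n0 rp rhp; have h0 : 0 < n%:R^-1 :> R by rewrite invr_gt0 ltr0n.
have h1 : n%:R^-1 <= 1 :> R by rewrite invf_le1 ?ltr0n // ler1n.
have := boundary_bsplines h0 h1 (knots_start r rh n k) (knots_first k n0 rp rhp)
  (knots_second_gt0 rh k n0 rp) (knots_last p r rh n k).
by rewrite invrK.
Qed.

(** * Regularity, bounds and rationality of the gluing data *)

Section PatchGeometry.
Context {R : realType}.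
Variable G : geometry R.
Hypothesis tp : two_patch G.

Lemma D01_ext (f g : R -> R) v : v \in `[0, 1] -> (forall w, w \in `[0, 1] -> f w = g w) ->
  D01 f v = D01 g v.
Proof.
move=> v01 E; rewrite /D01; congr (lim _); rewrite eqEsubset.
by split; apply: near_eq_cvg; rewrite near_withinE; apply: filterE => w w01; rewrite !E.
Qed.

Lemma patch_C1 S : exists fu fv gu gv, [/\
  C1_with (fun z => (Fmap G S z).1) fu fv, C1_with (fun z => (Fmap G S z).2) gu gv,
  forall z, square z -> dFu G S z.1 z.2 = (fu z, gu z) /\ dFv G S z.1 z.2 = (fv z, gv z) &
  forall j, (j < gn2 G)%N -> exists q1 q2 q3 q4 : {poly R}, forall v, v \in `[knot (gn2 G) j, knot (gn2 G) j.+1] ->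
    (fu (0, v), gu (0, v)) = (q1.[v], q2.[v]) /\ (fv (0, v), gv (0, v)) = (q3.[v], q4.[v])].
Proof.
have [t1 t2] := tp_spline tp S; have /andP[r1 _] := tp_reg1 tp S; have /andP[r2 _] := tp_reg2 tp.
have [fu [fv [Cf Pf]]] := tensor_spline_C1 r1 r2 t1.
have [gu [gv [Cg Pg]]] := tensor_spline_C1 r1 r2 t2.
exists fu, fv, gu, gv; split=> //.
  move=> z sz; have [a1 a2] := D01_C1 Cf sz; have [b1 b2] := D01_C1 Cg sz.
  by rewrite /dFu /dFv a1 a2 b1 b2.
move=> j jn; have [q1 [q3 H1]] := Pf j jn; have [q2 [q4 H2]] := Pg j jn.
exists q1, q2, q3, q4 => v vj; have [-> ->] := H1 v vj; by have [-> ->] := H2 v vj.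
Qed.

Lemma square_edge (v : R) : v \in `[0, 1] -> square (0, v).
Proof. by rewrite in_itv => h; apply/squareP; rewrite /= lexx ler01. Qed.

Lemma dFv_interface S v : v \in `[0, 1] -> dFv G S 0 v = tangent G v.
Proof.
move=> v01; rewrite /tangent; case: S => //; rewrite /dFv.
by congr pair; apply: D01_ext => // w w01; rewrite (tp_interface tp).
Qed.

Lemma alphaE S v : v \in `[0, 1] -> alpha G S v = det2 (dFu G S 0 v) (dFv G S 0 v).
Proof. by move=> v01; rewrite dFv_interface. Qed.

Lemma alpha_lower : exists2 c : R, 0 < c & forall S v, v \in `[0, 1] -> c <= `|alpha G S v|.
Proof.
have [c c0 H] := tp_det tp; exists c => // S v v01; rewrite alphaE //; apply: H => //.
by rewrite in_itv /= lexx ler01.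
Qed.

Lemma tangent_gt0 v : v \in `[0, 1] -> 0 < dot (tangent G v) (tangent G v).
Proof.
move=> v01; have [c c0 /(_ PL v v01)] := alpha_lower; rewrite /alpha.
case: (tangent G v) (dFu G PL 0 v) => a b [x y]; rewrite /dot /det2 /= => h.
rewrite lt0r addr_ge0 -?expr2 ?sqr_ge0 // andbT paddr_eq0 ?sqr_ge0 // !sqrf_eq0.
apply/negP => /andP[/eqP a0 /eqP b0]; move: h; rewrite a0 b0 !mulr0 subrr normr0.
by rewrite leNgt c0.
Qed.

Lemma tau_gt0 v : v \in `[0, 1] -> 0 < tau G v.
Proof. by move=> /tangent_gt0 h; rewrite /tau /enorm sqrtr_gt0. Qed.

Lemma sqr_tau v : tau G v ^+ 2 = dot (tangent G v) (tangent G v).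
Proof. by rewrite /tau /enorm sqr_sqrtr // /dot addr_ge0 // -expr2 sqr_ge0. Qed.

(** In this form the square root hidden in [tau] has cancelled, which makes [beta] rational where
    the first derivatives are polynomial. *)
Lemma betaE S v : beta G S v = dot (dFu G S 0 v) (tangent G v) / dot (tangent G v) (tangent G v).
Proof.
by rewrite /beta /tangent0 -sqr_tau dotZr expr2 invfM (mulrC (tau G v)^-1) -mulrA.
Qed.

Lemma knot_sub j v : (j < gn2 G)%N -> v \in `[knot (gn2 G) j, knot (gn2 G) j.+1] -> v \in `[(0 : R), 1].
Proof.
move=> jn; have /andP[h1 _] := @knot_itv R _ _ (ltnW jn).
have /andP[_ h2] := @knot_itv R _ _ jn; rewrite !in_itv /= => /andP[h3 h4].
by rewrite (le_trans h1 h3) (le_trans h4 h2).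
Qed.

(** The only denominator is that of [beta], the square of the length of the tangent; it cannot
    vanish because [alpha] does not. *)
Lemma gluing_rational S j : (j < gn2 G)%N ->
  rational_on (knot (gn2 G) j) (knot (gn2 G) j.+1) (alpha G S) /\
  rational_on (knot (gn2 G) j) (knot (gn2 G) j.+1) (beta G S).
Proof.
move=> jn.
have [fu [fv [gu [gv [_ _ E P]]]]] := patch_C1 S.
have [fu' [fv' [gu' [gv' [_ _ E' P']]]]] := patch_C1 PL.
have [q1 [q2 [q1' [q2' H]]]] := P j jn; have [q3' [q4' [q3 [q4 H']]]] := P' j jn.
have EU v : v \in `[knot (gn2 G) j, knot (gn2 G) j.+1] -> dFu G S 0 v = (q1.[v], q2.[v]).
  move=> vj; have [<- _] := H v vj; exact: (E (0, v) (square_edge (knot_sub jn vj))).1.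
have ET v : v \in `[knot (gn2 G) j, knot (gn2 G) j.+1] -> tangent G v = (q3.[v], q4.[v]).
  move=> vj; have [_ <-] := H' v vj; exact: (E' (0, v) (square_edge (knot_sub jn vj))).2.
split.
  exists (q1 * q4 - q2 * q3, 1) => v vj; rewrite /ratfun /= hornerC oner_neq0 divr1.
  by rewrite /alpha (EU v vj) (ET v vj) /det2 !(hornerD, hornerN, hornerM).
exists (q1 * q3 + q2 * q4, q3 * q3 + q4 * q4) => v vj; rewrite /ratfun /=.
have := tangent_gt0 (knot_sub jn vj); rewrite betaE (EU v vj) (ET v vj) /dot /=.
by rewrite !(hornerD, hornerM) => /gt_eqF ->.
Qed.

Lemma edge_bounded (k : R * R -> R) : {within square, continuous k} ->
  exists2 M : R, 0 < M & forall v, v \in `[0, 1] -> `|k (0, v)| <= M.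
Proof.
move=> ck; have [M M0 H] := within_bounded compact_square ck.
by exists M => // v v01; apply: H; exact: square_edge.
Qed.

Lemma interval_bounded (k : R -> R) : {within `[0, 1], continuous k} ->
  exists2 M : R, 0 < M & forall v, v \in `[0, 1] -> `|k v| <= M.
Proof.
move=> c; have /compact_bounded/ex_strict_bound_gt0[M M0 H] := continuous_compact c (@segment_compact _ 0 1).
by exists M => // v v01; apply/ltW/H; exists v.
Qed.

Lemma gluing_continuous S : {within `[0, 1], continuous (alpha G S)} /\
  {within `[0, 1], continuous (beta G S)}.
Proof.
have [Ca Cb] := tp_gluing_C1 tp S.
by have [? [c1 _ _]] := Ck_C1_interval (leqnn 1) Ca; have [? [c2 _ _]] := Ck_C1_interval (leqnn 1) Cb.
Qed.

Lemma tau_continuous : {within `[0, 1], continuous (tau G)}.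
Proof.
have [fu [fv [gu [gv [[_ _ cf _] [_ _ cg _] E _]]]]] := patch_C1 PL.
apply: (@within_eq _ _ _ (fun v => Num.sqrt (fv (0, v) * fv (0, v) + gv (0, v) * gv (0, v)))).
  move=> v v01; have [_ e] := E _ (square_edge v01).
  by rewrite /tau /enorm /tangent e.
have c1 := continuous_edge cf; have c2 := continuous_edge cg.
move=> v; apply: continuous_comp; last exact: sqrt_continuous.
by apply: cvgD; apply: cvgM; (try exact: c1); exact: c2.
Qed.

Lemma geometry_bounds : exists2 M : R, 0 < M & forall S v, v \in `[0, 1] ->
  [/\ `|dFu G S 0 v| <= M, `|tangent G v| <= M, tau G v <= M & `|beta G S v| <= M].
Proof.
have B S : exists2 M : R, 0 < M & forall v, v \in `[0, 1] ->
  [/\ `|dFu G S 0 v| <= M, `|dFv G S 0 v| <= M & `|beta G S v| <= M].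
  have [fu [fv [gu [gv [[_ c1 c2 _] [_ c3 c4 _] E _]]]]] := patch_C1 S.
  have [M1 p1 H1] := edge_bounded c1; have [M2 p2 H2] := edge_bounded c2.
  have [M3 p3 H3] := edge_bounded c3; have [M4 p4 H4] := edge_bounded c4.
  have [M5 p5 H5] := interval_bounded (gluing_continuous S).2.
  exists (M1 + M2 + M3 + M4 + M5) => [|v v01]; first by rewrite !addr_gt0.
  have [-> ->] := E _ (square_edge v01).
  have h1 := H1 v v01; have h2 := H2 v v01; have h3 := H3 v v01; have h4 := H4 v v01; have h5 := H5 v v01.
  rewrite !norm_pair_le /=; split; try (apply/andP; split); lra.
have [ML pL HL] := B PL; have [MR pR HR] := B PR; have [Mt pt Ht] := interval_bounded tau_continuous.
exists (ML + MR + Mt) => [|S v v01]; first by rewrite !addr_gt0.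
have [l1 l2 l3] := HL v v01; have [r1 r2 r3] := HR v v01; have ht := Ht v v01.
rewrite dFv_interface // in l2.
rewrite (gtr0_norm (tau_gt0 v01)) in ht.
have h1 : ML <= ML + MR + Mt by rewrite -addrA lerDl addr_ge0 // ltW.
have h2 : MR <= ML + MR + Mt by rewrite addrAC lerDr addr_ge0 // ltW.
have h3 : Mt <= ML + MR + Mt by rewrite lerDr addr_ge0 // ltW.
have hL := le_trans _ h1; have hR := le_trans _ h2.
case: S; split; [exact: hL l1|exact: hL l2|exact: le_trans ht h3|exact: hL l3|
  exact: hR r1|exact: hL l2|exact: le_trans ht h3|exact: hR r3].
Qed.

End PatchGeometry.

(** * Linear combinations of C^1 functions on the square *)

Section LinearCombinations.
Context {R : realType}.

Lemma C1_with_add (f fu fv g gu gv : R * R -> R) : C1_with f fu fv -> C1_with g gu gv ->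
  C1_with (fun z => f z + g z) (fun z => fu z + gu z) (fun z => fv z + gv z).
Proof.
move=> [c1 c2 c3 d] [c1' c2' c3' d']; split.
- by move=> z; apply: cvgD; [exact: c1|exact: c1'].
- by move=> z; apply: cvgD; [exact: c2|exact: c2'].
- by move=> z; apply: cvgD; [exact: c3|exact: c3'].
- move=> z oz; have [a b] := d z oz; have [a' b'] := d' z oz.
  by split; exact: is_deriveD.
Qed.

Lemma C1_with_lincomb N (c : 'I_N -> R) (f fu fv : 'I_N -> R * R -> R) :
  (forall j, C1_with (f j) (fu j) (fv j)) ->
  C1_with (fun z => \sum_j c j * f j z) (fun z => \sum_j c j * fu j z) (fun z => \sum_j c j * fv j z).
Proof.
move=> H.
have C (k : 'I_N -> R * R -> R) : (forall j, {within square, continuous (k j)}) ->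
    {within square, continuous (fun z => \sum_j c j * k j z)}.
  move=> ck; apply: within_sum => j z; apply: cvgM; last exact: (ck j z).
  exact: cvg_cst.
split; try by apply: C => j; have [] := H j.
move=> z oz; split; apply: is_derive_bigsum => j; have [_ _ _ /(_ z oz)[d1 d2]] := H j.
  exact: is_derive_ext (is_deriveZ (c j) d1).
exact: is_derive_ext (is_deriveZ (c j) d2).
Qed.

End LinearCombinations.

(** * Functions of the interface space on one patch *)

Section PatchFunctions.
Context {R : realType}.
Variables (G : geometry R) (D : degrees).
Hypotheses (tp : two_patch G) (ad : admissible G D).
Variables (k1 : patch -> nat) (k2 : nat) (P : (R -> R) -> R -> R).
Hypotheses (k10 : forall S, (0 < k1 S)%N) (k20 : (0 < k2)%N).
Hypothesis bC : basis_C1 G D k1 k2 P.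

Lemma n1_gt0 S : (0 < n1 G k1 S)%N.
Proof. by rewrite /n1 muln_gt0 (tp_mesh1 tp) k10. Qed.

Lemma boundary_profiles S : exists Q1 Q2 : {poly R},
  [/\ Q1.[0] = 1, Q2.[0] = 0, Q1^`().[0] = - Q2^`().[0], h1 G k1 S / (p1 D S)%:R * Q2^`().[0] = 1 &
      forall x, 0 <= x < h1 G k1 S -> b1 G D k1 S x = Q1.[x] /\ b2 G D k1 S x = Q2.[x]].
Proof.
have gp := ad_p1 ad S; have gr := tp_reg1 tp S; have r1p := ad_r1 ad S.
have p0 : (1 < p1 D S)%N by case/andP: gr => g1 g2; exact: leq_trans (leq_ltn_trans g1 g2) gp.
have rp : (r1 D S < p1 D S)%N.
  case/andP: r1p => _ h; apply: (leq_ltn_trans h); rewrite subn1 prednK //; exact: ltnW.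
have rhp : (gr1 G S < p1 D S)%N by case/andP: gr => _ h; exact: leq_trans gp.
have [Q1 [Q2 [e1 e2 e3 e4 e5]]] := @bspline_near0 R _ _ _ _ (k1 S) (n1_gt0 S) rp rhp.
exists Q1, Q2; split=> //; first by rewrite e3 e4.
have n0 : (n1 G k1 S)%:R != 0 :> R by rewrite pnatr_eq0 -lt0n n1_gt0.
have q0 : (p1 D S)%:R != 0 :> R by rewrite pnatr_eq0 -lt0n ltnW.
by rewrite e4 /h1; field; rewrite n0 q0.
Qed.

Lemma h1_gt0 S : 0 < h1 G k1 S :> R.
Proof. by rewrite /h1 invr_gt0 ltr0n n1_gt0. Qed.

Lemma b12_at0 S : b1 G D k1 S 0 = 1 /\ b2 G D k1 S 0 = 0.
Proof.
have [Q1 [Q2 [e1 e2 _ _ E]]] := boundary_profiles S.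
by have [-> ->] := E 0 (ltac:(by rewrite lexx h1_gt0)).
Qed.

(** Covers both kinds of basis functions: [K] is the value at [u = 0], which is zero for [fminus],
    and does not influence the slope. *)
Lemma boundary_slope S (K L : R) (f : R -> R) :
  (forall u, f u = K * (b1 G D k1 S u + b2 G D k1 S u) + L * (h1 G k1 S / (p1 D S)%:R) * b2 G D k1 S u) ->
  D01 f 0 = L.
Proof.
move=> E; have [Q1 [Q2 [e1 e2 e3 e4 e5]]] := boundary_profiles S.
rewrite (@D01_poly0 R f (K *: (Q1 + Q2) + (L * (h1 G k1 S / (p1 D S)%:R)) *: Q2) _ (h1_gt0 S)).
  by rewrite derivD !derivZ derivD !(hornerD, hornerZ) e3 addNr mulr0 add0r -mulrA e4 mulr1.
by move=> x /e5[E1 E2]; rewrite E E1 E2 !(hornerD, hornerZ).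
Qed.

(** [basis_C1] provides partial derivatives without a formula; on the edge they are one-sided
    derivatives by [D01_C1] and can be computed from the first two B-splines. *)
Lemma fplus_C1 S j : exists fu fv, C1_with (@fplus R G D k1 k2 P S j) fu fv /\
  forall v, v \in `[0, 1] ->
    fu (0, v) = betat G P S v * D01 (@bplus R G D k2 j) v /\ fv (0, v) = D01 (@bplus R G D k2 j) v.
Proof.
have [/(_ S j)[fu [fv C]] _] := bC; exists fu, fv; split=> // v v01.
have [<- <-] := D01_C1 C (square_edge v01); split => /=.
  by apply: (@boundary_slope S (@bplus R G D k2 j v)).
congr D01; apply/funext => t; have [b10 b20] := b12_at0 S.
by rewrite /fplus /= b10 b20 addr0 mulr1 mulr0 addr0.
Qed.

Lemma fminus_C1 S j : exists fu fv, C1_with (@fminus R G D k1 k2 P S j) fu fv /\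
  forall v, v \in `[0, 1] ->
    fu (0, v) = alphat G P S v * @bminus R G D k2 j v /\ fv (0, v) = 0.
Proof.
have [_ /(_ S j)[fu [fv C]]] := bC; exists fu, fv; split=> // v v01.
have [<- <-] := D01_C1 C (square_edge v01); split => /=.
  by apply: (@boundary_slope S 0) => u; rewrite mul0r add0r.
apply: D01E => // e e0; exists 1 => // w _ _; have [_ b20] := b12_at0 S.
by rewrite /fminus /= b20 !mulr0 mul0r !subrr normr0 mulr_ge0 // ltW.
Qed.

Lemma space_function_C1 S c d : exists fu fv,
  C1_with (fun z => \sum_j c j * @fplus R G D k1 k2 P S j z + \sum_j d j * @fminus R G D k1 k2 P S j z) fu fv /\
  forall v, v \in `[0, 1] ->
    fv (0, v) = \sum_j c j * D01 (@bplus R G D k2 j) v /\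
    fu (0, v) = betat G P S v * (\sum_j c j * D01 (@bplus R G D k2 j) v) +
                alphat G P S v * (\sum_j d j * @bminus R G D k2 j v).
Proof.
have /choice[pu] := fplus_C1 S => /choice[pv Hp]; have /choice[mu] := fminus_C1 S => /choice[mv Hm].
exists (fun z => \sum_j c j * pu j z + \sum_j d j * mu j z), (fun z => \sum_j c j * pv j z + \sum_j d j * mv j z); split.
  by apply: C1_with_add; apply: C1_with_lincomb => j; [exact: (Hp j).1|exact: (Hm j).1].
move=> v v01; split.
  rewrite [X in _ + X]big1 ?addr0; last by move=> j _; rewrite ((Hm j).2 v v01).2 mulr0.
  by apply: eq_bigr => j _; rewrite ((Hp j).2 v v01).2.
rewrite !mulr_sumr; congr (_ + _); apply: eq_bigr => j _.
  by rewrite ((Hp j).2 v v01).1 mulrCA.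
by rewrite ((Hm j).2 v v01).1 mulrCA.
Qed.

Lemma glue_patch S f z : osquare z -> glue G f (Fmap G S z) = f S z.
Proof.
move=> oz; have sz := osquare_square oz.
have K T : 'pinv_(fun=> (0, 0)) square (Fmap G T) (Fmap G T z) = z.
  by apply: pinvKV; [have [] := tp_bij tp T|rewrite inE].
have OS T : OmegaS G T (Fmap G T z) by rewrite (tp_img tp); exists z.
rewrite /glue; case: S => /=; last by rewrite mem_set ?K //; exact: OS.
rewrite memNset ?K // => h; have : (OmegaS G PL `&` OmegaS G PR) (Fmap G PL z) by split=> //; exact: OS.
by rewrite (tp_disj tp).
Qed.

End PatchFunctions.

(** * The normal derivative on the interface as a limit from one patch *)

Section SideDerivative.
Context {R : realType}.
Variable G : geometry R.
Hypothesis tp : two_patch G.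

Lemma Fmap_pair S : (fun z => ((Fmap G S z).1, (Fmap G S z).2)) = Fmap G S.
Proof. by apply/funext => z; rewrite -surjective_pairing. Qed.

Lemma grad_hatE (fu fv gu gv pu pv : R * R -> R) d z :
  dot (grad_hat fu fv gu gv pu pv (1, 0) z, grad_hat fu fv gu gv pu pv (0, 1) z) d =
  grad_hat fu fv gu gv pu pv d z.
Proof.
by rewrite /grad_hat /dot /sol /det2 /=; ring.
Qed.

Lemma det_lower S (fu fv gu gv : R * R -> R) :
  (forall z, square z -> dFu G S z.1 z.2 = (fu z, gu z) /\ dFv G S z.1 z.2 = (fv z, gv z)) ->
  exists2 c : R, 0 < c & forall z, square z -> c <= `|det2 (fu z, gu z) (fv z, gv z)|.
Proof.
move=> E; have [c c0 H] := tp_det tp; exists c => // z sz; have [<- <-] := E z sz.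
by have /squareP[z1 z2] := sz; apply: H; rewrite in_itv.
Qed.

(** Points of the patch near the interface point have parameters near [(0, v)], by continuity of the
    inverse, and there the gradient is given by [grad_hat], which is continuous up to the edge. The
    filter is proper because [F(0, v)] lies in the closure of the patch. *)
Lemma side_derivativeE S (fu fv gu gv p pu pv phi : R * R -> R) v :
  C1_with (fun z => (Fmap G S z).1) fu fv -> C1_with (fun z => (Fmap G S z).2) gu gv ->
  (forall z, square z -> dFu G S z.1 z.2 = (fu z, gu z) /\ dFv G S z.1 z.2 = (fv z, gv z)) ->
  C1_with p pu pv -> (forall z, osquare z -> phi (Fmap G S z) = p z) ->
  v \in `[0, 1] ->
  side_derivative G (OmegaS G S) phi (Fmap G S (0, v)) =
  grad_hat fu fv gu gv pu pv (normal G (Fmap G S (0, v))) (0, v).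
Proof.
move=> Cf Cg E Cp Hphi v01; have sv := square_edge v01.
have [c c0 dF] := det_lower E; set n := normal _ _.
have [bij1 inj _] := tp_bij tp S.
have pf : ProperFilter (within (OmegaS G S) (nbhs (Fmap G S (0, v)))).
  apply: within_nbhs_proper; exact: bij1.
have H : {within square, continuous (grad_hat fu fv gu gv pu pv n)}.
  exact: (@grad_hat_continuous R _ fu fv _ gu gv c Cf Cg c0 dF p).
apply: cvg_lim => //; apply/cvgrPdist_lt => e e0.
have [d d0 Hd] := within_dist H sv e0.
have [cf _ _ _] := Cf; have [cg _ _ _] := Cg.
have inj' : set_inj square (fun z => ((Fmap G S z).1, (Fmap G S z).2)) by rewrite Fmap_pair.
have [r r0 Hr] := inverse_continuous cf cg inj' sv d0.
rewrite near_withinE; apply/nbhs_ballP; exists r => //= y; rewrite -ball_normE /= => yr Oy.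
have : (Fmap G S @` osquare) y by rewrite -(tp_img tp).
move=> [z oz Fz]; have sz := osquare_square oz.
have zd : `|z - (0, v)| < d.
  by apply: Hr => //; rewrite -!surjective_pairing Fz distrC.
have D1 d' : is_derive y d' phi (grad_hat fu fv gu gv pu pv d' z).
  rewrite -Fz (surjective_pairing (Fmap G S z)).
  apply: (@derive_pullback R _ fu fv _ gu gv c Cf Cg c0 dF p pu pv phi d' z Cp _ oz) => w ow.
  by rewrite -surjective_pairing Hphi.
rewrite /pd1 /pd2 (@derive_val _ _ _ _ _ _ _ (D1 (1, 0))) (@derive_val _ _ _ _ _ _ _ (D1 (0, 1))).
by rewrite grad_hatE distrC; exact: Hd.
Qed.

End SideDerivative.

(** * Algebra of the jump at one point of the interface *)

Section JumpAlgebra.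
Context {R : realType}.

Lemma normal_component (U t n : R * R) (E a : R) : det2 U t != 0 -> 0 < dot t t -> dot n t = 0 ->
  dot (E, a) (sol U t n) = det2 n t * ((E - dot U t / dot t t * a) / det2 U t).
Proof.
move=> D0 T0 nt; have T1 := gt_eqF T0.
(* Orthogonality of [n] to [t] expresses one of the two Cramer determinants of [n] through the
   other, so that [det2 n t] can be factored out. *)
have key : det2 U n * dot t t = - (det2 n t * dot U t).
  have : det2 U n * dot t t + det2 n t * dot U t = det2 U t * dot n t.
    by rewrite /det2 /dot; ring.
  by rewrite nt mulr0 => /eqP; rewrite addr_eq0 => /eqP.
have e : det2 U n = - (det2 n t * dot U t) / dot t t by rewrite -key mulfK // T1.
have -> : dot (E, a) (sol U t n) = E * (det2 n t / det2 U t) + a * (det2 U n / det2 U t) by [].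
rewrite e; move: (det2 U t) (dot t t) (dot U t) (det2 n t) D0 T1 => x y z w x0 /negbT y0.
by field; rewrite x0 y0.
Qed.

Lemma normal_square (t n : R * R) : enorm n = 1 -> dot n t = 0 -> det2 n t ^+ 2 = dot t t.
Proof.
move=> n1 nt; have nn : dot n n = 1.
  have d0 : 0 <= dot n n by rewrite /dot addr_ge0 // -expr2 sqr_ge0.
  by rewrite -(sqr_sqrtr d0) -/(enorm n) n1 expr1n.
have : det2 n t ^+ 2 + dot n t ^+ 2 = dot n n * dot t t by rewrite /det2 /dot; ring.
by rewrite nt nn mul1r expr0n addr0.
Qed.

Lemma dot_bound (x g : R * R) (M : R) : `|x| <= M -> `|dot g x| <= M * (`|g.1| + `|g.2|).
Proof.
rewrite norm_pair_le => /andP[x1 x2]; apply: (le_trans (ler_normD _ _)).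
by rewrite !normrM mulrDr; apply: lerD; rewrite mulrC; exact: ler_wpM2r.
Qed.

Lemma relative_lower (x y e : R) : x != 0 -> `|x - y| / `|x| <= e -> (1 - e) * `|x| <= `|y|.
Proof.
move=> x0; rewrite ler_pdivrMr ?normr_gt0 // => h.
have : `|x| <= `|x - y| + `|y| by have := ler_normD (x - y) y; rewrite subrK.
by move: h; lra.
Qed.

Lemma quotient_bound (x y d c : R) : 0 < c -> c <= `|y| -> `|x| <= d -> `|x / y| <= d / c.
Proof.
move=> c0 cy xd; rewrite normrM normfV; apply: ler_pM => //.
by rewrite lef_pV2 // posrE (lt_le_trans c0).
Qed.

Lemma jump_algebra (c e M dl tau s a B : R) (al be al' be' : patch -> R) :
  0 < c -> 0 < e -> 0 < M -> 0 <= dl -> dl <= M -> 0 <= tau -> tau <= M -> 0 <= s ->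
  (forall S, c <= `|al S|) -> e * c <= `|al' PR| -> `|be PR| <= M ->
  (forall S, `|al S - al' S| <= dl) -> (forall S, `|be S - be' S| <= dl) ->
  `|a| <= M * s -> `|be' PR * a + al' PR * B| <= M * s ->
  (tau * ((be' PR * a + al' PR * B - be PR * a) / al PR -
          (be' PL * a + al' PL * B - be PL * a) / al PL)) ^+ 2 * tau <=
  (M * (2 / c) * (M * (1 + (1 + 2 * M) / (e * c)))) ^+ 2 * M * (dl ^+ 2 * s ^+ 2).
Proof.
move=> c0 e0 M0 dl0 dlM tau0 tauM s0 alc al'c beM da db aM EM.
have ec : 0 < e * c by exact: mulr_gt0.
have al0 S : al S != 0 by rewrite -normr_gt0 (lt_le_trans c0).
have al'0 : al' PR != 0 by rewrite -normr_gt0 (lt_le_trans ec).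
set X := _ - _.
(* Each quotient contains [al / al * B = B], with the same [B] on both patches; it cancels in the
   difference and leaves only approximation errors as coefficients. *)
have XE : X = ((be' PR - be PR) / al PR - (be' PL - be PL) / al PL) * a +
              ((al' PR - al PR) / al PR - (al' PL - al PL) / al PL) * B.
  by rewrite /X; field; rewrite !al0.
have q (k k' : patch -> R) S : (forall S, `|k S - k' S| <= dl) -> `|(k' S - k S) / al S| <= dl / c.
  by move=> h; apply: quotient_bound => //; rewrite distrC.
have q2 (k k' : patch -> R) : (forall S, `|k S - k' S| <= dl) ->
    `|(k' PR - k PR) / al PR - (k' PL - k PL) / al PL| <= 2 / c * dl.
  move=> h; apply: (le_trans (ler_normB _ _)).
  have := lerD (q k k' PR h) (q k k' PL h).
  suff -> : dl / c + dl / c = 2 / c * dl by [].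
  by rewrite -mulrDl -mulr2n -[dl *+ 2]mulr_natl mulrAC.
(* This is where [dl <= M] enters: the approximated [beta] differs from the exact one by at most
   [M]. *)
have bM : `|be' PR| <= 2 * M.
  have := ler_normB (be PR) (be PR - be' PR); rewrite subKr => h.
  have := db PR; lra.
have BM : `|B| <= M * ((1 + 2 * M) / (e * c)) * s.
  have -> : B = (be' PR * a + al' PR * B - be' PR * a) / al' PR by field.
  have -> : M * ((1 + 2 * M) / (e * c)) * s = (M * s + 2 * M * (M * s)) / (e * c).
    by field; rewrite !gt_eqF.
  apply: quotient_bound => //; apply: (le_trans (ler_normB _ _)); apply: lerD => //.
  by rewrite normrM; exact: ler_pM.
have k0 : 0 <= 2 / c * dl by rewrite mulr_ge0 // divr_ge0 // ltW.
have XM : `|X| <= 2 / c * dl * (M * (1 + (1 + 2 * M) / (e * c)) * s).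
  rewrite XE; apply: (le_trans (ler_normD _ _)); rewrite !normrM.
  have -> : 2 / c * dl * (M * (1 + (1 + 2 * M) / (e * c)) * s) =
     2 / c * dl * (M * s) + 2 / c * dl * (M * ((1 + 2 * M) / (e * c)) * s) by ring.
  by apply: lerD; apply: ler_pM => //; exact: q2.
have tX : `|tau * X| <= M * (2 / c * dl * (M * (1 + (1 + 2 * M) / (e * c)) * s)).
  by rewrite normrM (ger0_norm tau0); exact: ler_pM.
have t2 : (tau * X) ^+ 2 <= (M * (2 / c * dl * (M * (1 + (1 + 2 * M) / (e * c)) * s))) ^+ 2.
  rewrite -real_normK ?num_real // lerXn2r ?nnegrE ?normr_ge0 //.
  exact: le_trans tX.
apply: (@le_trans _ _ ((M * (2 / c * dl * (M * (1 + (1 + 2 * M) / (e * c)) * s))) ^+ 2 * M)).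
  by apply: ler_pM => //; exact: sqr_ge0.
set k := 1 + _; rewrite le_eqVlt; apply/orP; left; apply/eqP; ring.
Qed.

End JumpAlgebra.

(** * The trace inequality in terms of the Sobolev norm of a patch *)

Section PatchTrace.
Context {R : realType}.
Local Notation mu := (@lebesgue_measure R).
Variable G : geometry R.
Hypothesis tp : two_patch G.

Lemma patch_trace S (fu fv gu gv : R * R -> R) :
  C1_with (fun z => (Fmap G S z).1) fu fv -> C1_with (fun z => (Fmap G S z).2) gu gv ->
  (forall z, square z -> dFu G S z.1 z.2 = (fu z, gu z) /\ dFv G S z.1 z.2 = (fv z, gv z)) ->
  exists2 C : R, 0 < C & forall (p pu pv phi : R * R -> R) d, C1_with p pu pv ->
    (forall z, osquare z -> phi (Fmap G S z) = p z) -> d = (1, 0) \/ d = (0, 1) ->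
    (\int[mu]_(v in `[0%R, 1%R]) (grad_hat fu fv gu gv pu pv d (0%R, v) ^+ 2)%:E <=
     C%:E * sobolev_norm 2 (OmegaS G S) phi ^+ 2)%E.
Proof.
move=> Cf Cg E; have [c c0 dF] := det_lower tp E.
have [_ inj _] := tp_bij tp S.
have inj' : set_inj square (fun z => ((Fmap G S z).1, (Fmap G S z).2)) by rewrite Fmap_pair.
have im : [set ((Fmap G S z).1, (Fmap G S z).2) | z in osquare] = OmegaS G S.
  by rewrite (tp_img tp) -[in RHS](Fmap_pair G S).
have oS : open (OmegaS G S) by exact: tp_openS.
have oI : open [set ((Fmap G S z).1, (Fmap G S z).2) | z in osquare] by rewrite im.
have [C C0 H] := trace_estimate Cf Cg inj' c0 dF oI.
exists C => // p pu pv phi d Cp Hphi Hd.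
apply: sobolev_lower => //.
  by apply: integral_ge0 => v _; rewrite lee_fin sqr_ge0.
move=> w Hw; rewrite im in H; apply: (H p pu pv phi w d Cp _ Hw Hd) => z oz.
by rewrite -surjective_pairing; exact: Hphi.
Qed.

End PatchTrace.

(** * Approximation of the gluing data and the jump formula *)

Section GluingBounds.
Context {R : realType}.
Local Notation mu := (@lebesgue_measure R).

Lemma gluing_approximation (G : geometry R) (D : degrees) (Cst Capp : R) :
  two_patch G ->
  (forall S, Ck (gr2 G - 1) 0 1 (alpha G S) /\ Ck (gr2 G - 1) 0 1 (beta G S)) ->
  exists2 M : R, 0 <= M & forall k2 P, projector G D k2 Cst Capp P ->
    {ae mu, forall v, v \in `]0, 1[ -> forall S,
      `|alpha G S v - alphat G P S v| <= M * h2 G k2 ^+ (pt D).+1 /\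
      `|beta G S v - betat G P S v| <= M * h2 G k2 ^+ (pt D).+1}.
Proof.
move=> tp Cab; have n0 := tp_mesh2 tp.
have A S := approximation_bound D Cst Capp n0 (Cab S).1 (fun j jn => (gluing_rational tp S jn).1).
have B S := approximation_bound D Cst Capp n0 (Cab S).2 (fun j jn => (gluing_rational tp S jn).2).
have [a1 a10 H1] := A PL; have [a2 a20 H2] := A PR; have [b1 b10 H3] := B PL; have [b2 b20 H4] := B PR.
exists (a1 + a2 + b1 + b2); first by rewrite !addr_ge0.
move=> k2 P pr; have := H1 k2 P pr; have := H2 k2 P pr; have := H3 k2 P pr; have := H4 k2 P pr.
have hp : 0 <= h2 G k2 ^+ (pt D).+1 :> R by rewrite exprn_ge0 // /h2 invr_ge0.
move=> N4 N3 N2 N1; have F := ae_filter_ringOfSetsType mu; have := @filterI _ _ F _ _ (@filterI _ _ F _ _ N1 N2) (@filterI _ _ F _ _ N3 N4).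
apply: (@filterS _ _ F) => v [[K1 K2] [K3 K4]] v01.
have w (x a b : R) : x <= a * h2 G k2 ^+ (pt D).+1 -> a <= b -> x <= b * h2 G k2 ^+ (pt D).+1.
  by move=> xa ab; apply: (le_trans xa); exact: ler_wpM2r.
have q1 : a1 <= a1 + a2 + b1 + b2 by rewrite -!addrA lerDl !addr_ge0.
have q2 : a2 <= a1 + a2 + b1 + b2 by rewrite [a1 + a2]addrC -!addrA lerDl !addr_ge0.
have q3 : b1 <= a1 + a2 + b1 + b2 by rewrite addrAC lerDr !addr_ge0.
have q4 : b2 <= a1 + a2 + b1 + b2 by rewrite lerDr !addr_ge0.
case; split.
- exact: w (K1 v01) q1.
- exact: w (K3 v01) q3.
- exact: w (K2 v01) q2.
- exact: w (K4 v01) q4.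
Qed.

(** The factor [det2 n t] does not depend on the patch and can be taken out of the jump; the
    interface point is written with the left map on both sides. *)
Lemma side_formula (G : geometry R) S (fu fv gu gv p pu pv phi : R * R -> R) v :
  two_patch G ->
  C1_with (fun z => (Fmap G S z).1) fu fv -> C1_with (fun z => (Fmap G S z).2) gu gv ->
  (forall z, square z -> dFu G S z.1 z.2 = (fu z, gu z) /\ dFv G S z.1 z.2 = (fv z, gv z)) ->
  C1_with p pu pv -> (forall z, osquare z -> phi (Fmap G S z) = p z) ->
  v \in `]0, 1[ ->
  side_derivative G (OmegaS G S) phi (Fmap G PL (0, v)) =
  det2 (normal G (Fmap G PL (0, v))) (tangent G v) *
    ((pu (0, v) - beta G S v * pv (0, v)) / alpha G S v).
Proof.
move=> tp Cf Cg E Cp Hphi vo; have v01 : v \in `[0, 1] by exact: subset_itv_oo_cc vo.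
have FE : Fmap G PL (0, v) = Fmap G S (0, v) by case: S {Cf Cg E Hphi} => //; exact: (tp_interface tp).
have [_ nt _] := tp_normalL tp vo.
rewrite [in LHS]FE (side_derivativeE tp Cf Cg E Cp Hphi v01) -FE.
have [e1 e2] := E _ (square_edge v01).
have [c c0 /(_ S v v01) ac] := alpha_lower tp.
rewrite /grad_hat -e1 -e2 /= dFv_interface // normal_component //.
- by rewrite -betaE.
- by rewrite -[det2 _ _]/(alpha G S v) -normr_gt0 (lt_le_trans c0).
- exact: tangent_gt0.
Qed.

Lemma space_on_patch (G : geometry R) (D : degrees) k1 k2 P phi c d S z : two_patch G ->
  (forall y, phi y = \sum_j c j * @Bplus R G D k1 k2 P j y + \sum_j d j * @Bminus R G D k1 k2 P j y) ->
  osquare z ->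
  phi (Fmap G S z) = \sum_j c j * @fplus R G D k1 k2 P S j z + \sum_j d j * @fminus R G D k1 k2 P S j z.
Proof.
move=> tp -> oz; rewrite /Bplus /Bminus.
by congr (_ + _); apply: eq_bigr => j _; rewrite glue_patch.
Qed.

Lemma edge_measurable (k : R -> R) : {within `[0, 1], continuous k} ->
  measurable_fun (`]0, 1[ : set R) k.
Proof.
move=> ck; apply: (@measurable_funS _ _ _ _ (`[0, 1]%classic : set (measurableTypeR R))) => //.
  exact: subset_itv_oo_cc.
exact: subspace_continuous_measurable_fun.
Qed.

Lemma le_sqrte_scale (X Y : \bar R) (k : R) : 0 <= k -> (0 <= X)%E -> (0 <= Y)%E ->
  (X <= (k ^+ 2)%:E * Y)%E -> (X `^ 2^-1 <= k%:E * Y `^ 2^-1)%E.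
Proof.
move=> k0 X0 Y0 H; rewrite !poweR12_sqrt //.
have k0' : (0 <= k%:E)%E by rewrite lee_fin.
rewrite -lee_sqr ?sqrte_ge0 ?mule_ge0 ?sqrte_ge0 // sqr_sqrte //.
apply: (le_trans H); rewrite [leRHS]expe2 muleACA -!expe2 sqr_sqrte // expr2 EFinM.
Qed.

Lemma double_scale (k t C : R) (x y : \bar R) : 0 <= C -> (0 <= x)%E -> (0 <= y)%E -> 0 <= t ->
  k * (t + t) <= C -> (k%:E * (t%:E * x + t%:E * x) <= C%:E * (x + y))%E.
Proof.
move=> C0 x0 y0 t0 kC; rewrite -ge0_muleDl ?lee_fin // muleA -EFinM.
apply: (@le_trans _ _ (C%:E * x)%E); first by apply: lee_wpmul2r; rewrite ?lee_fin.
by apply: lee_wpmul2l; rewrite ?lee_fin // leeDl.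
Qed.

End GluingBounds.

Theorem theorem1 (R : realType) (G : geometry R) (D : degrees)
    (eps Cst Capp : R) :
  two_patch G ->
  admissible G D ->
  (forall S, Ck (gr2 G - 1) 0 1 (alpha G S) /\ Ck (gr2 G - 1) 0 1 (beta G S)) ->
  eps < 1 ->
  exists C : R, 0 < C /\
    forall (k1 : patch -> nat) (k2 : nat) (P : (R -> R) -> R -> R),
      (forall S, (0 < k1 S)%N) -> (0 < k2)%N ->
      projector G D k2 Cst Capp P ->
      basis_C1 G D k1 k2 P ->
      (forall S v, v \in `[0, 1] ->
         `|alpha G S v - alphat G P S v| / `|alpha G S v| <= eps) ->
      forall phi, interface_space G D k1 k2 P phi ->
        (L2_Gamma G (jump G phi) <=
         (C * h2 G k2 ^+ (pt D).+1)%:E *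
         (sobolev_norm 2 (OmegaS G PR) phi ^+ 2 +
          sobolev_norm 2 (OmegaS G PL) phi ^+ 2) `^ 2^-1)%E.
Proof.
have sq2 (x y : R) : (`|x| + `|y|) ^+ 2 <= 2 * (x ^+ 2 + y ^+ 2).
  rewrite -(real_normK (num_real x)) -(real_normK (num_real y)).
  by have := sqr_ge0 (`|x| - `|y|); rewrite !expr2; lra.
have sqC (x : R) : 0 <= x -> x <= (1 + x) ^+ 2 by move=> x0; rewrite expr2; nra.
move=> tp ad Cab eps1.
have [c c0 alc] := alpha_lower tp.
have [M0 M00 HM0] := geometry_bounds tp.
have [Ma Ma0 Happ] := gluing_approximation D Cst Capp tp Cab.
(* One constant for the geometry and for the approximation: [M * hp] dominates the errors and, as
   [hp <= 1], is itself at most [M]. *)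
pose M := M0 + Ma.
have Mpos : 0 < M by rewrite ltr_wpDr.
have M0M : M0 <= M by rewrite lerDl.
have MaM : Ma <= M by rewrite lerDr ltW.
have [fuL [fvL [guL [gvL [CfL CgL EL _]]]]] := patch_C1 tp PL.
have [fuR [fvR [guR [gvR [CfR CgR ER _]]]]] := patch_C1 tp PR.
have [Ct Ct0 HT] := patch_trace tp CfR CgR ER.
have e0 : 0 < 1 - eps by rewrite subr_gt0.
pose K := (M * (2 / c) * (M * (1 + (1 + 2 * M) / ((1 - eps) * c)))) ^+ 2 * M.
have K0 : 0 <= K by rewrite mulr_ge0 ?sqr_ge0 // ltW.
(* One factor 2 comes from [sq2], the other from adding the trace estimates for the two coordinate
   directions. *)
pose C0 := 4 * (K * M ^+ 2) * Ct.
have C00 : 0 <= C0.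
  by apply: mulr_ge0; [apply: mulr_ge0 => //; exact: mulr_ge0 K0 (sqr_ge0 _)|exact: ltW].
(* [1 + C0] stands in for the square root of [C0]: its square dominates [C0], and it is positive
   even when [C0] is zero. *)
exists (1 + C0); split; first by rewrite ltr_pwDl.
move=> k1 k2 P k10 k20 pr bC Heps phi [cc [dd Hphi]].
have HpR z : osquare z -> _ := space_on_patch PR tp Hphi.
have HpL z : osquare z -> _ := space_on_patch PL tp Hphi.
have [puR [pvR [CR BR]]] := space_function_C1 tp ad k10 bC PR cc dd.
have [puL [pvL [CL BL]]] := space_function_C1 tp ad k10 bC PL cc dd.
pose hp : R := h2 G k2 ^+ (pt D).+1.
have h2_01 : 0 <= (h2 G k2 : R) <= 1.
  have n20 : (0 < n2 G k2)%N by rewrite /n2 muln_gt0 (tp_mesh2 tp).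
  by rewrite /h2 invr_ge0 ler0n /= invf_le1 ?ltr0n // ler1n.
have hp0 : 0 <= hp by rewrite exprn_ge0 //; case/andP: h2_01.
have hp1 : hp <= 1 by apply: exprn_ile1; case/andP: h2_01.
pose dl := M * hp.
have dl0 : 0 <= dl by rewrite mulr_ge0 // ltW.
have dlM : dl <= M by rewrite ler_piMr // ltW.
pose g d v := grad_hat fuR fvR guR gvR puR pvR d (0, v).
pose XR v := (puR (0, v) - beta G PR v * pvR (0, v)) / alpha G PR v.
pose XL v := (puL (0, v) - beta G PL v * pvL (0, v)) / alpha G PL v.
pose W v := (tau G v * (XR v - XL v)) ^+ 2 * tau G v.
(* [det2 n t] equals [tau] up to a sign, which the square removes. *)
have jumpE v : v \in `]0, 1[ -> jump G phi (Fmap G PL (0, v)) ^+ 2 * tau G v = W v.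
  move=> vo; rewrite /jump (side_formula tp CfR CgR ER CR HpR vo) (side_formula tp CfL CgL EL CL HpL vo).
  have [n1 nt _] := tp_normalL tp vo.
  by rewrite -mulrBr /W !exprMn (normal_square n1 nt) -sqr_tau.
have pointwise v : v \in `]0, 1[ -> (forall S,
      `|alpha G S v - alphat G P S v| <= Ma * hp /\ `|beta G S v - betat G P S v| <= Ma * hp) ->
    W v <= 2 * (K * dl ^+ 2) * (g (1, 0) v ^+ 2 + g (0, 1) v ^+ 2).
  move=> vo Hd; have v01 : v \in `[0, 1] by exact: subset_itv_oo_cc vo.
  have dle : Ma * hp <= dl by rewrite ler_wpM2r.
  pose s := `|g (1, 0) v| + `|g (0, 1) v|.
  have s0 : 0 <= s by rewrite addr_ge0.
  have gd (d : R * R) : `|d| <= M0 -> `|g d v| <= M * s.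
    move=> dM; rewrite /g -grad_hatE.
    have h := dot_bound (g (1, 0) v, g (0, 1) v) dM.
    by apply: (le_trans h); exact: ler_wpM2r.
  have [U1 U2 U3 U4] := HM0 PR v v01.
  have [e1 e2] := ER _ (square_edge v01); rewrite /= dFv_interface // in e2.
  have D0 : det2 (fuR (0, v), guR (0, v)) (fvR (0, v), gvR (0, v)) != 0.
    by rewrite -e1 -e2 -[det2 _ _]/(alpha G PR v) -normr_gt0 (lt_le_trans c0) // alc.
  (* The tangent and the [u]-derivative of the map are the columns of its Jacobian, so Cramer's rule
     returns the two partial derivatives of the pulled back function. *)
  have ga : g (tangent G v) v = pvR (0, v).
    rewrite /g /grad_hat e2 /sol /det2 /dot /= [X in X / _](_ : _ = 0) ?mul0r ?mulr0 ?add0r; last by ring.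
    by rewrite mulfV ?mulr1 //.
  have gE : g (dFu G PR 0 v) v = puR (0, v).
    rewrite /g /grad_hat e1 /sol /det2 /dot /= mulfV ?mulr1 //.
    have -> : fuR (0, v) * guR (0, v) - guR (0, v) * fuR (0, v) = 0 by ring.
    by rewrite mul0r mulr0 addr0.
  have [EvR EuR] := BR v v01; have [EvL EuL] := BL v v01.
  have aM := gd _ U2; rewrite ga EvR in aM.
  have EM := gd _ U1; rewrite gE EuR in EM.
  have tau0 := ltW (tau_gt0 tp v01).
  have al0 S : alpha G S v != 0 by rewrite -normr_gt0 (lt_le_trans c0) // alc.
  have alt : (1 - eps) * c <= `|alphat G P PR v|.
    apply: le_trans (relative_lower (al0 PR) (Heps PR v v01)).
    by rewrite ler_wpM2l ?alc // ltW.
  have := @jump_algebra R c (1 - eps) M dl (tau G v) s _ _ (fun S => alpha G S v) (fun S => beta G S v)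
    (fun S => alphat G P S v) (fun S => betat G P S v) c0 e0 Mpos dl0 dlM tau0 (le_trans U3 M0M) s0
    (fun S => alc S v v01) alt (le_trans U4 M0M)
    (fun S => le_trans (Hd S).1 dle) (fun S => le_trans (Hd S).2 dle) aM EM.
  rewrite /W /XR /XL EvR EuR EvL EuL => h; apply: (le_trans h).
  rewrite -/K mulrA [2 * _]mulrC -[leRHS]mulrA; apply: ler_wpM2l (sq2 _ _).
  by rewrite mulr_ge0 // sqr_ge0.
have cX (pu pv : R * R -> R) S p : C1_with p pu pv ->
    {within `[0, 1], continuous (fun v => (pu (0, v) - beta G S v * pv (0, v)) / alpha G S v)}.
  move=> [_ c1 c2 _]; have k1' := continuous_edge c1; have k2' := continuous_edge c2.
  have [ca cb] := gluing_continuous tp S.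
  apply/subspace_continuousP => v v01.
  have C' (k : R -> R) : {within `[0, 1], continuous k} -> k x @[x --> within `[0, 1] (nbhs v)] --> k v.
    by move=> /subspace_continuousP; exact.
  have al0 : alpha G S v != 0 by rewrite -normr_gt0 (lt_le_trans c0) // alc.
  apply: cvgM; last by apply: cvgV => //; exact: C'.
  by apply: cvgB; [exact: C' k1'|apply: cvgM; [exact: C' cb|exact: C' k2']].
have mW : measurable_fun (`]0, 1[ : set R) W.
  have mt := edge_measurable (tau_continuous tp).
  have mR := edge_measurable (cX _ _ PR _ CR); have mL := edge_measurable (cX _ _ PL _ CL).
  by apply: measurable_funM => //; apply: measurable_funX; apply: measurable_funM => //; exact: measurable_funB.
have [cd cd0 dF] := det_lower tp ER.
have mg d : measurable_fun (`[0, 1] : set R) (fun v => g d v ^+ 2).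
  exact: (@measurable_edge R _ fuR fvR _ guR gvR cd CfR CgR cd0 dF _ puR pvR d 0 1 CR).
have mgo d : measurable_fun (`]0, 1[ : set R) (fun v => g d v ^+ 2).
  by apply: measurable_funS (mg d) => //; exact: subset_itv_oo_cc.
have W0 v : v \in `]0, 1[ -> 0 <= W v.
  by move=> vo; rewrite mulr_ge0 ?sqr_ge0 // ltW // (tau_gt0 tp) //; exact: subset_itv_oo_cc vo.
pose aR := sobolev_norm 2 (OmegaS G PR) phi; pose aL := sobolev_norm 2 (OmegaS G PL) phi.
have T d : d = (1, 0) \/ d = (0, 1) ->
   (\int[@lebesgue_measure R]_(v in `]0%R, 1%R[) (g d v ^+ 2)%:E <= Ct%:E * aR ^+ 2)%E.
  move=> Hd; apply: le_trans (HT _ puR pvR phi d CR HpR Hd).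
  apply: ge0_subset_integral => //.
  - by apply/measurable_EFinP; exact: mg.
  - by move=> v _; rewrite lee_fin sqr_ge0.
  - exact: subset_itv_oo_cc.
have IW : (\int[@lebesgue_measure R]_(v in `]0%R, 1%R[) (W v)%:E <=
    (2 * (K * dl ^+ 2))%:E * (Ct%:E * aR ^+ 2 + Ct%:E * aR ^+ 2))%E.
  have k0 : 0 <= 2 * (K * dl ^+ 2) by apply: mulr_ge0 => //; exact: mulr_ge0 K0 (sqr_ge0 _).
  apply: (@le_trans _ _ (\int[@lebesgue_measure R]_(v in `]0%R, 1%R[)
      (2 * (K * dl ^+ 2) * (g (1%R, 0%R) v ^+ 2 + g (0%R, 1%R) v ^+ 2))%:E)%E).
    apply: ae_ge0_le_integral => //.
    - exact/measurable_EFinP.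
    - by move=> v _; rewrite lee_fin mulr_ge0 // addr_ge0 // sqr_ge0.
    - apply/measurable_EFinP; apply: measurable_funM => //.
      by apply: measurable_funD; exact: mgo.
    have := Happ k2 P pr; apply: (@filterS _ _ (ae_filter_ringOfSetsType _)) => v H vo; rewrite lee_fin.
    by apply: pointwise => //; exact: H.
  under eq_integral => v _ do rewrite EFinM EFinD.
  rewrite ge0_integralZl //; last 2 first.
  - by apply: emeasurable_funD; apply/measurable_EFinP; exact: mgo.
  - by move=> v _; rewrite adde_ge0 // lee_fin sqr_ge0.
  apply: lee_wpmul2l; first by rewrite lee_fin.
  rewrite ge0_integralD //.
  - by apply: leeD; apply: T; [left|right].
  - by move=> v _; rewrite lee_fin sqr_ge0.
  - by apply/measurable_EFinP; exact: mgo.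
  - by move=> v _; rewrite lee_fin sqr_ge0.
  - by apply/measurable_EFinP; exact: mgo.
rewrite /L2_Gamma -/aR -/aL.
have -> : (\int[@lebesgue_measure R]_(v in `]0%R, 1%R[) (jump G phi (Fmap G PL (0, v)) ^+ 2 * tau G v)%:E =
   \int[@lebesgue_measure R]_(v in `]0%R, 1%R[) (W v)%:E)%E.
  by apply: eq_integral => v; rewrite inE => vo; rewrite jumpE.
apply: le_sqrte_scale.
- by rewrite mulr_ge0 // addr_ge0.
- by apply: integral_ge0 => v vo; rewrite lee_fin W0.
- by rewrite adde_ge0 // sqre_ge0.
apply: (le_trans IW).
apply: (double_scale (sqr_ge0 _) (sqre_ge0 _) (sqre_ge0 _) (ltW Ct0)).
have -> : 2 * (K * dl ^+ 2) * (Ct + Ct) = C0 * hp ^+ 2 by rewrite /C0 /dl; ring.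
by rewrite exprMn ler_wpM2r ?sqr_ge0 // sqC.
Qed.
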